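(* (i) Let $G$ be one of the classical groups $\mathrm{Sp}_{2n}(\mathbb{R})$, or $\mathrm{SO}(p,q)(\mathbb{R})$ with $p+q$ odd. The $L$-group of $G$ comes equipped with a natural embedding of the dual group $\widehat G$ in $\mathrm{SL}_m(\mathbb{C})$ (with $\widehat G=\mathrm{SO}_{2n+1}(\mathbb{C})$, $m=2n+1$ in the first case, and $\widehat G=\mathrm{Sp}_{p+q-1}(\mathbb{C})$, $m=p+q-1$ in the second). An $A$-parameter for $G$ is cohomological if and only if, considered as a parameter with values in $\mathrm{SL}_m(\mathbb{C})$, it is a cohomological $A$-parameter for $\mathrm{PGL}_m(\mathbb{R})$. Further, a cohomological parameter for $\mathrm{PGL}_m(\mathbb{R})$ is automatically a parameter (hence a cohomological parameter) for the symplectic group if $m$ is odd (i.e. it takes values in $\mathrm{SO}_m(\mathbb{C})$ up to conjugacy), and for the odd orthogonal group if $m$ is even (i.e. it takes values in $\mathrm{Sp}_m(\mathbb{C})$ up to conjugacy). (ii) If $G=\mathrm{U}(p,q)$ and $m=p+q$, then an $A$-parameter for $\mathrm{U}(p,q)(\mathbb{R})$ is cohomological if and only if its restriction to $W_{\mathbb{C}}$ (i.e. to $W_{\mathbb C}\times \mathrm{SL}_2(\mathbb C)$, with values in $\mathrm{GL}_m(\mathbb{C})$) is a cohomological $A$-parameter for $\mathrm{GL}_m(\mathbb{C})$.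
   Context: $W_{\mathbb{C}}=\mathbb{C}^\times$ and $W_{\mathbb{R}}=\mathbb{C}^\times\cdot\langle j\rangle$ with $j^2=-1$, $jzj^{-1}=\bar z$. For a connected reductive group $G$ over $\mathbb{R}$, the $L$-group is ${}^LG=\widehat{G}\rtimes W_{\mathbb{R}}$, with $\widehat{G}\supset\widehat B\supset\widehat T$ the complex dual group with pinned Borel and maximal torus, preserved by $W_{\mathbb{R}}$, which acts through $\mathrm{Gal}(\mathbb{C}/\mathbb{R})$; $X^*(T)=X_*(\widehat T)$. For $\mathrm{Sp}_{2n}$, $\mathrm{SO}(p,q)$ with $p+q$ odd and $\mathrm{PGL}_m$ this action is trivial (the dual group of $\mathrm{PGL}_m$ is $\mathrm{SL}_m(\mathbb C)$); parameters are thus identified with homomorphisms into $\widehat G$. An $A$-parameter for $G$ is an admissible homomorphism $\psi:W_{\mathbb{R}}\times \mathrm{SL}_2(\mathbb{C})\to{}^LG$ (continuous, over $W_{\mathbb{R}}$, semisimple on $W_{\mathbb{R}}$, algebraic on $\mathrm{SL}_2(\mathbb{C})$) whose restriction to $W_{\mathbb{R}}$ has bounded image in $\widehat{G}$; parameters are taken up to $\widehat G$-conjugacy. Infinitesimal character: the $L$-parameter attached to $\psi$ is $w\mapsto\psi(w,\mathrm{diag}(|w|^{1/2},|w|^{-1/2}))$, where $|z|=z\bar z$ for $z\in\mathbb{C}^\times$ and $|j|=1$. After conjugation its restriction to $\mathbb{C}^\times$ is $z\mapsto z^{\lambda}\bar z^{\mu}\in\widehat T$ with $\lambda,\mu\in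 X_*(\widehat T)\otimes\mathbb{C}$, $\lambda-\mu\in X_*(\widehat T)$; the infinitesimal character of $\psi$ is the Weyl group orbit of $\lambda$. The infinitesimal character of the irreducible finite-dimensional algebraic representation of $G(\mathbb{C})$ of highest weight $\lambda_0\in X^*(T)=X_*(\widehat T)$ is the orbit of $\lambda_0+\check\rho_{\widehat G}$, with $\check\rho_{\widehat G}$ half the sum of the positive coroots of $\widehat G$. A cohomological $A$-parameter for $G$ (or $G(\mathbb{R})$) is an $A$-parameter with the infinitesimal character of a finite-dimensional irreducible algebraic representation $V$ of $G(\mathbb{C})$ with $V\cong V^\theta$, where $\theta$ is (the algebraic extension of) a Cartan involution on $G(\mathbb{R})$. For the complex group $\mathrm{GL}_m(\mathbb{C})$, viewed as a real group by restriction of scalars, $A$-parameters are identified by restriction with homomorphisms $\psi:W_{\mathbb{C}}\times\mathrm{SL}_2(\mathbb{C})\to\mathrm{GL}_m(\mathbb{C})$ (bounded on $W_{\mathbb C}$). If $\psi(z,\mathrm{diag}((z\bar z)^{1/2},(z\bar z)^{-1/2}))=z^{\lambda}\bar z^{\mu}$, the infinitesimal character is the pair $(\lambda,\mu)$ up to $W\times W$, $W$ the Weyl group of $\mathrm{GL}_m$. The finite-dimensional irreducible representations of $\mathrm{GL}_m(\mathbb{C})$ (as a real group) invariant under a Cartan involution are $V_a\otimes\overline{V_a}^{\vee}$ with $V_a$ algebraic of highest weight $a$; this has infinitesimal character $(a+\rho,-(a+\rho))$ up to $W\times W$, $\rho$ half the sum of positive roots. *)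

(* Defs.v *)
From HB Require Import structures.
From mathcomp Require Import all_boot all_order all_algebra.
From mathcomp Require Import all_classical all_reals all_analysis.
From mathcomp Require Import complex.
(* Required without Import: its notations clash with those of the analysis
   library, [Import -(notations) mpoly] gives access to its instances. *)
From mathcomp Require mpoly.

Set Implicit Arguments.
Unset Strict Implicit.
Unset Printing Implicit Defensive.

Import Order.TTheory GRing.Theory Num.Theory.
Import numFieldNormedType.Exports.

Local Open Scope classical_set_scope.
Local Open Scope ring_scope.

(* The field R[i], typed so that its norm topology and the product topology on
   matrices over it are inferred. *)
Definition Cx (R : realType) : numClosedFieldType := R[i].

(* Subgroups of GL_N(C) are sets of N x N matrices; maps defined on such a
   group are functions on all matrices, of which only the values on the group
   matter. *)

Section WeilGroup.
Variable R : realType.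
Local Notation C := (Cx R).

(* (z, e) stands for z j^e; the elements of W_R are the pairs with z != 0. *)
Definition weil : Type := (C * bool)%type.

Definition WR : set weil := [set w | w.1 != 0].

(* z j^e y j^f = z (j^e y j^-e) j^(e+f), where j y j^-1 is the conjugate of y
   and j^2 = -1. *)
Definition mulW (w w' : weil) : weil :=
  (w.1 * (if w.2 then w'.1^* else w'.1) * (-1) ^+ (w.2 && w'.2), w.2 (+) w'.2).

(* |z| = z z^* on C^*, extended by |j| = 1. *)
Definition absW (w : weil) : C := w.1 * w.1^*.

Definition SL2 : set 'M[C]_2 := [set x | \det x = 1].

Definition diag2 (a b : C) : 'M[C]_2 :=
  \matrix_(i, j) (if i == j then if i == 0 then a else b else 0).

End WeilGroup.

Section Characters.
Variable R : realType.
Local Notation C := (Cx R).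

(* r^s for r > 0 and s complex *)
Definition cpowR (r : R) (s : C) : C :=
  ((expR (complex.Re s * ln r))%:C)%C *
  (cos (complex.Im s * ln r) +i* sin (complex.Im s * ln r))%C.

(* z^l conj(z)^mu, where l - mu = k is an integer, i.e. z^k (z conj(z))^mu *)
Definition zpow (k : int) (mu : C) (z : C) : C :=
  z ^ k * cpowR (complex.Re (z * z^*)) mu.

Definition zpow_mx m (k : 'rV[int]_m) (mu : 'rV[C]_m) (z : C) : 'M[C]_m :=
  diag_mx (\row_i zpow (k 0 i) (mu 0 i) z).

End Characters.

(* In a subgroup Gd of GL_m(C) such as those below, the diagonal matrices and
   the upper triangular matrices form a maximal torus and a Borel subgroup.
   Cocharacters of this torus are written in the coordinates Z^m. *)
Section Torus.
Variables (R : realType) (m : nat) (Gd : set 'M[Cx R]_m).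
Local Notation C := (Cx R).

Definition torus : set 'M[C]_m := [set t | Gd t /\ is_diag_mx t].

Definition cochar (k : 'rV[int]_m) : Prop :=
  forall z : C, z != 0 -> torus (diag_mx (\row_i (z ^ k 0 i))).

(* X_*(T) (x) C, inside C^m *)
Definition cocharC (l : 'rV[C]_m) : Prop :=
  exists (r : nat) (c : 'I_r -> C) (x : 'I_r -> 'rV[int]_m),
    (forall i, cochar (x i)) /\
    l = \sum_i c i *: map_mx (fun k : int => k%:~R) (x i).

(* l' is in the orbit of l under the Weyl group N(T)/T, acting on
   X_*(T) (x) C = Lie(T) by conjugation. *)
Definition weyl_orbit (l l' : 'rV[C]_m) : Prop :=
  exists2 n : 'M[C]_m,
    Gd n /\ (forall t, torus t <-> torus (n *m t *m invmx n)) &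
    n *m diag_mx l *m invmx n = diag_mx l'.

End Torus.

Section AlgebraicRepresentations.
Variables (R : realType) (N : nat) (G : set 'M[Cx R]_N).
Local Notation C := (Cx R).

(* f is the restriction to G of an element of C[x_ij, 1/det]. *)
Definition regular_on (f : 'M[C]_N -> C) : Prop :=
  exists (p : mpoly.mpoly (N * N) C) (k : nat),
    forall g, G g -> f g = mpoly.meval (fun s => mxvec g 0 s) p / \det g ^+ k.

Definition alg_rep d (rho : 'M[C]_N -> 'M[C]_d) : Prop :=
  [/\ forall g, G g -> rho g \in unitmx,
      forall g h, G g -> G h -> rho (g *m h) = rho g *m rho h &
      forall i j, regular_on (fun g => rho g i j)].

(* rho acts on column vectors, whence the transpose: a subspace of C^d is the
   row space of a matrix U. *)
Definition irreducible d (rho : 'M[C]_N -> 'M[C]_d) : Prop :=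
  (0 < d)%N /\
  forall U : 'M[C]_d, (forall g, G g -> stablemx U (rho g)^T) ->
    U = 0 \/ row_full U.

Definition rep_iso d (rho rho' : 'M[C]_N -> 'M[C]_d) : Prop :=
  exists2 P : 'M[C]_d, P \in unitmx & forall g, G g -> P *m rho g = rho' g *m P.

End AlgebraicRepresentations.

(* A real reductive group with its dual group. The complex points are
   [cpoints / ckernel], and likewise for the real points (a nontrivial kernel
   only occurs for PGL_m). The Cartan involution is g |-> (g^* )^-1 on
   the real points, which are stable under conjugate transposition; [theta] is
   its algebraic extension. *)
Record real_group (R : realType) := RealGroup {
  gsize : nat;
  cpoints : set 'M[Cx R]_gsize;
  ckernel : set 'M[Cx R]_gsize;
  rpoints : set 'M[Cx R]_gsize;
  theta : 'M[Cx R]_gsize -> 'M[Cx R]_gsize;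
  theta_cartan : forall g, rpoints g ->
    theta g = invmx (map_mx Num.conj g)^T;
  (* the h such that the h b h^-1 in [cpoints] with b upper triangular form a
     Borel subgroup, with the diagonal b giving a maximal torus *)
  frames : set 'M[Cx R]_gsize;
  dsize : nat;
  dual : set 'M[Cx R]_dsize;
  (* the action of j on the dual group; C^* acts trivially *)
  gal : 'M[Cx R]_dsize -> 'M[Cx R]_dsize;
  (* half the sum of the positive coroots of the dual group *)
  drho : 'rV[Cx R]_dsize;
  (* characters of the torus of G are given by the first [grank] coordinates
     of cocharacters of the torus of the dual group *)
  grank : nat
}.

Section ArthurParams.
Variables (R : realType) (G : real_group R).
Local Notation C := (Cx R).
Local Notation m := (dsize G).

Definition Lgroup : Type := ('M[C]_m * weil R)%type.

Definition actL (w : weil R) (g : 'M[C]_m) : 'M[C]_m :=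
  if w.2 then gal g else g.

Definition mulL (x y : Lgroup) : Lgroup :=
  (x.1 *m actL x.2 y.1, mulW x.2 y.2).

Definition conjL (h : 'M[C]_m) (x : Lgroup) : Lgroup :=
  mulL (mulL (h, (1, false)) x) (invmx h, (1, false)).

(* Image of x under the faithful representation of dual G ><| Gal(C/R)
   induced from the standard representation of dual G; x is semisimple iff
   this image is diagonalizable. *)
Definition Lrep (x : Lgroup) : 'M[C]_(m + m) :=
  if x.2.2 then block_mx 0 x.1 (gal x.1) 0 else block_mx x.1 0 0 (gal x.1).

Definition semisimpleL (x : Lgroup) : Prop := diagonalizable (Lrep x).

Definition parameter : Type := weil R -> 'M[C]_2 -> Lgroup.

Definition A_parameter (psi : parameter) : Prop :=
  (forall w x, WR w -> SL2 x -> dual (psi w x).1 /\ (psi w x).2 = w) /\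
  [/\ forall w w' x x', WR w -> WR w' -> SL2 x -> SL2 x' ->
        psi (mulW w w') (x *m x') = mulL (psi w x) (psi w' x'),
      forall e : bool,
        {within [set p : C * 'M[C]_2 | p.1 != 0 /\ SL2 p.2],
          continuous (fun p : C * 'M[C]_2 => (psi (p.1, e) p.2).1)},
      forall w, WR w -> semisimpleL (psi w 1%:M),
      forall i j, regular_on (@SL2 R) (fun x => (psi (1, false) x).1 i j) &
      exists M : C, forall w i j, WR w -> `|(psi w 1%:M).1 i j| <= M].

Definition conj_param (h : 'M[C]_m) (psi : parameter) : parameter :=
  fun w x => conjL h (psi w x).

Definition L_parameter (psi : parameter) (w : weil R) : Lgroup :=
  psi w (diag2 (sqrtC (absW w)) (sqrtC (absW w))^-1).

(* l lies in the infinitesimal character of psi *)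
Definition in_inf_char (psi : parameter) (l : 'rV[C]_m) : Prop :=
  exists (h : 'M[C]_m) (l0 mu0 : 'rV[C]_m) (k : 'rV[int]_m),
    [/\ dual h,
        [/\ cocharC (@dual _ G) l0, cocharC (@dual _ G) mu0,
            cochar (@dual _ G) k & l0 - mu0 = map_mx (fun a : int => a%:~R) k],
        forall z : C, z != 0 ->
          (conjL h (L_parameter psi (z, false))).1 = zpow_mx k mu0 z &
        weyl_orbit (@dual _ G) l0 l].

Definition weight_char (l : 'rV[int]_m) (b : 'M[C]_(gsize G)) : C :=
  \prod_(i < gsize G | (i < grank G)%N)
    \prod_(j < m | j == i :> nat) b i i ^ l 0 j.

Definition has_highest_weight d (rho : 'M[C]_(gsize G) -> 'M[C]_d)
    (l : 'rV[int]_m) : Prop :=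
  exists2 h : 'M[C]_(gsize G), frames h &
  exists2 v : 'cV[C]_d, v != 0 &
    forall b, is_trig_mx b^T -> cpoints (h *m b *m invmx h) ->
      rho (h *m b *m invmx h) *m v = weight_char l b *: v.

(* a finite-dimensional irreducible algebraic representation of G(C) *)
Definition irrep d (rho : 'M[C]_(gsize G) -> 'M[C]_d) : Prop :=
  [/\ alg_rep (@cpoints _ G) rho, irreducible (@cpoints _ G) rho &
      forall z, ckernel z -> rho z = 1%:M].

Definition cohomological (psi : parameter) : Prop :=
  A_parameter psi /\
  exists (d : nat) (rho : 'M[C]_(gsize G) -> 'M[C]_d) (l : 'rV[int]_m),
    [/\ irrep rho,
        rep_iso (@cpoints _ G) rho (fun g => rho (theta g)),
        cochar (@dual _ G) l /\ has_highest_weight rho l &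
        in_inf_char psi (map_mx (fun a : int => a%:~R) l + drho G)].

End ArthurParams.

Section ClassicalGroups.
Variable R : realType.
Local Notation C := (Cx R).

Definition GL m : set 'M[C]_m := [set g | g \in unitmx].
Definition SL m : set 'M[C]_m := [set g | \det g = 1].
Arguments GL : clear implicits.
Arguments SL : clear implicits.

Definition real_mx m (g : 'M[C]_m) : Prop := map_mx Num.conj g = g.

(* The antidiagonal form with alternating signs: symmetric for m odd,
   alternating for m even. *)
Definition antidiag m : 'M[C]_m :=
  \matrix_(i, j) (if j == rev_ord i then (-1) ^+ i else 0).
Arguments antidiag : clear implicits.

(* the form with matrix diag(1, .., 1, -1, .., -1) *)
Definition Ipq p q : 'M[C]_(p + q) := block_mx 1%:M 0 0 (- 1%:M).

Definition special_isometries m (J : 'M[C]_m) : set 'M[C]_m :=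
  [set g | g *m J *m g^T = J /\ \det g = 1].

(* SO_m(C) for m odd, Sp_m(C) for m even *)
Definition classical m : set 'M[C]_m := special_isometries (antidiag m).
Arguments classical : clear implicits.

Definition scalars m : set 'M[C]_m := [set g | exists2 c : C, c != 0 & g = c%:M].
Arguments scalars : clear implicits.

(* The automorphism of GL_m preserving the standard pinning. *)
Definition pinned_aut m (g : 'M[C]_m) : 'M[C]_m :=
  antidiag m *m invmx g^T *m invmx (antidiag m).

Definition ev m (i : 'I_m) : 'rV[C]_m := delta_mx 0 i.
(* the i-th basis vector of X_*(T) for T the torus of [classical m], i < m./2 *)
Definition fv m (i : 'I_m) : 'rV[C]_m := ev i - ev (rev_ord i).

Definition rhoGL m : 'rV[C]_m :=
  2^-1 *: \sum_(i < m) \sum_(j < m | (i < j)%N) (ev i - ev j).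
Arguments rhoGL : clear implicits.

(* The positive coroots are f_i - f_j, f_i + f_j (i < j), and 2 f_i for SO_m,
   m odd, f_i for Sp_m, m even. *)
Definition rho_classical m : 'rV[C]_m :=
  2^-1 *: (\sum_(i < m | (i < m./2)%N) \sum_(j < m | (i < j < m./2)%N)
             ((fv i - fv j) + (fv i + fv j))
           + \sum_(i < m | (i < m./2)%N) fv i *+ (if odd m then 2 else 1)).
Arguments rho_classical : clear implicits.

Lemma cartan_opp_inv_tr m (g : 'M[C]_m) :
  real_mx g -> invmx g^T = invmx (map_mx Num.conj g)^T.
Proof. by move=> ->. Qed.

Lemma Ipq_sq p q : Ipq p q *m Ipq p q = 1%:M.
Proof.
rewrite /Ipq mulmx_block !mulmx1 !mul1mx !mulmx0 !mul0mx.
by rewrite !addr0 add0r mulmxN mulmx1 opprK -scalar_mx_block.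
Qed.

Lemma cartan_Ipq p q (g : 'M[C]_(p + q)) :
  g *m Ipq p q *m (map_mx Num.conj g)^T = Ipq p q ->
  Ipq p q *m g *m Ipq p q = invmx (map_mx Num.conj g)^T.
Proof.
move=> gI; set h := (map_mx _ g)^T in gI *.
have Ih : Ipq p q *m g *m Ipq p q *m h = 1%:M.
  by rewrite -2!mulmxA [g *m _]mulmxA gI Ipq_sq.
have [_ hu] := mulmx1_unit Ih.
by rewrite -[LHS](mulmxK hu) Ih mul1mx.
Qed.

Lemma cartan_SO p q (g : 'M[C]_(p + q)) :
  real_mx g /\ special_isometries (Ipq p q) g ->
  Ipq p q *m g *m Ipq p q = invmx (map_mx Num.conj g)^T.
Proof. by move=> [gr [gI _]]; apply: cartan_Ipq; rewrite gr. Qed.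

Definition Sp2n (n : nat) : real_group R := {|
  gsize := n.*2;
  cpoints := classical n.*2;
  ckernel := [set 1%:M];
  rpoints := [set g | real_mx g /\ classical n.*2 g];
  theta := fun g => invmx g^T;
  theta_cartan := fun g gr => cartan_opp_inv_tr (proj1 gr);
  frames := [set 1%:M];
  dsize := n.*2.+1;
  dual := classical n.*2.+1;
  gal := id;
  drho := rho_classical n.*2.+1;
  grank := n |}.

(* For p + q odd. *)
Definition SO (p q : nat) : real_group R := {|
  gsize := p + q;
  cpoints := special_isometries (Ipq p q);
  ckernel := [set 1%:M];
  rpoints := [set g | real_mx g /\ special_isometries (Ipq p q) g];
  theta := fun g => Ipq p q *m g *m Ipq p q;
  theta_cartan := @cartan_SO p q;
  frames := [set h | h *m antidiag (p + q) *m h^T = Ipq p q];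
  dsize := (p + q).-1;
  dual := classical (p + q).-1;
  gal := id;
  drho := rho_classical (p + q).-1;
  grank := (p + q)./2 |}.

Definition PGL (m : nat) : real_group R := {|
  gsize := m;
  cpoints := GL m;
  ckernel := scalars m;
  rpoints := [set g | real_mx g /\ GL m g];
  theta := fun g => invmx g^T;
  theta_cartan := fun g gr => cartan_opp_inv_tr (proj1 gr);
  frames := [set 1%:M];
  dsize := m;
  dual := SL m;
  gal := id;
  drho := rhoGL m;
  grank := m |}.

Definition U (p q : nat) : real_group R := {|
  gsize := p + q;
  cpoints := GL (p + q);
  ckernel := [set 1%:M];
  rpoints := [set g | g *m Ipq p q *m (map_mx Num.conj g)^T = Ipq p q];
  theta := fun g => Ipq p q *m g *m Ipq p q;
  theta_cartan := @cartan_Ipq p q;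
  frames := [set 1%:M];
  dsize := p + q;
  dual := GL (p + q);
  gal := @pinned_aut (p + q);
  drho := rhoGL (p + q);
  grank := p + q |}.

End ClassicalGroups.

Arguments GL : clear implicits.
Arguments SL : clear implicits.
Arguments PGL : clear implicits.
Arguments Sp2n : clear implicits.
Arguments SO : clear implicits.
Arguments U : clear implicits.

(* The complex group GL_m(C), viewed as a real group. *)
Section ComplexGL.
Variables (R : realType) (m : nat).
Local Notation C := (Cx R).

Definition C_parameter : Type := C -> 'M[C]_2 -> 'M[C]_m.

Definition A_parameter_GLC (psi : C_parameter) : Prop :=
  (forall z x, z != 0 -> SL2 x -> GL R m (psi z x)) /\
  [/\ forall z z' x x', z != 0 -> z' != 0 -> SL2 x -> SL2 x' ->
        psi (z * z') (x *m x') = psi z x *m psi z' x',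
      {within [set p : C * 'M[C]_2 | p.1 != 0 /\ SL2 p.2],
        continuous (fun p : C * 'M[C]_2 => psi p.1 p.2)},
      forall z, z != 0 -> diagonalizable (psi z 1%:M),
      forall i j, regular_on (@SL2 R) (fun x => psi 1 x i j) &
      exists M : C, forall z i j, z != 0 -> `|psi z 1%:M i j| <= M].

(* (l, mu) lies in the infinitesimal character of psi, a W x W-orbit *)
Definition in_inf_char_GLC (psi : C_parameter) (l mu : 'rV[C]_m) : Prop :=
  exists (h : 'M[C]_m) (l0 mu0 : 'rV[C]_m) (k : 'rV[int]_m),
    [/\ h \in unitmx,
        l0 - mu0 = map_mx (fun a : int => a%:~R) k,
        forall z : C, z != 0 ->
          h *m psi z (diag2 (sqrtC (z * z^*)) (sqrtC (z * z^*))^-1) *m invmx h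
            = zpow_mx k mu0 z,
        weyl_orbit (GL R m) l0 l & weyl_orbit (GL R m) mu0 mu].

(* The irreducible representations of GL_m(C) invariant under a Cartan
   involution are the V_a (x) conj(V_a)^\vee, of infinitesimal character
   (a + rho, -(a + rho)), with V_a algebraic of highest weight a. *)
Definition cohomological_GLC (psi : C_parameter) : Prop :=
  A_parameter_GLC psi /\
  exists (d : nat) (Va : 'M[C]_m -> 'M[C]_d) (a : 'rV[int]_m),
    [/\ alg_rep (GL R m) Va, irreducible (GL R m) Va,
        exists2 v : 'cV[C]_d, v != 0 &
          forall b, is_trig_mx b^T -> GL R m b ->
            Va b *m v = (\prod_i b i i ^ a 0 i) *: v &
        let l := map_mx (fun a : int => a%:~R) a + rhoGL R m in
        in_inf_char_GLC psi l (- l)].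

End ComplexGL.

Definition restr_WC (R : realType) (p q : nat) (psi : parameter (U R p q)) :
    C_parameter R (p + q) :=
  fun z x => (psi (z, false) x).1.

(* Main.v *)
Require Import Defs.
From mathcomp Require Import all_boot all_order all_algebra.
From mathcomp Require Import all_classical all_reals all_analysis.
From mathcomp Require Import perm spectral ring lra zify complex mxtens.
From mathcomp Require mpoly.
Import -(notations) mpoly.

Set Implicit Arguments.
Unset Strict Implicit.
Unset Printing Implicit Defensive.

Import Order.TTheory GRing.Theory Num.Theory.
Import numFieldNormedType.Exports.

Local Open Scope ring_scope.

                                                                  
                                                                             
                                                                         

                                                                              
                                                                           
                                                                          
                                                                          
                                                                            
                                                                         
                                                                              
                                                                         

                                                                          
                                                                     
                                                                           
                                                                            
                                                                              
                                                                      
                                       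

                                                                           
                                                                               
                       

                          

(** In part (i) everything is read in $m$ coordinates. Cocharacters of the torus of $\widehat G$ are
    the integer vectors antisymmetric under reversal ([cochar_classical],
    [cochar_classical_antisym]), and $\check\rho_{\widehat G}$ coincides with $\rho$ of
    $\mathrm{GL}_m$ ([rho_classicalE]). One dominant $l$ therefore gives the same $\lambda = l+\rho$
    for $G$ and for $\mathrm{PGL}_m$, and $2\lambda$ is a strictly decreasing sequence of integers
    ([reg]). As $\lambda$ is regular, $\psi$ can be conjugated so that its $L$-parameter on
    $\mathbb{C}^\times$ is diagonal, equal to $z^\lambda\bar z^\mu$ ([torus_form]). This form passes
    from the classical group to $\mathrm{SL}_m$ ([cohomological_PGL]). Conversely, if $\psi$ has
    classical values and $h\in\mathrm{SL}_m$ diagonalizes it, the form $A = hJh^T$ is preserved by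
    the resulting diagonal matrices. So $A_{ij}\neq 0$ forces the characters at $i$ and $j$ to be
    inverse, and strict decrease of $\lambda$ forces $j$ to be the reversal of $i$. Hence $l$ is
    antisymmetric, and a diagonal rescaling moves $h$ into the classical group
    ([cohomological_of_PGL]).

    That a cohomological parameter of $\mathrm{PGL}_m$ is orthogonal or symplectic rests on
    multiplicity one. Boundedness gives $2\lambda_i = k_i + w_i$, with $k_i$ the exponent of $z/|z|$
    (usual absolute value) and $w_i$ the $\mathrm{SL}_2$-weight ([regE_weights]), so the pairs
    $(k_i,w_i)$ are distinct. The element $(j, W)$, with $W$ the Weyl element of $\mathrm{SL}_2$,
    negates both, so it acts by an antidiagonal matrix $N$ ([weights_rev]). The anti-involution
    $\tau(w,x) = (jw^{-1}j^{-1}, x^T)$ fixes the torus characters, and a comparison of matrix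
    coefficients shows that $\psi\circ\tau$ and the transpose of $\psi$ are related by a diagonal
    matrix $P$ ([contragredient], [M_adjoint]). Then $PN$ is an invariant bilinear form, and its
    symmetry sign is that of $N^2 = (-1)^{m-1}$ ([invariant_form], [jW_sq]). Diagonal scaling turns
    it into $J$ ([PGL_to_classical]).

    The representations on both sides must also be supplied. A highest weight is shown dominant by
    restriction to root subgroups $\mathrm{SL}_2$ ([SL2_dominance], [classical_hw_dominant]).
    Conversely, dominant weights of $\mathrm{GL}_N$ are realised in tensor products compatible with
    conjugate transposition, where invariant subspaces have invariant complements ([GLhw_dominant],
    [irr_constituent]); the other groups follow by restriction. Invariance under $\theta$ holds for
    $\mathrm{Sp}_{2n}$ and $\mathrm{SO}(p,q)$ because $\theta$ is inner on complex points, and for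
    $\mathrm{PGL}_m$ by comparing one matrix coefficient on the big cell ([coef_pinned_aut],
    [GL_rep_iso_opp_inv_tr]).

    In part (ii) $\theta$ is again inner. The relation $jz = \bar zj$ makes $\psi(\bar z)$ conjugate
    to the dual of $\psi(z)$, so $\mu$ lies in the Weyl orbit of $-\lambda$
    ([U_infinitesimal_character]), which is what the pair $(\lambda,-\lambda)$ on the
    $\mathrm{GL}_m(\mathbb{C})$ side asks for. *)

(** * Regular functions on matrix groups and identities along curves *)

Section Regular.
Variables (R : realType) (N : nat).
Local Notation C := (Cx R).
Local Notation GLN := (GL R N).
Implicit Types (G : set 'M[C]_N) (f : 'M[C]_N -> C).

Lemma regular_sub G G' f : (forall g, G g -> G' g) ->
  regular_on G' f -> regular_on G f.
Proof. by move=> GG' [p [k fE]]; exists p, k => g /GG' /fE. Qed.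

Lemma regular_ext G f f' : (forall g, G g -> f g = f' g) ->
  regular_on G f -> regular_on G f'.
Proof. by move=> ff' [p [k fE]]; exists p, k => g Gg; rewrite -ff' // fE. Qed.

Lemma regular_entry G i j : regular_on G (fun g => g i j).
Proof.
exists (mpolyX C (mnm1 (mxvec_index i j))), 0 => g _.
by rewrite expr0 divr1 mevalXU mxvecE.
Qed.

Lemma regular_cst G c : regular_on G (fun=> c).
Proof. by exists (mpolyC _ c), 0 => g _; rewrite mevalC expr0 divr1. Qed.

Lemma regular_mul G f f' : regular_on G f -> regular_on G f' ->
  regular_on G (fun g => f g * f' g).
Proof.
move=> [p [k fE]] [p' [k' f'E]]; exists (p * p'), (k + k')%N => g Gg.
by rewrite fE // f'E // mevalM exprD invfM; ring.
Qed.

Let detP : mpoly (N * N) C :=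
  \det (\matrix_(i, j) mpolyX C (mnm1 (mxvec_index i j)) : 'M[mpoly (N * N) C]_N).

Let detPE g : meval (fun s => mxvec g 0 s) detP = \det g.
Proof.
rewrite /detP -det_map_mx; congr (\det _).
by apply/matrixP=> i j; rewrite !mxE /= mevalXU mxvecE.
Qed.

Lemma regular_add G f f' : (forall g, G g -> g \in unitmx) ->
  regular_on G f -> regular_on G f' -> regular_on G (fun g => f g + f' g).
Proof.
move=> GU [p [k fE]] [p' [k' f'E]].
exists (p * detP ^+ k' + p' * detP ^+ k), (k + k')%N => g Gg.
have d0 : \det g != 0 by rewrite -unitfE -unitmxE GU.
rewrite fE // f'E // mevalD !mevalM !rmorphXn /= detPE exprD invfM.
by rewrite -[in LHS](mulfK (expf_neq0 k' d0) (_ / _)) -[X in _ + X](mulfK (expf_neq0 k d0)); ring.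
Qed.

Lemma regular_sum G (I : Type) (r : seq I) (F : I -> 'M[C]_N -> C) :
  (forall g, G g -> g \in unitmx) -> (forall i, regular_on G (F i)) ->
  regular_on G (fun g => \sum_(i <- r) F i g).
Proof.
move=> GU Fr; elim: r => [|i r IH].
  by apply: regular_ext (regular_cst _ 0) => g _; rewrite big_nil.
by apply: regular_ext (regular_add GU (Fr i) IH) => g _; rewrite big_cons.
Qed.

Lemma regular_prod G (I : Type) (r : seq I) (F : I -> 'M[C]_N -> C) :
  (forall i, regular_on G (F i)) ->
  regular_on G (fun g => \prod_(i <- r) F i g).
Proof.
move=> Fr; elim: r => [|i r IH].
  by apply: regular_ext (regular_cst _ 1) => g _; rewrite big_nil.
by apply: regular_ext (regular_mul (Fr i) IH) => g _; rewrite big_cons.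
Qed.

Lemma regular_exp_det (k : int) : regular_on GLN (fun g => \det g ^ k).
Proof.
case: k => k; first by exists (detP ^+ k), 0 => g _; rewrite rmorphXn /= detPE expr0 divr1.
by exists 1, k.+1 => g _; rewrite meval1 mul1r NegzE -exprnN.
Qed.

(** Replaces Zariski density in several variables: along a polynomial curve a regular function is a
    polynomial over a power of the determinant, so one-variable polynomial identities suffice. *)
Lemma regular_curve G f (gt : 'M[{poly C}]_N) : regular_on G f ->
  exists (P : {poly C}) (k : nat), forall t,
    let g := map_mx (horner_eval t) gt in G g -> f g = P.[t] / \det g ^+ k.
Proof.
move=> [p [k fE]].
exists (\sum_(m <- msupp p) (mcoeff m p)%:P * \prod_i (mxvec gt 0 i) ^+ (m i)), k.
move=> t g Gg; rewrite fE //; congr (_ / _).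
rewrite mevalE horner_sum; apply: eq_bigr => m _.
rewrite hornerM hornerC horner_prod; congr (_ * _); apply: eq_bigr => i _.
by rewrite horner_exp /g -map_mxvec mxE.
Qed.

End Regular.

(** The product $S(P-Q)$ vanishes everywhere, in particular at more integers than its degree
    allows. *)
Lemma poly_eq_inf (F : numFieldType) (P Q : {poly F}) (S : {poly F}) :
  S != 0 -> (forall t, S.[t] != 0 -> P.[t] = Q.[t]) -> P = Q.
Proof.
move=> S0 PQ; suff: S * (P - Q) == 0 by rewrite mulf_eq0 (negPf S0) subr_eq0 => /eqP.
set T := S * _; apply/negPn/negP => T0.
pose rs := [seq (i%:R : F) | i <- iota 0 (size T)].
have := max_poly_roots (p := T) T0 (rs := rs); rewrite size_map size_iota ltnn => H.
suff: false by []; apply: H.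
  apply/allP => x _; rewrite /root /T hornerM hornerD hornerN.
  have [->|/PQ ->] := eqVneq S.[x] 0; first by rewrite mul0r.
  by rewrite subrr mulr0.
by rewrite map_inj_uniq ?iota_uniq // => i j /eqP; rewrite eqr_nat => /eqP.
Qed.

                          

(** * Characters $z^\lambda\bar z^\mu$ of $\mathbb{C}^\times$ *)

Section ZPow.
Variable R : realType.
Local Notation C := (Cx R).
Implicit Types (r : R) (s mu z : C) (k : int).

Lemma complex_eqP (x y : C) : complex.Re x = complex.Re y ->
  complex.Im x = complex.Im y -> x = y.
Proof. by move=> e1 e2; apply/eqP; rewrite eq_complex e1 e2 !eqxx. Qed.

Lemma cpowRD r s s' : cpowR r (s + s') = cpowR r s * cpowR r s'.
Proof.
rewrite /cpowR (raddfD (@complex.Re R)) (raddfD (@complex.Im R)) /=.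
rewrite !mulrDl expRD cosD sinD.
by apply: complex_eqP => /=; ring.
Qed.

Lemma cpowR0 r : cpowR r 0 = 1.
Proof.
by rewrite /cpowR /= !mul0r expR0 cos0 sin0; apply: complex_eqP => /=; ring.
Qed.

Lemma cpowR1 s : cpowR 1 s = 1.
Proof.
by rewrite /cpowR /= ln1 !mulr0 expR0 cos0 sin0; apply: complex_eqP => /=; ring.
Qed.

Lemma cpowRM r r' s : 0 < r -> 0 < r' -> cpowR (r * r') s = cpowR r s * cpowR r' s.
Proof.
move=> r0 r'0; rewrite /cpowR lnM // !mulrDr expRD cosD sinD.
by apply: complex_eqP => /=; ring.
Qed.

Lemma cpowR_neq0 r s : cpowR r s != 0.
Proof.
apply/eqP => H; have := cpowRD r s (- s).
by rewrite subrr cpowR0 H mul0r => /eqP; rewrite oner_eq0.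
Qed.

Lemma cpowRN r s : cpowR r (- s) = (cpowR r s)^-1.
Proof.
by apply: (mulfI (cpowR_neq0 r s)); rewrite divff ?cpowR_neq0 // -cpowRD subrr cpowR0.
Qed.

Lemma cpowRXz r s k : cpowR r s ^ k = cpowR r (s *~ k).
Proof.
have nat n : cpowR r s ^+ n = cpowR r (s *+ n).
  elim: n => [|n IH]; first by rewrite mulr0n cpowR0 expr0.
  by rewrite exprS mulrS cpowRD IH.
by case: k => n; rewrite ?NegzE -?exprnP ?nat // -exprnN nat mulrNz cpowRN.
Qed.

Lemma cpowR_inj s : (forall r, 0 < r -> cpowR r s = 1) -> s = 0.
Proof.
case: s => a b H.
have {}H x : expR (a * x) * cos (b * x) = 1 /\ sin (b * x) = 0.
  have := H (expR x) (expR_gt0 _).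
  rewrite /cpowR expRK /= => /eqP; rewrite eq_complex /= !mul0r subr0 addr0.
  move=> /andP[/eqP e1 /eqP e2]; split=> //.
  by apply: (mulfI (lt0r_neq0 (expR_gt0 (a * x)))); rewrite mulr0.
have b0 : b = 0.
  (* At $x = \pi/b$ the cosine is $-1$, so a positive exponential would be negative. *)
  apply/eqP/negPn/negP => b0; have [] := H (pi / b).
  rewrite [b * _]mulrC divfK // cospi mulrN1 => e _.
  by have := expR_gt0 (a * (pi / b)); lra.
have [] := H 1; rewrite b0 !mul0r !mulr1 cos0 mulr1 => e _.
by move: e; rewrite -[X in _ = X]expR0 => /expR_inj ->.
Qed.

Lemma normsq_gt0 z : z != 0 -> 0 < complex.Re (z * z^*).
Proof.
move=> z0; have : 0 < z * z^* by rewrite -normCK exprn_gt0 // normr_gt0.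
by rewrite ltcE /= => /andP[].
Qed.

Lemma normsqE z : ((complex.Re (z * z^*))%:C)%C = `|z| ^+ 2.
Proof.
have : 0 <= z * z^* by rewrite -normCK exprn_ge0.
rewrite normCK lecE => /andP[/eqP i0 _].
by apply: complex_eqP => //=.
Qed.

Lemma normsqM z z' :
  complex.Re (z * z' * (z * z')^*) = complex.Re (z * z^*) * complex.Re (z' * z'^*).
Proof.
by apply: (@complexI R); rewrite [RHS]rmorphM /= !normsqE normrM exprMn.
Qed.

Lemma cpowR_norm (z : C) (e : int) : z != 0 ->
  cpowR (complex.Re (z * z^*)) (e%:~R / 2) = `|z| ^ e.
Proof.
move=> z0; pose a : R := complex.Re `|z|.
have zE : `|z| = (a%:C)%C by apply: complex_eqP => //; have := normr_ge0 z; rewrite lecE => /andP[/eqP].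
have a0 : 0 < a by rewrite -ltcR -zE normr_gt0.
have -> : complex.Re (z * z^*) = a * a.
  by apply: (@complexI R); rewrite normsqE zE rmorphM expr2.
rewrite cpowRM // -cpowRD (_ : _ + _ = e%:~R); last by field.
rewrite -[e%:~R]/(1 *~ e) -cpowRXz; congr (_ ^ e).
rewrite zE /cpowR /= mul1r mul0r cos0 sin0 lnK ?posrE //.
by apply: complex_eqP => /=; ring.
Qed.

Lemma zpow_neq0 k mu z : z != 0 -> zpow k mu z != 0.
Proof. by move=> z0; rewrite mulf_neq0 ?cpowR_neq0 // expfz_neq0. Qed.

Lemma zpowMr k k' mu mu' z : z != 0 ->
  zpow k mu z * zpow k' mu' z = zpow (k + k') (mu + mu') z.
Proof. by move=> z0; rewrite /zpow cpowRD expfzDr //; ring. Qed.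

Lemma zpowM k mu z z' : z != 0 -> z' != 0 ->
  zpow k mu (z * z') = zpow k mu z * zpow k mu z'.
Proof.
by move=> z0 z'0; rewrite /zpow normsqM cpowRM ?normsq_gt0 // expfzMl; ring.
Qed.

Lemma zpow00 z : zpow 0 0 z = 1.
Proof. by rewrite /zpow cpowR0 expr0z mulr1. Qed.

Lemma zpowN k mu z : z != 0 -> zpow (- k) (- mu) z = (zpow k mu z)^-1.
Proof.
move=> z0; apply: (mulfI (zpow_neq0 k mu z0)).
by rewrite zpowMr // !subrr zpow00 divff // zpow_neq0.
Qed.

Lemma norm_zpow_half (k e : int) z : z != 0 ->
  zpow k (e%:~R / 2) z = z ^ k * `|z| ^ e.
Proof. by move=> z0; rewrite /zpow cpowR_norm. Qed.

(** Conjugation exchanges the two exponents: with $\lambda = \mu + k$, the character $z^\lambda\bar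
    z^\mu$ becomes $z^\mu\bar z^\lambda$. *)
Lemma zpow_conj k mu z : z != 0 -> zpow k mu z^* = zpow (- k) (mu + k%:~R) z.
Proof.
move=> z0; rewrite /zpow conjCK [z^* * z]mulrC cpowRD.
have -> : k%:~R = (k + k)%:~R / 2 :> C by rewrite intrD; field.
rewrite cpowR_norm // expfzDr ?normr_eq0 // -expfzMl -expr2 normCK expfzMl.
have : z ^ (- k) * z ^ k = 1 by rewrite -expfzDr // addNr expr0z.
by move=> e; rewrite -[LHS]mul1r -e; ring.
Qed.

(** Positive real $z$ give $\mu + k/2 = 0$; then $z$ on the unit circle, written as $r^i$, give $k =
    0$. *)
Lemma zpow_eq1 k mu : (forall z, z != 0 -> zpow k mu z = 1) -> k = 0 /\ mu = 0.
Proof.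
move=> H; have mu0 : mu + k%:~R / 2 = 0.
  apply: cpowR_inj => r r0; pose z : C := ((Num.sqrt r)%:C)%C.
  have z0 : z != 0 by apply/eqP => /(congr1 (@complex.Re R)) /= /eqP; rewrite gt_eqF // sqrtr_gt0.
  have zz : complex.Re (z * z^*) = r.
    apply: (@complexI R); rewrite normsqE /z normc_def /= expr0n /= addr0 sqrtr_sqr.
    by rewrite ger0_norm ?sqrtr_ge0 // -rmorphXn sqr_sqrtr // ltW.
  have nz : `|z| = z by rewrite ger0_norm // /z ler0c sqrtr_ge0.
  by rewrite cpowRD -[r in cpowR r (_ / _)]zz cpowR_norm // nz mulrC -[r in cpowR r _]zz -(H z z0).
have {mu0}muE : mu = - (k%:~R / 2) by apply/eqP; rewrite -addr_eq0 mu0.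
have k0 : k = 0.
  have : 'i *~ k = 0 :> C.
    apply: cpowR_inj => r r0; rewrite -cpowRXz; set z := cpowR r 'i.
    have z0 : z != 0 by exact: cpowR_neq0.
    have nz : `|z| = 1.
      rewrite /z /cpowR -[in LHS]complexiE /= mul0r expR0 mul1r normc_def /= mul1r.
      by rewrite !mul0r mul1r subr0 addr0 cos2Dsin2 sqrtr1.
    have := H z z0; rewrite muE -mulNr -intrN norm_zpow_half // nz exp1rz mulr1 //.
  by move/eqP; rewrite mulrz_eq0 (negPf (neq0Ci _)) orbF => /eqP.
by split=> //; rewrite muE k0 mul0r oppr0.
Qed.

Lemma zpow_inj k k' mu mu' :
  (forall z, z != 0 -> zpow k mu z = zpow k' mu' z) -> k = k' /\ mu = mu'.
Proof.
move=> H; have [|/eqP + /eqP] := @zpow_eq1 (k - k') (mu - mu').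
  by move=> z z0; rewrite -zpowMr // zpowN // H // divff // zpow_neq0.
by rewrite !subr_eq0 => /eqP -> /eqP.
Qed.

Lemma zpow_inv k k' mu mu' :
  (forall z, z != 0 -> zpow k mu z * zpow k' mu' z = 1) -> k' = - k /\ mu' = - mu.
Proof.
move=> H; have [|/eqP + /eqP] := @zpow_eq1 (k + k') (mu + mu').
  by move=> z z0; rewrite -zpowMr // H.
by rewrite addrC addr_eq0 => /eqP ->; rewrite addrC addr_eq0 => /eqP.
Qed.

Lemma zpow_normX k mu (e : int) z : z != 0 ->
  zpow k mu z * `|z| ^ e = zpow k (mu + e%:~R / 2) z.
Proof. by move=> z0; rewrite /zpow -mulrA -cpowR_norm // -cpowRD. Qed.

(** At a positive real $r$ the modulus is $r^{k+2\mathrm{Re}\,\mu}$, unbounded unless the exponent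
    vanishes. *)
Lemma zpow_bounded k mu (M : C) : (forall z, z != 0 -> `|zpow k mu z| <= M) ->
  k%:~R + 2 * complex.Re mu = 0.
Proof.
move=> HM; set e := _ + _; apply/eqP/negPn/negP => e0.
have {HM} H (r : R) : 0 < r -> ((expR (e * ln r))%:C)%C <= M.
  move=> r0; have rn : `|(r%:C)%C : C| = (r%:C)%C by rewrite ger0_norm // ler0c ltW.
  have r0' : (r%:C)%C != 0 :> C by rewrite -normr_gt0 rn ltcR.
  suff <- : `|zpow k mu (r%:C)%C| = ((expR (e * ln r))%:C)%C by exact: HM.
  have sq : complex.Re ((r%:C)%C * ((r%:C)%C : C)^*) = r * r.
    by apply: (@complexI R); rewrite normsqE rn -rmorphXn expr2.
  have -> : zpow k mu (r%:C)%C = cpowR r (k%:~R + (mu + mu)).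
    rewrite /zpow sq cpowRM // -cpowRD [RHS]cpowRD; congr (_ * _).
    rewrite -[k%:~R]/(1 *~ k) -cpowRXz; congr (_ ^ k).
    rewrite /cpowR /= mul1r mul0r cos0 sin0 lnK ?posrE //.
    by apply: complex_eqP => /=; ring.
  rewrite /cpowR normrM ger0_norm; last by rewrite ler0c expR_ge0.
  rewrite [X in _ * X]normc_def /= cos2Dsin2 sqrtr1 mulr1.
  congr (((expR (_ * ln r))%:C)%C).
  rewrite !(raddfD (@complex.Re R)) /= /e.
  suff -> : complex.Re (k%:~R : C) = k%:~R by ring.
  by rewrite -(rmorph_int (@real_complex R)).
have M0 : M = ((complex.Re M)%:C)%C.
  have := H 1 ltr01; rewrite lecE => /andP[/eqP /= i0 _].
  by apply: complex_eqP.
(* For this $r$ the modulus is $e^{M}$, which exceeds $M$. *)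
have := H (expR (complex.Re M / e)) (expR_gt0 _).
rewrite M0 lecR expRK mulrC divfK //.
by have := expR_ge1Dx (complex.Re M); lra.
Qed.

End ZPow.

                              

(** * Monomial matrices *)

Section Monomial.
Variables (F : fieldType) (m : nat).
Implicit Types (n A B : 'M[F]_m).

Lemma unitmx_row_neq0 n i : n \in unitmx -> exists j, n i j != 0.
Proof.
move=> nu; apply: contrapT => H.
have : row i (n *m invmx n) = 0.
  rewrite row_mul (_ : row i n = 0) ?mul0mx //.
  apply/rowP => j; rewrite !mxE; apply/eqP/negPn/negP => nij.
  by apply: H; exists j.
rewrite mulmxV // row1 => /rowP /(_ i) /eqP.
by rewrite !mxE !eqxx oner_eq0.
Qed.

Lemma mulmx_diag_entry A B (d d' : 'rV[F]_m) :
  A *m diag_mx d = diag_mx d' *m B -> forall i j, A i j * d 0 j = d' 0 i * B i j.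
Proof. by rewrite mul_mx_diag mul_diag_mx => /matrixP e i j; have := e i j; rewrite !mxE. Qed.

Lemma monomial_of_diag n (l l' : 'rV[F]_m) : n \in unitmx -> injective (l' 0) ->
  n *m diag_mx l *m invmx n = diag_mx l' ->
  exists2 s : 'S_m, l' = col_perm s l &
    forall d, n *m diag_mx d *m invmx n = diag_mx (col_perm s d).
Proof.
move=> nu l'inj nl.
have nE i j : n i j * l 0 j = l' 0 i * n i j.
  by apply: mulmx_diag_entry; rewrite -nl mulmxKV.
have [f fE] : exists f : 'I_m -> 'I_m, forall i, n i (f i) != 0.
  by apply: (@fin_all_exists _ (fun=> 'I_m) (fun i j => n i j != 0)) => i; exact: unitmx_row_neq0.
have lf i : l 0 (f i) = l' 0 i.
  by apply: (mulfI (fE i)); rewrite nE mulrC.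
have finj : injective f by move=> i j fij; apply: l'inj; rewrite -!lf fij.
exists (perm finj); first by apply/rowP => i; rewrite !mxE permE lf.
move=> d; suff -> : n *m diag_mx d = diag_mx (col_perm (perm finj) d) *m n by rewrite mulmxK.
rewrite mul_mx_diag mul_diag_mx; apply/matrixP => i j; rewrite !mxE permE.
have [->|nij] := eqVneq (n i j) 0; first by rewrite mul0r mulr0.
suff -> : j = f i by rewrite mulrC.
have [k jk] := codomP (injF_onto finj j).
rewrite jk; congr f; apply: l'inj; rewrite -lf -jk.
by apply: (mulfI nij); rewrite nE mulrC.
Qed.

Lemma is_diag_of_commutes (I : Type) (D : I -> 'rV[F]_m) A :
  (forall i j, i != j -> exists t, D t 0 i != D t 0 j) ->
  (forall t, A *m diag_mx (D t) = diag_mx (D t) *m A) ->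
  forall i j, i != j -> A i j = 0.
Proof.
move=> Dd Ac i j ij; have [t Dt] := Dd _ _ ij.
have /eqP := mulmx_diag_entry (Ac t) i j.
rewrite mulrC -subr_eq0 -mulrBl mulf_eq0 subr_eq0 eq_sym (negPf Dt) /=.
by move=> /eqP.
Qed.

End Monomial.

(** * The antidiagonal form and the classical dual groups *)

Section Antidiagonal.
Variables (R : realType) (m : nat).
Local Notation C := (Cx R).
Local Notation J := (antidiag R m).
Implicit Types (A g h : 'M[C]_m).

Lemma sign_rev_ord (i : 'I_m) : (-1) ^+ rev_ord i = (-1) ^+ m.-1 * (-1) ^+ i :> C.
Proof.
have -> : m.-1 = (rev_ord i + i)%N by case: m i => [[]//|n] i /=; rewrite subSS subnK // -ltnS.
by rewrite exprD -mulrA -exprMn mulrNN mulr1 expr1n mulr1.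
Qed.

Lemma mul_antidiag_mx A i j : (J *m A) i j = (-1) ^+ i * A (rev_ord i) j.
Proof.
rewrite mxE (bigD1 (rev_ord i)) //= mxE eqxx big1 ?addr0 // => k /negPf ki.
by rewrite mxE ki mul0r.
Qed.

Lemma mul_mx_antidiag A i j : (A *m J) i j = A i (rev_ord j) * (-1) ^+ rev_ord j.
Proof.
rewrite mxE (bigD1 (rev_ord j)) //= mxE rev_ordK eqxx big1 ?addr0 // => k ki.
by rewrite mxE [j == _]eq_sym (can2_eq (@rev_ordK _) (@rev_ordK _)) (negPf ki) mulr0.
Qed.

Lemma tr_antidiag : J^T = (-1) ^+ m.-1 *: J.
Proof.
apply/matrixP => i j; rewrite !mxE [i == _]eq_sym (can2_eq (@rev_ordK _) (@rev_ordK _)).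
by case: eqP => [->|]; rewrite ?mulr0 // sign_rev_ord.
Qed.

Lemma antidiag_sq : J *m J = ((-1) ^+ m.-1)%:M.
Proof.
apply/matrixP => i j; rewrite mul_antidiag_mx !mxE rev_ordK [j == i]eq_sym.
case: eqP => _; rewrite ?mulr0 ?mulr0n ?mulr1n // sign_rev_ord mulrCA.
by rewrite -exprMn mulrNN mulr1 expr1n mulr1.
Qed.

Lemma antidiag_unit : J \in unitmx.
Proof.
suff /mulmx1_unit[] : J *m ((-1) ^+ m.-1 *: J) = 1%:M by [].
by rewrite -scalemxAr antidiag_sq scale_scalar_mx -exprMn mulrNN mulr1 expr1n.
Qed.

Lemma classical_unit g : @classical R m g -> g \in unitmx.
Proof. by case=> _ d; rewrite unitmxE d unitr1. Qed.

Lemma classical_sub_SL g : @classical R m g -> SL R m g.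
Proof. by case. Qed.

Lemma special_isometriesM (K g h : 'M[C]_m) :
  special_isometries K g -> special_isometries K h -> special_isometries K (g *m h).
Proof.
move=> [gK gd] [hK hd]; split; last by rewrite det_mulmx gd hd mulr1.
by rewrite trmx_mul !mulmxA -(mulmxA g h K) -(mulmxA g _ h^T) hK gK.
Qed.

Lemma special_isometries1 (K : 'M[C]_m) : special_isometries K 1%:M.
Proof. by split; rewrite ?det1 // trmx1 mulmx1 mul1mx. Qed.

Lemma isometry_inv g : g \in unitmx -> g *m J *m g^T = J ->
  invmx g *m J *m (invmx g)^T = J.
Proof.
move=> gu gJ; rewrite -{1}gJ !mulmxA mulVmx // mul1mx -mulmxA -trmx_mul mulVmx //.
by rewrite trmx1 mulmx1.
Qed.

Lemma classicalV g : @classical R m g -> @classical R m (invmx g).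
Proof.
move=> gc; have gu := classical_unit gc; case: gc => gJ gd; split.
  exact: isometry_inv.
by rewrite det_inv gd invr1.
Qed.

Lemma diag_isometry (d : 'rV[C]_m) : (forall i, d 0 i * d 0 (rev_ord i) = 1) ->
  diag_mx d *m J *m (diag_mx d)^T = J.
Proof.
move=> H; rewrite tr_diag_mx mul_mx_diag mul_diag_mx; apply/matrixP => i j.
rewrite !mxE; case: eqP => [->|]; last by rewrite mulr0 mul0r.
by rewrite mulrAC H mul1r.
Qed.

Definition antisym (V : zmodType) (k : 'rV[V]_m) := forall i, k 0 (rev_ord i) = - k 0 i.

Lemma antisym_sum (k : 'rV[int]_m) : antisym k -> \sum_i k 0 i = 0.
Proof.
move=> ka; set S := \sum_i _; have : S = - S.
  rewrite {1}/S (reindex_inj rev_ord_inj) /S -sumrN.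
  by apply: eq_bigr => i _; rewrite ka.
by lia.
Qed.

Lemma cochar_classical (k : 'rV[int]_m) : antisym k -> cochar (@classical R m) k.
Proof.
move=> ka z z0; split; last exact: diag_mx_is_diag.
split.
  by apply: diag_isometry => i; rewrite !mxE ka -expfzDr // subrr expr0z.
rewrite det_diag (eq_bigr (fun i => z ^ k 0 i)); last by move=> i _; rewrite mxE.
have -> : \prod_i z ^ k 0 i = z ^ (\sum_i k 0 i).
  apply/esym; elim/big_rec2: _ => [|i y x _ <-]; first exact: expr0z.
  by rewrite expfzDr.
by rewrite antisym_sum.
Qed.

Lemma cochar_classical_antisym (k : 'rV[int]_m) : cochar (@classical R m) k -> antisym k.
Proof.
(* The single value $z = 2$ is enough, since $2$ has infinite order. *)
move=> /(_ 2%:R); rewrite pnatr_eq0 => /(_ isT) [[+ _] _] i.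
rewrite tr_diag_mx mul_mx_diag mul_diag_mx => /matrixP /(_ i (rev_ord i)).
rewrite !mxE eqxx mulrAC -[RHS]mul1r => /(mulIf (expf_neq0 _ _)).
rewrite oppr_eq0 oner_eq0 => /(_ isT); rewrite -expfzDr ?pnatr_eq0 // => /eqP.
by rewrite pexprz_eq1 ?ler0n // (eqr_nat _ 2 1) orbF addrC addr_eq0 => /eqP.
Qed.

Lemma cocharC_classical (l : 'rV[C]_m) : antisym l -> cocharC (@classical R m) l.
Proof.
(* Summing over all $i$ meets each pair $\{i, \mathrm{rev}\,i\}$ twice, hence the halves. *)
move=> la; exists m, (fun i => l 0 i / 2), (fun i => delta_mx 0 i - delta_mx 0 (rev_ord i)).
split.
  move=> i; apply: cochar_classical => j; rewrite !mxE /= (inj_eq rev_ord_inj).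
  by rewrite (can2_eq (@rev_ordK _) (@rev_ordK _)); lia.
apply/rowP => j; rewrite summxE.
under eq_bigr => i _ do rewrite !mxE /= rmorphB /= mulrBr !mulrz_nat !mulr_natr !mulrb.
rewrite sumrB -!big_mkcond /= (eq_bigl (fun i => i == j)) ?big_pred1_eq; last by move=> i; rewrite eq_sym.
rewrite (eq_bigl (fun i => i == rev_ord j)) ?big_pred1_eq; last first.
  by move=> i; rewrite [RHS]eq_sym (can2_eq (@rev_ordK _) (@rev_ordK _)).
by rewrite la; field.
Qed.

Lemma mono_cochar (Gd Gd' : set 'M[C]_m) k : (forall g, Gd g -> Gd' g) ->
  cochar Gd k -> cochar Gd' k.
Proof. by move=> GG kc z /kc [? ?]; split=> //; apply: GG. Qed.

Lemma mono_cocharC (Gd Gd' : set 'M[C]_m) l : (forall g, Gd g -> Gd' g) ->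
  cocharC Gd l -> cocharC Gd' l.
Proof.
move=> GG [r [c [x [xc ->]]]]; exists r, c, x; split=> // i.
exact: mono_cochar (xc i).
Qed.

End Antidiagonal.

(** * Symplectic matrices have determinant one; rescaling to the antidiagonal form *)

Section SymplecticDet.
Variable F : fieldType.

                                                                      
(** The rows of $(P\mid Q)$ span a Lagrangian subspace, and a symmetric shear makes its first block
    invertible. With $Q$ in rank normal form [L *m p *m U], the choice of [S'] turns that block into
    $P' - P'p + p$, which has trivial kernel. *)
Lemma lagrangian_transverse n (P Q X Y : 'M[F]_n) :
  P *m Q^T = Q *m P^T -> P *m X + Q *m Y = 1%:M ->
  exists2 S : 'M[F]_n, S^T = S & P - Q *m S \in unitmx.
Proof.
move=> PQ PXQY; pose L := col_ebase Q; pose U := row_ebase Q.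
pose p : 'M[F]_n := pid_mx (\rank Q).
have Lu : L \in unitmx := col_ebase_unit Q.
have Uu : U \in unitmx := row_ebase_unit Q.
have QE : Q = L *m p *m U by rewrite mulmx_ebase.
have pT : p^T = p by rewrite tr_pid_mx.
have pp : p *m p = p by rewrite mul_pid_mx !minnn (minn_idPr (rank_leq_row Q)).
pose P' := invmx L *m P *m U^T.
have pP'T : (P' *m p)^T = P' *m p.
  have -> : P' *m p = invmx L *m (P *m Q^T) *m (invmx L)^T.
    by rewrite QE !trmx_mul pT /P' !mulmxA -[_ *m L^T *m _]mulmxA -trmx_mul mulVmx // trmx1 mulmx1.
  by rewrite !trmx_mul !trmxK -PQ !mulmxA.
pose S' := P' *m p - p.
pose M := P' - p *m S'.
have pZ : p *m (P' *m p) = P' *m p.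
  by rewrite -[in LHS]pP'T -[in RHS]pP'T trmx_mul pT mulmxA pp.
have ME : M = P' - P' *m p + p by rewrite /M /S' mulmxBr pZ pp opprB addrA addrAC.
have Mu : M \in unitmx.
  rewrite -row_free_unit; apply: inj_row_free => y; rewrite ME mulmxDr mulmxBr => yM.
  have yp : y *m p = 0.
    by have := congr1 (mulmx^~ p) yM; rewrite mulmxDl mulmxBl !mulmxA -!(mulmxA _ p p) pp subrr add0r mul0mx.
  have yZ : y *m (P' *m p) = 0 by rewrite -pZ mulmxA yp mul0mx.
  have yP : y *m P' = 0 by move: yM; rewrite yp yZ addr0 subr0.
  have P'X : P' *m ((invmx U)^T *m X *m L) + p *m (U *m Y *m L) = 1%:M.
    transitivity (invmx L *m (P *m X + Q *m Y) *m L); last by rewrite PXQY mulmx1 mulVmx.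
    rewrite mulmxDr mulmxDl QE /P' !mulmxA -[_ *m U^T *m _]mulmxA -trmx_mul (mulVmx Uu) trmx1 mulmx1.
    by rewrite mulVmx // mul1mx.
  by rewrite -[y]mulmx1 -P'X mulmxDr (mulmxA y P') (mulmxA y p) yP yp !mul0mx addr0.
exists (invmx U *m S' *m (invmx U)^T).
  by rewrite !trmx_mul trmxK mulmxA /S' raddfB /= pP'T pT.
suff -> : P - Q *m (invmx U *m S' *m (invmx U)^T) = L *m M *m (invmx U)^T.
  by rewrite !unitmx_mul Lu Mu unitmx_tr unitmx_inv Uu.
have -> : L *m M = P *m U^T - L *m p *m S'.
  rewrite /M mulmxBr (mulmxA L p S'); congr (_ - _).
  by rewrite /P' !mulmxA mulmxV // mul1mx.
rewrite mulmxBl; congr (_ - _).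
  by rewrite -mulmxA -trmx_mul mulVmx // trmx1 mulmx1.
by rewrite [X in X *m _]QE !mulmxA -[_ *m U *m invmx U]mulmxA mulmxV // mulmx1.
Qed.

(** After a unipotent shear the upper left block $A'$ is invertible. The isometry relations say that
    the Schur complement is the inverse transpose of $A'$, so the two determinants cancel. *)
Lemma det_symplectic_block n (g : 'M[F]_(n + n)) (J := block_mx 0 1%:M (- 1%:M) 0 : 'M[F]_(n + n)) :
  g *m J *m g^T = J -> \det g = 1.
Proof.
rewrite -[g]submxK; set A := ulsubmx g; set B := ursubmx g; set D := drsubmx g.
set E := dlsubmx g.
rewrite tr_block_mx !mulmx_block !mulmx0 !mulmx1 !mulmxN !mulmx1 !add0r !addr0.
move=> /eq_block_mx [/eqP AB ADB _ _].
have AB' : A *m B^T = B *m A^T by apply/eqP; rewrite -subr_eq0 addrC -mulNmx.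
have [|S ST A'u] := @lagrangian_transverse _ A B D^T (- E^T) AB'.
  by rewrite -ADB mulmxN -mulNmx addrC.
set A' := A - _ in A'u; pose E' := E - D *m S.
have A'B : A' *m B^T = B *m A'^T.
  by rewrite /A' mulmxBl raddfB /= mulmxBr AB' trmx_mul ST mulmxA.
have A'D : A' *m D^T - B *m E'^T = 1%:M.
  rewrite -ADB /A' /E' mulmxBl raddfB /= mulmxBr trmx_mul ST !mulmxA mulNmx.
  by rewrite opprB addrA subrK addrC.
have gE : block_mx A B E D *m block_mx 1%:M 0 (- S) 1%:M =
   block_mx A' 0 E' 1%:M *m block_mx 1%:M (invmx A' *m B) 0 (D - E' *m invmx A' *m B).
  rewrite !mulmx_block !mulmx1 !mulmx0 !mul0mx !mul1mx !add0r !addr0 !mulmxN.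
  by rewrite mulKVmx //; congr (block_mx _ _ _ _); rewrite mulmxA addrC subrK.
have := congr1 determinant gE; rewrite !det_mulmx !det_lblock det_ublock !det1 !mulr1 !mul1r => ->.
rewrite -[X in _ * X]det_tr -det_mulmx; suff -> : A' *m (D - E' *m invmx A' *m B)^T = 1%:M by rewrite det1.
rewrite raddfB /= mulmxBr !trmx_mul trmx_inv !mulmxA A'B.
by rewrite -[B *m _ *m _]mulmxA mulmxV ?unitmx_tr // mulmx1 A'D.
Qed.

Lemma symplectic_block_congr n (a : 'M[F]_n) (K := block_mx 1%:M 0 0 a^T : 'M[F]_(n + n)) :
  K *m block_mx 0 1%:M (- 1%:M) 0 *m K^T = block_mx 0 a (- a^T) 0.
Proof.
rewrite /K tr_block_mx !mulmx_block !trmx1 !trmx0 trmxK.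
by rewrite !(mulmx0, mul0mx, mulmx1, mul1mx, addr0, add0r, mulmxN).
Qed.

End SymplecticDet.

(** For $m$ even the antidiagonal form is alternating, and the block matrix [K] carries the standard
    symplectic form to it. *)
Lemma det_isometry_antidiag (R : realType) m (g : 'M[Cx R]_m) : ~~ odd m ->
  g *m antidiag R m *m g^T = antidiag R m -> \det g = 1.
Proof.
move=> em; have mE : m = (m./2 + m./2)%N by rewrite addnn even_halfK.
move: (m./2) mE => n mE; subst m; move=> {em}.
set J := antidiag R _; pose a := ursubmx J.
have JE : J = block_mx 0 a (- a^T) 0.
  have lt1 k : (k < n)%N -> (0 < n)%N by exact: leq_ltn_trans.
  rewrite -[LHS]submxK; congr block_mx.
  - apply/matrixP => i j; rewrite !mxE; case: eqP => // /(congr1 val) /=.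
    by have := ltn_ord i; have := ltn_ord j; lia.
  - apply/matrixP => i j; have := tr_antidiag R (n + n).
    move=> /matrixP /(_ (lshift n j) (rshift n i)); rewrite -/J !mxE => ->; rewrite -[(-1) ^+ (n + n).-1]signr_odd.
    have -> : odd (n + n).-1 by have := lt1 i (ltn_ord i); lia.
    by rewrite expr1 mulN1r.
  - apply/matrixP => i j; rewrite !mxE; case: eqP => // /(congr1 val) /=.
    by have := ltn_ord i; have := ltn_ord j; lia.
have au : a \in unitmx.
  have := antidiag_unit R (n + n); rewrite -/J JE !unitmxE.
  rewrite -[block_mx _ _ _ _]mulmx1 -[1%:M](_ : block_mx 0 1%:M 1%:M 0 *m block_mx 0 1%:M 1%:M 0 = _); last first.
    by rewrite mulmx_block !mulmx0 !mul0mx !mulmx1 !add0r addr0 -scalar_mx_block.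
  rewrite mulmxA mulmx_block !mulmx0 !mulmx1 !add0r !addr0 det_mulmx det_ublock.
  by rewrite !unitrM => /andP[/andP[]].
pose K : 'M[Cx R]_(n + n) := block_mx 1%:M 0 0 a^T.
pose J0 : 'M[Cx R]_(n + n) := block_mx 0 1%:M (- 1%:M) 0.
have Ku : K \in unitmx by rewrite unitmxE det_ublock det1 mul1r det_tr -unitmxE.
have KJ : K *m J0 *m K^T = J.
  by rewrite JE symplectic_block_congr.
rewrite -KJ => gJ; suff : \det (invmx K *m g *m K) = 1.
  by rewrite !det_mulmx mulrC mulrA det_inv mulrV ?mul1r // -unitmxE.
apply: det_symplectic_block; rewrite -/J0.
transitivity (invmx K *m (g *m (K *m J0 *m K^T) *m g^T) *m (invmx K)^T).
  by rewrite !trmx_mul !mulmxA.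
rewrite gJ !mulmxA mulVmx // mul1mx -mulmxA -trmx_mul mulVmx //.
by rewrite trmx1 mulmx1.
Qed.

Section AntidiagScaling.
Variables (R : realType) (m : nat).
Local Notation C := (Cx R).
Local Notation J := (antidiag R m).

(** The entry at $(i,\mathrm{rev}\,i)$ is multiplied by $c_ic_{\mathrm{rev}\,i}$. The symmetry of
    $A$ makes the required factor $x_i$ invariant under reversal, so its square root serves as
    $c_i$. *)
Lemma antidiag_scaling (A : 'M[C]_m) : A \in unitmx ->
  (forall i j, j != rev_ord i -> A i j = 0) -> A^T = (-1) ^+ m.-1 *: A ->
  exists2 c : 'rV[C]_m, (forall i, c 0 i != 0) & diag_mx c *m A *m (diag_mx c)^T = J.
Proof.
move=> Au A0 AT.
have Ar i : A i (rev_ord i) != 0.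
  have [j] := unitmx_row_neq0 i Au; have [-> //|/A0 ->] := eqVneq j (rev_ord i).
  by rewrite eqxx.
pose x i : C := (-1) ^+ (i : 'I_m) / A i (rev_ord i).
have xr i : x (rev_ord i) = x i.
  rewrite /x rev_ordK sign_rev_ord; have /matrixP /(_ i (rev_ord i)) := AT.
  rewrite !mxE => ->; rewrite invfM mulrACA divff ?mul1r //.
  by rewrite expf_neq0 // oppr_eq0 oner_eq0.
exists (\row_i sqrtC (x i)).
  by move=> i; rewrite mxE sqrtC_eq0 mulf_neq0 ?invr_neq0 // expf_neq0 // oppr_eq0 oner_eq0.
rewrite tr_diag_mx mul_mx_diag mul_diag_mx; apply/matrixP => i j; rewrite !mxE.
have [->|/A0 ->] := eqVneq j (rev_ord i); last by rewrite mulr0 mul0r.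
by rewrite xr mulrAC -expr2 sqrtCK divfK.
Qed.

Lemma antidiag_congr_classical (A : 'M[C]_m) h : h \in unitmx ->
  h *m J *m h^T = A -> (forall i j, j != rev_ord i -> A i j = 0) ->
  exists2 c : 'rV[C]_m, (forall i, c 0 i != 0) & classical (diag_mx c *m h).
Proof.
move=> hu hJ A0.
have Au : A \in unitmx by rewrite -hJ !unitmx_mul unitmx_tr hu antidiag_unit.
have AT : A^T = (-1) ^+ m.-1 *: A.
  by rewrite -hJ !trmx_mul trmxK tr_antidiag mulmxA -scalemxAr -scalemxAl.
have [c c0 cA] := antidiag_scaling Au A0 AT.
have chJ : diag_mx c *m h *m J *m (diag_mx c *m h)^T = J.
  by rewrite trmx_mul -[RHS]cA -hJ !mulmxA.
have [em|om] := boolP (odd m); last by exists c => //; split=> //; exact: det_isometry_antidiag.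
have d2 : \det (diag_mx c *m h) ^+ 2 = 1.
  have := congr1 determinant chJ; rewrite det_mulmx [\det (_ *m J)]det_mulmx det_tr mulrAC -expr2.
  rewrite -[RHS]mul1r => /mulIf; apply.
  by have := antidiag_unit R m; rewrite unitmxE unitfE.
move/eqP: d2; rewrite sqrf_eq1 => /orP[/eqP d1|/eqP d1]; first by exists c.
(* Here $m$ is odd and the determinant is $-1$; negating $c$ corrects it without changing the
   form. *)
exists (- c); first by move=> i; rewrite mxE oppr_eq0.
rewrite raddfN mulNmx; split; first by rewrite mulNmx raddfN /= mulmxN mulNmx opprK.
by rewrite -scaleN1r detZ d1 -signr_odd em expr1 mulrNN mulr1.
Qed.

End AntidiagScaling.

(** * Half sums of coroots in coordinates *)

Section Rho.
Variable R : realType.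
Local Notation C := (Cx R).

Lemma card_ord_lt m (k : 'I_m) : #|[pred i : 'I_m | (i < k)%N]| = k.
Proof.
rewrite -sum1_card (eq_bigl (fun i : 'I_m => (i < k)%N)) // -(big_ord_widen m (fun=> 1%N)) ?sum1_card ?card_ord //.
exact: ltnW.
Qed.

Lemma card_ord_between m n (k : nat) : (n <= m)%N ->
  #|[pred i : 'I_m | (k < i < n)%N]| = (n - k.+1)%N.
Proof.
move=> nm; rewrite -sum1_card.
rewrite (eq_bigl (fun i : 'I_m => (k < i)%N && (i < n)%N)) //.
rewrite -(big_ord_widen_cond m (fun i => (k < i)%N) (fun=> 1%N) nm).
rewrite -(big_mkord (fun i => (k < i)%N) (fun=> 1%N)).
have [nk|kn] := leqP n k.
  rewrite big1_seq ?(eqP (leqW nk)) // => i /andP[ki]; rewrite mem_index_iota; lia.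
rewrite (@big_cat_nat _ _ _ k.+1) //= big1_seq ?add0n; last first.
  by move=> i /andP[ki]; rewrite mem_index_iota; lia.
rewrite big_nat_cond (eq_bigl (fun i => (k.+1 <= i < n)%N && true)); last by move=> i; lia.
by rewrite -big_nat_cond sum_nat_const_nat muln1.
Qed.

Lemma rhoGLE m (k : 'I_m) : rhoGL R m 0 k = (m%:R - 1 - 2 * k%:R) / 2.
Proof.
pose a (i j : 'I_m) : C := (k == i)%:R - (k == j)%:R.
have -> : rhoGL R m 0 k = 2^-1 * \sum_(i < m) \sum_(j < m | (i < j)%N) a i j.
  rewrite /rhoGL mxE summxE; congr (_ * _); apply: eq_bigr => i _.
  by rewrite summxE; apply: eq_bigr => j _; rewrite !mxE eqxx.
have -> : \sum_(i < m) \sum_(j < m | (i < j)%N) a i j =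
   \sum_(j < m | (k < j < m)%N) 1 - \sum_(i < m | (i < k)%N) 1.
  under eq_bigr => i _ do rewrite sumrB.
  rewrite sumrB; congr (_ - _).
    rewrite (bigD1 k) //= eqxx [X in _ + X]big1 ?addr0; last first.
      by move=> i ik; rewrite big1 // => j _; rewrite eq_sym (negPf ik).
    by apply: eq_bigl => j; rewrite ltn_ord andbT.
  rewrite [RHS]big_mkcond; apply: eq_bigr => i _.
  rewrite big_mkcond (bigD1 k) //= eqxx big1 ?addr0 // => j jk.
  by rewrite eq_sym (negPf jk) if_same.
rewrite !sumr_const card_ord_lt card_ord_between // natrB ?ltn_ord //.
by rewrite -[k.+1]addn1 natrD; field.
Qed.

Lemma rhoGL_antisym m : antisym (rhoGL R m).
Proof.
move=> k; rewrite !rhoGLE /= natrB ?ltn_ord // -[k.+1]addn1 natrD; by field.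
Qed.

(** The principal $\mathrm{SL}_2$ of the classical group is principal in $\mathrm{SL}_m$. In
    coordinates, $f_i$ has coefficient $n-(i+1)+c/2$ with $c = 2$ for $m$ odd and $c = 1$ for $m$
    even, which is the $i$-th entry of $\rho$ for $\mathrm{GL}_m$. *)
Lemma rho_classicalE m : rho_classical R m = rhoGL R m.
Proof.
pose n := m./2; pose c : C := (if odd m then 2 else 1)%N%:R.
have nm : (n <= m)%N by rewrite /n; lia.
pose co (i : nat) : C := (n - i.+1)%:R + c / 2.
have mE : m%:R = (odd m)%:R + n%:R + n%:R :> C.
  by rewrite -!natrD -addnA addnn odd_double_half.
have coE (k : 'I_m) : (k < n)%N -> co k = rhoGL R m 0 k.
  move=> kn; rewrite rhoGLE /co natrB // -[k.+1]addn1 natrD mE /c.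
  by case: (odd m) => /=; field.
have RE : rho_classical R m = \sum_(i < m | (i < n)%N) co i *: fv R i.
  rewrite /rho_classical scalerDr 2!scaler_sumr -big_split /=.
  apply: eq_bigr => i _.
  rewrite (eq_bigr (fun=> fv R i *+ 2)); last by move=> j _; rewrite addrACA addNr addr0.
  rewrite sumr_const card_ord_between //.
  have sc (v : 'rV[C]_m) x y : 2^-1 *: (v *+ 2 *+ x) + 2^-1 *: (v *+ y) = (x%:R + y%:R / 2) *: v.
    by rewrite -!scalerMnr !scalerMnl -scalerDl; congr (_ *: _); field.
  by rewrite sc.
apply/rowP => k; rewrite RE summxE.
have -> : \sum_(i < m | (i < n)%N) (co i *: fv R i) 0 k =
   (if (k < n)%N then co k else 0) - (if (rev_ord k < n)%N then co (rev_ord k) else 0).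
  under eq_bigr => i _ do rewrite !mxE eqxx /= mulrBr.
  rewrite sumrB; congr (_ - _).
    rewrite big_mkcond (bigD1 k) //= eqxx mulr1 big1 ?addr0 // => i ik.
    by rewrite eq_sym (negPf ik) mulr0 if_same.
  rewrite big_mkcond (bigD1 (rev_ord k)) //= rev_ordK eqxx mulr1 big1 ?addr0 // => i ik.
  by rewrite -(can2_eq (@rev_ordK _) (@rev_ordK _)) eq_sym (negPf ik) mulr0 if_same.
case: ifPn => kn; case: ifPn => rkn; rewrite ?sub0r ?subr0.
- by move: kn rkn; rewrite /= /n; have := ltn_ord k; lia.
- exact: coE.
- by rewrite coE // rhoGL_antisym opprK.
- move: kn rkn; rewrite /= /n => kn rkn.
  have {kn rkn}mE' : m = (k + k + 1)%N by have := ltn_ord k; lia.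
  by rewrite rhoGLE [in X in _ = (X - _ - _) / _]mE' !natrD; field.
Qed.

End Rho.

                                 

(** * Diagonal normal form of parameters with regular infinitesimal character *)

Section TorusForm.
Variables (R : realType) (m : nat).
Local Notation C := (Cx R).
Implicit Types (Gd : set 'M[C]_m) (D : C -> 'M[C]_m).

                                                                           
                                          
(** A form of [in_inf_char] without Weyl orbit: the exponent $\lambda$ is $l$ itself, reached by one
    conjugation inside [Gd]. *)
Definition torus_form Gd D (l : 'rV[C]_m) : Prop :=
  exists (h : 'M[C]_m) (k : 'rV[int]_m) (mu : 'rV[C]_m),
    [/\ Gd h, [/\ cocharC Gd l, cocharC Gd mu & cochar Gd k],
        l - mu = map_mx (fun a : int => a%:~R) k &
        forall z, z != 0 -> h *m D z *m invmx h = zpow_mx k mu z].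

Lemma torus_form_mono Gd Gd' D l : (forall g, Gd g -> Gd' g) ->
  torus_form Gd D l -> torus_form Gd' D l.
Proof.
move=> GG [h [k [mu [hG [lc muc kc] lmu hD]]]]; exists h, k, mu; split=> //.
- exact: GG.
- split; [exact: mono_cocharC lc | exact: mono_cocharC muc | exact: mono_cochar kc].
Qed.

Lemma cochar_perm Gd n (s : {perm 'I_m}) k :
  (forall t, torus Gd t <-> torus Gd (n *m t *m invmx n)) ->
  (forall d, n *m diag_mx d *m invmx n = diag_mx (col_perm s d)) ->
  cochar Gd k -> cochar Gd (col_perm s k).
Proof.
move=> nT ns kc z z0; have /nT := kc z z0.
by rewrite ns; congr (torus _ (diag_mx _)); apply/rowP => i; rewrite !mxE.
Qed.

Lemma cocharC_perm Gd n (s : {perm 'I_m}) l :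
  (forall t, torus Gd t <-> torus Gd (n *m t *m invmx n)) ->
  (forall d, n *m diag_mx d *m invmx n = diag_mx (col_perm s d)) ->
  cocharC Gd l -> cocharC Gd (col_perm s l).
Proof.
move=> nT ns [r [c [x [xc ->]]]]; exists r, c, (fun i => col_perm s (x i)).
split; first by move=> i; exact: cochar_perm nT ns (xc i).
apply/rowP => j; rewrite mxE !summxE; apply: eq_bigr => i _.
by rewrite !mxE.
Qed.

Lemma zpow_mx_perm (s : {perm 'I_m}) k mu (z : C) :
  zpow_mx (col_perm s k) (col_perm s mu) z =
  diag_mx (col_perm s (\row_i zpow (k 0 i) (mu 0 i) z)).
Proof. by congr diag_mx; apply/rowP => i; rewrite !mxE. Qed.

Lemma invmxM n (A B : 'M[C]_n) : A \in unitmx -> B \in unitmx ->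
  invmx (A *m B) = invmx B *m invmx A.
Proof.
move=> Au Bu; have ABu : A *m B \in unitmx by rewrite unitmx_mul Au.
by rewrite -[RHS]mul1mx -(mulVmx ABu) -!mulmxA mulKVmx // mulmxV // mulmx1.
Qed.

(** Since $l$ has distinct entries, the Weyl element is monomial; it is absorbed into $h$ and
    permutes $k$ and $\mu$ along with $\lambda$. *)
Lemma weyl_torus_form Gd D h (l0 mu0 l : 'rV[C]_m) (k : 'rV[int]_m) :
  (forall g, Gd g -> g \in unitmx) ->
  (forall g g', Gd g -> Gd g' -> Gd (g *m g')) ->
  injective (l 0) -> Gd h -> cocharC Gd l0 -> cocharC Gd mu0 -> cochar Gd k ->
  l0 - mu0 = map_mx (fun a : int => a%:~R) k ->
  (forall z, z != 0 -> h *m D z *m invmx h = zpow_mx k mu0 z) ->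
  weyl_orbit Gd l0 l -> torus_form Gd D l.
Proof.
move=> Gu GM linj hG l0c mu0c kc lmu hD [n [nG nT] nl].
have nu := Gu _ nG; have hu := Gu _ hG.
have [s lE ns] := monomial_of_diag nu linj nl.
exists (n *m h), (col_perm s k), (col_perm s mu0); split.
- exact: GM.
- by rewrite lE; split; [exact: cocharC_perm nT ns l0c | exact: cocharC_perm nT ns mu0c | exact: cochar_perm nT ns kc].
- by apply/rowP => i; have /rowP /(_ (s i)) := lmu; rewrite lE !mxE.
- move=> z z0; rewrite zpow_mx_perm -ns -/(zpow_mx k mu0 z) -hD // invmxM //.
  by rewrite !mulmxA.
Qed.

End TorusForm.

Section InfinitesimalCharacter.
Variables (R : realType) (G : real_group R).
Local Notation C := (Cx R).
Local Notation m := (dsize G).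
Local Notation Gd := (@dual _ G).
Implicit Types (psi : parameter G).

Lemma conjL_fst (h : 'M[C]_m) (x : Lgroup G) :
  (conjL h x).1 = h *m x.1 *m (if x.2.2 then gal (invmx h) else invmx h).
Proof. by case: x => g [z []]. Qed.

Lemma det_mx2 (F : comNzRingType) (A : 'M[F]_2) : \det A = A 0 0 * A 1 1 - A 0 1 * A 1 0.
Proof.
rewrite (expand_det_row _ 0) !big_ord_recl big_ord0 addr0 /cofactor !det_mx11 !mxE.
rewrite (_ : lift _ _ = 1); last exact/val_inj.
by rewrite (_ : lift _ _ = 0) ?mul1r ?addn0 ?expr1 ?expr0 ?mul1r ?mulN1r ?mulrN //; exact/val_inj.
Qed.

Lemma det_diag2 (a b : C) : \det (diag2 a b) = a * b.
Proof. by rewrite det_mx2 !mxE /= mulr0 subr0. Qed.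

Lemma SL2_diag2 (a : C) : a != 0 -> SL2 (diag2 a a^-1).
Proof. by move=> a0; rewrite /SL2 /= det_diag2 divff. Qed.

Lemma sqrt_absW_neq0 (z : C) : z != 0 -> sqrtC (z * z^*) != 0.
Proof. by move=> z0; rewrite sqrtC_eq0 -normCK expf_neq0 // normr_eq0. Qed.

Definition Lparam psi (z : C) : 'M[C]_m := (L_parameter psi (z, false)).1.

Definition over_WR psi := forall w x, WR w -> SL2 x -> (psi w x).2 = w.

Lemma conjL_Lparam psi h z : over_WR psi -> z != 0 ->
  (conjL h (L_parameter psi (z, false))).1 = h *m Lparam psi z *m invmx h.
Proof.
move=> psiW z0; rewrite conjL_fst psiW //.
by apply: SL2_diag2; exact: sqrt_absW_neq0.
Qed.

Lemma in_inf_char_torus_form psi (l : 'rV[C]_m) : (forall g, Gd g -> g \in unitmx) ->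
  (forall g g', Gd g -> Gd g' -> Gd (g *m g')) -> over_WR psi ->
  injective (l 0) -> in_inf_char psi l -> torus_form Gd (Lparam psi) l.
Proof.
move=> Gu GM psiW linj [h [l0 [mu0 [k [hG [l0c mu0c kc lmu] hD lw]]]]].
apply: (weyl_torus_form (h := h) (l0 := l0) (mu0 := mu0) (k := k)) => // z z0.
by rewrite -conjL_Lparam // hD.
Qed.

Lemma torus_form_in_inf_char psi (l : 'rV[C]_m) : Gd 1%:M -> over_WR psi ->
  torus_form Gd (Lparam psi) l -> in_inf_char psi l.
Proof.
move=> G1 psiW [h [k [mu [hG [lc muc kc] lmu hD]]]].
exists h, l, mu, k; split=> //; first by move=> z z0; rewrite conjL_Lparam // hD.
exists 1%:M; last by rewrite invmx1 mulmx1 mul1mx.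
by split=> // t; rewrite invmx1 mulmx1 mul1mx.
Qed.

End InfinitesimalCharacter.

Section RegularCharacter.
Variables (R : realType) (m : nat).
Local Notation C := (Cx R).

(** Twice $\lambda = l + \rho$, doubled in order to stay among the integers. *)
Definition reg (l : 'rV[int]_m) (i : 'I_m) : int := 2 * l 0 i + (m%:Z - 1 - 2 * (i : nat)%:Z).

Lemma regE l i : (map_mx (fun a : int => a%:~R) l + rhoGL R m) 0 i = (reg l i)%:~R / 2 :> C.
Proof. by rewrite mxE rhoGLE !mxE /reg !(intrD, rmorphN, intrM) /= -!pmulrn; field. Qed.

Definition dominant n (l : 'rV[int]_n) := forall i j : 'I_n, (i <= j)%N -> l 0 j <= l 0 i.

Lemma reg_decr l (i j : 'I_m) : dominant l -> (i < j)%N -> reg l j < reg l i.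
Proof. by move=> /(_ i j) ld ij; have := ld (ltnW ij); rewrite /reg; lia. Qed.

Lemma reg_inj l : dominant l -> injective (reg l).
Proof.
move=> ld i j e; apply/val_inj; case: (ltngtP i j) => // /(reg_decr ld).
  by rewrite e ltxx.
by rewrite e ltxx.
Qed.

Lemma regular_inj l : dominant l ->
  injective ((map_mx (fun a : int => a%:~R) l + rhoGL R m : 'rV[C]_m) 0).
Proof.
move=> ld i j; rewrite !regE => /(mulIf _); rewrite invr_eq0 pnatr_eq0 => /(_ isT).
by move=> /intr_inj /(reg_inj ld).
Qed.

(** A map that negates a strictly decreasing sequence is strictly order-reversing, and a finite
    chain has only one such self-map: [up] bounds it above and [dn] below. *)
Lemma decr_eq_rev (f : 'I_m -> int) (s : 'I_m -> 'I_m) :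
  (forall i j : 'I_m, (i < j)%N -> f j < f i) -> (forall i, f (s i) = - f i) ->
  forall i, s i = rev_ord i.
Proof.
move=> fd fs.
have fW (i j : 'I_m) : f i < f j -> (j < i)%N.
  by case: (ltngtP i j) => // [/fd|/val_inj ->]; rewrite ?ltxx //; lia.
have sd (i j : 'I_m) : (i < j)%N -> (s j < s i)%N by move=> /fd; have := fs i; have := fs j => e1 e2 ?; apply: fW; lia.
have up k : forall i : 'I_m, i = k :> nat -> (s i + k < m)%N.
  elim: k => [|k IH] i ik; first by rewrite addn0.
  have km : (k < m)%N by have := ltn_ord i; lia.
  by have := IH (Ordinal km) erefl; have := sd (Ordinal km) i; rewrite /= ik ltnS leqnn => /(_ isT); lia.
have dn k : forall i : 'I_m, (i + k.+1)%N = m -> (k <= s i)%N.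
  elim: k => [|k IH] i ik //.
  have km : (i.+1 < m)%N by lia.
  have := IH (Ordinal km); have := sd i (Ordinal km); rewrite /= ltnS leqnn => /(_ isT) => h1 h2.
  by have := h2 ltac:(lia); lia.
move=> i; apply/val_inj => /=; have := up i i erefl.
by have := dn (m - i.+1)%N i; have := ltn_ord i => h1 h2; have := h2 ltac:(lia); lia.
Qed.

Lemma reg_antisym l : antisym l <-> forall i, reg l (rev_ord i) = - reg l i.
Proof.
split=> H i; have := H i; rewrite /reg /=; have := ltn_ord i; first by move=> im ->; lia.
by lia.
Qed.

End RegularCharacter.

                                                           

(** * Algebraic characters, their independence, and homogeneous polynomials *)

Section Characters.
Variable R : realType.
Local Notation C := (Cx R).

(** Made for $\mathrm{diag}(t,t^{-1}) = t^{-1}\mathrm{diag}(t^2,1)$, whose entries are not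
    polynomial; a power of $t$ as large as the total degree clears the denominators. *)
Lemma regular_scaled_curve N (G : set 'M[C]_N) f (gt : 'M[{poly C}]_N) : regular_on G f ->
  exists (P : {poly C}) (d k : nat), forall t, t != 0 ->
    let g := t^-1 *: map_mx (horner_eval t) gt in G g -> f g = P.[t] / t ^+ d / \det g ^+ k.
Proof.
move=> [p [k fE]].
pose d := \max_(m <- msupp p) mdeg m.
exists (\sum_(m <- msupp p) (mcoeff m p)%:P * 'X^(d - mdeg m) *
   \prod_i (mxvec gt 0 i) ^+ (m i)), d, k.
move=> t t0 g Gg; rewrite fE //; congr (_ / _).
rewrite mevalE horner_sum mulr_suml !big_seq; apply: eq_bigr => m mp.
rewrite !hornerM hornerC hornerXn horner_prod -!mulrA; congr (_ * _).
have md : (mdeg m <= d)%N by rewrite /d; exact: leq_bigmax_seq.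
rewrite -[X in _ = _ * (_ / t ^+ X)](subnK md) exprD invfM mulrCA mulrC.
rewrite -!mulrA mulrA mulfV ?expf_neq0 // mul1r mdegE -prodrXr -prodfV -big_split /=.
apply: eq_bigr => i _; rewrite horner_exp -exprVn -exprMn; congr (_ ^+ _).
by rewrite /g linearZ /= mxE -map_mxvec mxE.
Qed.

(** A multiplicative Laurent polynomial is a monomial: compare the leading coefficients in $t$ of
    $P(s)P(t) = P(st)$. *)
Lemma regular_char (c : C -> C) (P : {poly C}) (d : nat) : c 1 != 0 ->
  (forall s t, s != 0 -> t != 0 -> c (s * t) = c s * c t) ->
  (forall s, s != 0 -> c s = P.[s] / s ^+ d) ->
  exists w : int, forall s, s != 0 -> c s = s ^ w.
Proof.
move=> c1 cM cE.
have PM s : s != 0 -> P.[s] *: P = P \Po (s *: 'X).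
  move=> s0; apply: (@poly_eq_inf _ _ _ 'X); first by rewrite polyX_eq0.
  move=> t; rewrite hornerX => t0; rewrite hornerZ horner_comp hornerZ hornerX.
  have st0 : s * t != 0 by rewrite mulf_neq0.
  apply: (mulIf (invr_neq0 (expf_neq0 d st0))); rewrite -cE // cM // !cE //.
  by rewrite exprMn invfM mulrACA.
have P0 : P != 0.
  by apply: contraNneq c1 => P0; rewrite cE ?oner_neq0 // P0 horner0 mul0r.
exists ((size P).-1%:Z - d%:Z) => s s0; rewrite cE // expfzDr // exprnN.
congr (_ * _); have := congr1 (fun p : {poly C} => p`_(size P).-1) (PM s s0).
have Pl : ((size P).-1 < size P)%N by rewrite prednK // size_poly_gt0.
rewrite coefZ comp_polyE coef_sum (bigD1 (Ordinal Pl)) //= exprZn !coefZ coefXn eqxx mulr1.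
rewrite big1 ?addr0; last first.
  move=> i ni; rewrite exprZn !coefZ coefXn; case: eqP => [e|]; last by rewrite !mulr0.
  by case/eqP: ni; apply: val_inj.
by rewrite mulrC => /mulfI; apply; rewrite -/(lead_coef P) lead_coef_eq0.
Qed.

(** Dedekind's independence of characters, by induction on the number of nonzero coefficients:
    translating the relation by [t1] and subtracting [chi j t1] times it removes the index $j$ and
    keeps $i$. *)
Lemma dedekind m (T : Type) (op : T -> T -> T) (P : T -> Prop) (chi : 'I_m -> T -> C) t0 :
  P t0 -> (forall i t, P t -> chi i t != 0) -> (forall t t', P t -> P t' -> P (op t t')) ->
  (forall i t t', P t -> P t' -> chi i (op t t') = chi i t * chi i t') ->
  (forall i j, i != j -> exists2 t, P t & chi i t != chi j t) ->
  forall x : 'I_m -> C, (forall t, P t -> \sum_i x i * chi i t = 0) -> forall i, x i = 0.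
Proof.
move=> Pt0 chi0 opP chiM chiD x.
have [n] := ubnP #|[pred i | x i != 0]|; elim: n x => // n IH x xn Hx i.
apply/eqP/negPn/negP => xi0.
have [j /andP[ji xj0]|none] := pickP [pred j | (j != i) && (x j != 0)]; last first.
  have := Hx _ Pt0; rewrite (bigD1 i) //= big1 ?addr0; last first.
    by move=> j ji; have := none j; rewrite /= ji /= => /negbFE/eqP ->; rewrite mul0r.
  by move/eqP; rewrite mulf_eq0 (negPf xi0) (negPf (chi0 i _ Pt0)).
have [t1 Pt1 t1D] := chiD _ _ ji.
pose y a := x a * (chi a t1 - chi j t1).
have y0 : forall i, y i = 0.
  apply: IH.
    rewrite -ltnS; apply: leq_trans xn; rewrite ltnS; apply: proper_card.
    apply/properP; split.
      by apply/fintype.subsetP => a; rewrite !inE /y; apply: contraNneq => ->; rewrite mul0r.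
    by exists j; rewrite !inE //= /y subrr mulr0 eqxx.
  move=> t Pt; under eq_bigr => a _ do rewrite /y mulrBr mulrBl.
  rewrite sumrB; under [X in X - _]eq_bigr => a _ do rewrite -mulrA -chiM //.
  rewrite Hx; last exact: opP.
  under eq_bigr => a _ do rewrite mulrAC.
  by rewrite -mulr_suml Hx // mul0r subrr.
move: (y0 i); rewrite /y => /eqP; rewrite mulf_eq0 (negPf xi0) subr_eq0 eq_sym.
by rewrite (negPf t1D).
Qed.

(** The relation says that $P$ is homogeneous of degree $d/2$. For $d = 0$ it is constant; for $d <
    0$ clearing denominators and evaluating at $0$ gives $P(1) = 0$, hence $P = 0$. *)
Lemma unip_entry (P : {poly C}) (d : int) : d <= 0 ->
  (forall s, s != 0 -> P.[s ^+ 2] = s ^ d * P.[1]) -> forall t, P.[t] = P.[0].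
Proof.
case: d => [[|n]|n] // _ HP.
  move=> t; suff -> : P = (P.[1])%:P by rewrite !hornerC.
  apply: (@poly_eq_inf _ _ _ 'X); first by rewrite polyX_eq0.
  move=> t'; rewrite hornerX hornerC => t'0.
  by rewrite -(sqrtCK t') HP ?sqrtC_eq0 // expr0z mul1r.
have H : 'X^(n.+1) * (P \Po 'X^2) = (P.[1])%:P.
  apply: (@poly_eq_inf _ _ _ 'X); first by rewrite polyX_eq0.
  move=> s; rewrite hornerX => s0; rewrite hornerM horner_comp !hornerXn hornerC HP //.
  by rewrite NegzE -exprnN mulrA divff ?mul1r // expf_neq0.
have P1 : P.[1] = 0.
  have := congr1 (fun p => p.[0]) H.
  by rewrite hornerM hornerXn hornerC expr0n mul0r.
have -> : P = 0; last by move=> t; rewrite !horner0.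
apply: (@poly_eq_inf _ _ _ 'X); first by rewrite polyX_eq0.
move=> t; rewrite hornerX horner0 => t0.
by rewrite -(sqrtCK t) HP ?sqrtC_eq0 // P1 mulr0.
Qed.

Lemma coef_X2D1_exp (n d : nat) : (('X^2 + 1 : {poly C}) ^+ n)`_(d.*2) = ('C(n, d))%:R.
Proof.
rewrite addrC exprDn coef_sum.
under eq_bigr => i _ do rewrite expr1n mul1r coefMn -exprM coefXn mul2n (inj_eq double_inj).
have [dn|nd] := leqP d n; last first.
  rewrite bin_small // big1 // => i _; case: eqP => [e|]; last by rewrite mul0rn.
  by have := ltn_ord i; rewrite -e; lia.
have dn' : (d < n.+1)%N by [].
rewrite (bigD1 (Ordinal dn')) //= eqxx big1 ?addr0 // => i id.
have /negPf -> : d != i by apply: contraNneq id => e; apply/eqP/val_inj.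
by rewrite mul0rn.
Qed.

End Characters.

Lemma sandwich_entry (F : comNzRingType) n (A B E : 'M[F]_n) (d d' : 'rV[F]_n) a c :
  (A *m diag_mx d *m B *m diag_mx d' *m E) a c =
  \sum_i (\sum_j A a i * B i j * E j c * d' 0 j) * d 0 i.
Proof.
rewrite mxE; under eq_bigr => j _ do rewrite mul_mx_diag mxE mxE !mulr_suml.
rewrite exchange_big; apply: eq_bigr => i _; rewrite mulr_suml; apply: eq_bigr => j _.
by rewrite mul_mx_diag mxE; ring.
Qed.

(** * Comparing a multiplicity-free representation with its twisted transpose *)

Section Contragredient.
Variables (F : fieldType) (m : nat) (G T : Type).
Variables (ok : G -> Prop) (mul : G -> G -> G) (tau : G -> G) (e : G) (M : G -> 'M[F]_m).
Variables (okT : T -> Prop) (tor : T -> G) (chi : 'I_m -> T -> F).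
Hypothesis ok_mul : forall g h, ok g -> ok h -> ok (mul g h).
Hypothesis ok_tau : forall g, ok g -> ok (tau g).
Hypothesis ok_tor : forall t, okT t -> ok (tor t).
Hypothesis ok_e : ok e.
Hypothesis MM : forall g h, ok g -> ok h -> M (mul g h) = M g *m M h.
Hypothesis tauM : forall g h, tau (mul g h) = mul (tau h) (tau g).
Hypothesis M_e : M e = 1%:M.
Hypothesis M_tau_e : M (tau e) = 1%:M.
Hypothesis M_tor : forall t, okT t -> M (tor t) = diag_mx (\row_i chi i t).
Hypothesis M_tau_tor : forall t, okT t -> M (tau (tor t)) = M (tor t).
Hypothesis chi_indep : forall x : 'I_m -> F,
  (forall t, okT t -> \sum_i x i * chi i t = 0) -> forall i, x i = 0.

(** The coefficient at $(i_0,i_0)$ takes the same value at $a\,t\,g\,t'\,c$ and at its image under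
    the anti-involution. Both values are combinations of the products $\chi_i(t)\chi_j(t')$, and
    independence of characters equates them term by term. *)
Lemma tau_cyclic i0 a g c i j : (forall g, ok g -> M (tau g) i0 i0 = M g i0 i0) ->
  ok a -> ok g -> ok c ->
  M a i0 i * M g i j * M c j i0 = M (tau c) i0 j * M (tau g) j i * M (tau a) i i0.
Proof.
move=> i0tau aok gok cok; apply/eqP; rewrite -subr_eq0; apply/eqP.
move: j; apply: chi_indep => t' t'ok.
under eq_bigr => j _ do rewrite mulrBl.
rewrite sumrB; move: i; apply: chi_indep => t tok.
under eq_bigr => i _ do rewrite mulrBl.
rewrite sumrB; apply/eqP; rewrite subr_eq0; apply/eqP.
have tt := ok_tor tok; have tt' := ok_tor t'ok.
have o1 := ok_mul tt' cok; have o2 := ok_mul gok o1; have o3 := ok_mul tt o2.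
have ac := ok_tau aok; have gc := ok_tau gok; have cc := ok_tau cok.
have tc := ok_tau tt; have tc' := ok_tau tt'.
have p1 := ok_mul cc tc'; have p2 := ok_mul p1 gc; have p3 := ok_mul p2 tc.
have := i0tau _ (ok_mul aok o3).
rewrite (MM aok o3) (MM tt o2) (MM gok o1) (MM tt' cok).
rewrite !tauM (MM p3 ac) (MM p2 tc) (MM p1 gc) (MM cc tc') !M_tau_tor // !M_tor //.
rewrite !mulmxA !sandwich_entry => E.
transitivity (\sum_i (\sum_j M a i0 i * M g i j * M c j i0 *
    (\row_i chi i t') 0 j) * (\row_i chi i t) 0 i).
  by apply: eq_bigr => i _; rewrite [in RHS]mxE; congr (_ * _); apply: eq_bigr => j _; rewrite mxE.
rewrite -E; under eq_bigr => j _ do rewrite mulr_suml.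
rewrite exchange_big; apply: eq_bigr => i _; rewrite mulr_suml.
by apply: eq_bigr => j _; rewrite !mxE mulrAC.
Qed.

                                                                                       
                                                                                   
                                              
(** Each index $i$ is linked to the top index of its block by nonzero entries of some $M(a)$ and
    $M(c)$, so [tau_cyclic] expresses $M(\tau g)_{ji}$ through $M(g)_{ij}$. The factor is
    $\rho_i/\rho_j$, where $\rho_i$ compares the linking entry of $M(a)$ with that of $M(\tau
    a)$. *)
Lemma contragredient (top : 'I_m -> 'I_m) :
  (forall i g, ok g -> M (tau g) (top i) (top i) = M g (top i) (top i)) ->
  (forall i, exists a c, [/\ ok a, ok c, M a (top i) i != 0 & M c i (top i) != 0]) ->
  (forall g i j, ok g -> M g i j != 0 -> top i = top j) ->
  exists2 rho : 'I_m -> F, forall i, rho i != 0 &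
    forall g i j, ok g -> M (tau g) j i = M g i j * (rho i / rho j).
Proof.
move=> toptau reach Mtop.
have [ac Hac] := @fin_all_exists _ (fun=> (G * G)%type) (fun i p =>
  [/\ ok p.1, ok p.2, M p.1 (top i) i != 0 & M p.2 i (top i) != 0])
  (fun i => let: ex_intro a (ex_intro c H) := reach i in ex_intro _ (a, c) H).
pose A i := M (ac i).1 (top i) i; pose A' i := M (tau (ac i).1) i (top i).
pose D i := M (ac i).2 i (top i); pose D' i := M (tau (ac i).2) (top i) i.
(* With the identity in the middle, [tau_cyclic] relates the four linking entries, so that none of
   them vanishes. *)
have E0 i : A i * D i = D' i * A' i.
  have [aok cok _ _] := Hac i.
  by have := tau_cyclic i i (toptau i) aok ok_e cok; rewrite M_e M_tau_e !mxE eqxx !mulr1.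
have A0 i : A i != 0 by have [] := Hac i.
have D0 i : D i != 0 by have [] := Hac i.
have [D'0 A'0] : (forall i, D' i != 0) /\ (forall i, A' i != 0).
  by split=> i; have := mulf_neq0 (A0 i) (D0 i); rewrite E0 mulf_eq0 negb_or => /andP[].
exists (fun i => A i / A' i); first by move=> i; rewrite mulf_neq0 ?invr_eq0.
move=> g i j gok; have [tij|tij] := eqVneq (top i) (top j); last first.
  have -> : M g i j = 0 by apply/eqP; apply: contraNT tij => /(Mtop _ _ _ gok) ->.
  rewrite mul0r; apply/eqP; apply: contraNT tij => /(Mtop _ _ _ (ok_tau gok)) ->.
  exact: eqxx.
have [aok _ _ _] := Hac i; have [_ cok _ _] := Hac j.
have := tau_cyclic i j (toptau i) aok gok cok.
rewrite {2 3}tij -/(A i) -/(D j) -/(A' i) -/(D' j) => E.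
have DE : D j = D' j * A' j / A j by rewrite -E0 mulrAC mulfV ?mul1r.
apply: (mulfI (mulf_neq0 (D'0 j) (A'0 i))); rewrite mulrAC -E DE.
have := A'0 j; have := A'0 i; have := A0 j; have := A0 i; have := D'0 j.
by move=> h1 h2 h3 h4 h5; field; rewrite ?h1 ?h2 ?h3 ?h4 ?h5.
Qed.

End Contragredient.

(** * Two-by-two matrices and the anti-involution of the Weil group *)

Section TwoByTwo.
Variable F : comNzRingType.

Definition mx2 (a b c d : F) : 'M[F]_2 :=
  \matrix_(i, j) (if i == 0 then (if j == 0 then a else b) else (if j == 0 then c else d)).

Lemma mx2M a b c d a' b' c' d' : mx2 a b c d *m mx2 a' b' c' d' =
  mx2 (a * a' + b * c') (a * b' + b * d') (c * a' + d * c') (c * b' + d * d').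
Proof.
apply/matrixP => i j; rewrite !mxE !big_ord_recl big_ord0 addr0 !mxE /=.
by case: (i == 0); case: (j == 0).
Qed.

Lemma ord2P (i : 'I_2) : i = 0 \/ i = 1.
Proof. by case: i => [[|[|//]] H]; [left|right]; apply: val_inj. Qed.

Lemma mx2_eta (A : 'M[F]_2) : A = mx2 (A 0 0) (A 0 1) (A 1 0) (A 1 1).
Proof. by apply/matrixP => i j; rewrite !mxE; case: (ord2P i) => ->; case: (ord2P j) => ->. Qed.

Lemma det_mx2E a b c d : \det (mx2 a b c d) = a * d - b * c.
Proof. by rewrite det_mx2 !mxE. Qed.

Lemma tr_mx2 a b c d : (mx2 a b c d)^T = mx2 a c b d.
Proof. by apply/matrixP => i j; rewrite !mxE; case: (i == 0); case: (j == 0). Qed.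

Lemma mx2_1 : 1%:M = mx2 1 0 0 1.
Proof. by apply/matrixP => i j; rewrite !mxE; case: (ord2P i) => ->; case: (ord2P j) => ->. Qed.

End TwoByTwo.

Lemma diag2E (R : realType) (a b : Cx R) : diag2 a b = mx2 a 0 0 b.
Proof. by apply/matrixP => i j; rewrite !mxE; case: (ord2P i) => ->; case: (ord2P j) => ->. Qed.

Section MulW.
Variable R : realType.
Local Notation C := (Cx R).
Implicit Types z y : C.

Lemma mulWff z y : mulW (z, false) (y, false) = (z * y, false).
Proof. by rewrite /mulW /= mulr1. Qed.
Lemma mulWft z y : mulW (z, false) (y, true) = (z * y, true).
Proof. by rewrite /mulW /= mulr1. Qed.
Lemma mulWtf z y : mulW (z, true) (y, false) = (z * y^*, true).
Proof. by rewrite /mulW /= mulr1. Qed.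
Lemma mulWtt z y : mulW (z, true) (y, true) = (- (z * y^*), false).
Proof. by rewrite /mulW /= expr1 mulrN1. Qed.

                                                              
(** The anti-involution $w\mapsto jw^{-1}j^{-1}$. On $\mathbb{C}^\times$ it is $z\mapsto\bar
    z^{-1}$, which keeps the argument of $z$ and hence the value of every power of $z/|z|$. *)
Definition tauW (w : weil R) : weil R :=
  if w.2 then (- w.1^-1, true) else ((w.1^*)^-1, false).

Lemma tauWM w w' : tauW (mulW w w') = mulW (tauW w') (tauW w).
Proof.
case: w w' => z [] [y []]; rewrite ?(mulWff, mulWtf, mulWft, mulWtt) /tauW /= ?(mulWff, mulWtf, mulWft, mulWtt).
- by rewrite rmorphN rmorphM /= conjCK invrN invfM rmorphN fmorphV /= mulrNN mulrC.
- by rewrite invfM mulrN mulrC.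
- by rewrite fmorphV /= conjCK invfM mulNr mulrC.
- by rewrite rmorphM invfM mulrC.
Qed.

Lemma tauW_WR w : WR w -> WR (tauW w).
Proof. by case: w => z [] /= z0; rewrite /WR /tauW /= ?oppr_eq0 invr_eq0 ?conjC_eq0. Qed.

Lemma mulW_WR (w w' : weil R) : WR w -> WR w' -> WR (mulW w w').
Proof.
case: w w' => z e [y f]; rewrite /WR /= => z0 y0.
by rewrite !mulf_neq0 ?signr_eq0 //; case: e; rewrite ?conjC_eq0.
Qed.

Lemma tauW_mul w : WR w -> mulW (mulW (tauW w) (1, true)) w = (1, true).
Proof.
case: w => z [] z0.
  have -> : tauW (z, true) = (- z^-1, true) by [].
  by rewrite mulWtt mulWft conjC1 mulr1 opprK mulVf.
have -> : tauW (z, false) = ((z^*)^-1, false) by [].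
by rewrite mulWft mulWtf mulr1 mulVf ?conjC_eq0.
Qed.

Lemma mulW1 (w : weil R) : mulW w (1, false) = w.
Proof. by case: w => z []; rewrite ?mulWtf ?mulWff ?conjC1 mulr1. Qed.

Lemma mul1W (w : weil R) : mulW (1, false) w = w.
Proof. by case: w => z []; rewrite ?mulWft ?mulWff mul1r. Qed.

End MulW.

(** * The invariant bilinear form of a cohomological parameter of $\mathrm{PGL}_m$ *)

Section SelfDual.
Variables (R : realType) (m : nat).
Local Notation C := (Cx R).
Variables (M : weil R -> 'M[C]_2 -> 'M[C]_m) (l k : 'rV[int]_m) (mu : 'rV[C]_m) (b : C).
Hypothesis ld : dominant l.
Hypothesis MM : forall w w' x x', WR w -> WR w' -> SL2 x -> SL2 x' ->
  M (mulW w w') (x *m x') = M w x *m M w' x'.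
Hypothesis Mu : forall w x, WR w -> SL2 x -> M w x \in unitmx.
Hypothesis Mreg : forall i j, regular_on (@SL2 R) (fun x => M (1, false) x i j).
Hypothesis Mb : forall w i j, WR w -> `|M w 1%:M i j| <= b.
Hypothesis MD : forall z, z != 0 ->
  M (z, false) (diag2 (sqrtC (z * z^*)) (sqrtC (z * z^*))^-1) = zpow_mx k mu z.
Hypothesis lmu : map_mx (fun a : int => a%:~R) l + rhoGL R m - mu = map_mx (fun a : int => a%:~R) k.

Local Notation id_W := ((1, false) : weil R).
Local Notation j_W := ((1, true) : weil R).
Local Notation r i := (reg l i).

Let WR1 (z : C) e : z != 0 -> WR (z, e). Proof. by []. Qed.
Let WRe e : WR ((1, e) : weil R). Proof. by rewrite /WR /= oner_neq0. Qed.
Let SL21 : SL2 (1%:M : 'M[C]_2). Proof. by rewrite /SL2 /= det1. Qed.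
Let SL2d (s : C) : s != 0 -> SL2 (diag2 s s^-1). Proof. exact: SL2_diag2. Qed.

Lemma muE i : mu 0 i = (r i - k 0 i *+ 2)%:~R / 2.
Proof.
have /rowP /(_ i) := lmu; rewrite mxE regE !mxE => e.
have -> : mu 0 i = (r i)%:~R / 2 - (k 0 i)%:~R by rewrite -e opprB addrC subrK.
by rewrite intrD rmorphN mulr2n intrD /=; field.
Qed.

Lemma M1 : M id_W 1%:M = 1%:M.
Proof.
have := MM (WRe false) (WRe false) SL21 SL21; rewrite mulWff !mulr1 mulmx1 => e.
have u := Mu (WRe false) SL21.
by apply: (can_inj (mulKmx u)); rewrite mulmx1 -e.
Qed.

Lemma Mpoly (gt : 'M[{poly C}]_2) : (forall t, SL2 (map_mx (horner_eval t) gt)) ->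
  forall i j, exists P : {poly C}, forall t, M id_W (map_mx (horner_eval t) gt) i j = P.[t].
Proof.
move=> gS i j; have [P [d HP]] := regular_curve gt (Mreg i j).
by exists P => t; rewrite HP //; have := gS t; rewrite /SL2 /= => ->; rewrite expr1n divr1.
Qed.

(** The diagonal torus of $\mathrm{SL}_2$ commutes with the image of the $L$-parameter of
    $\mathbb{C}^\times$, whose diagonal characters are distinct because $\lambda$ is regular. *)
Lemma torus_diag s : s != 0 -> forall i j, i != j -> M id_W (diag2 s s^-1) i j = 0.
Proof.
move=> s0; apply: (is_diag_of_commutes (D := fun t : {z : C | z != 0} => \row_i zpow (k 0 i) (mu 0 i) (val t))).
  move=> i j ij; apply: contrapT => H; case/eqP: ij.
  apply: (reg_inj ld); have [z0|ke me] := @zpow_inj R (k 0 i) (k 0 j) (mu 0 i) (mu 0 j).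
    move=> nz; apply/eqP; apply: contraT => ne; case: H.
    by exists (exist _ z0 nz); rewrite !mxE.
  move: me; rewrite !muE ke => /(mulIf _); rewrite invr_eq0 pnatr_eq0 => /(_ isT).
  by move=> /intr_inj; lia.
move=> [z z0] /=; rewrite -/(zpow_mx k mu z) -(MD z0).
have sz := SL2d (sqrt_absW_neq0 z0); have sS := SL2d s0.
rewrite -(MM (WRe false) (WR1 false z0) sS sz) -(MM (WR1 false z0) (WRe false) sz sS).
by rewrite !mulWff mulr1 mul1r !diag2E !mx2M; congr (M _ (mx2 _ _ _ _)); ring.
Qed.

Lemma torus_weights : exists w : 'I_m -> int, forall s, s != 0 -> forall i, M id_W (diag2 s s^-1) i i = s ^ w i.
Proof.
suff /(@fin_all_exists _ (fun=> int) (fun i wi => forall s, s != 0 -> M id_W (diag2 s s^-1) i i = s ^ wi)) [w Hw] :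
  forall i, exists w : int, forall s, s != 0 -> M id_W (diag2 s s^-1) i i = s ^ w.
  by exists w => s s0 i; exact: Hw.
move=> i; have [P [d [d' HP]]] := regular_scaled_curve (mx2 ('X^2) 0 0 1) (Mreg i i).
apply: (@regular_char _ (fun s => M id_W (diag2 s s^-1) i i) P d).
- by rewrite invr1 diag2E -mx2_1 M1 mxE eqxx oner_neq0.
- move=> s t s0 t0; have -> : diag2 (s * t) (s * t)^-1 = diag2 s s^-1 *m diag2 t t^-1.
    by rewrite !diag2E mx2M invfM; congr mx2; ring.
  have := MM (WRe false) (WRe false) (SL2d s0) (SL2d t0); rewrite mulWff mulr1 => ->.
  rewrite mxE (bigD1 i) //= big1 ?addr0 // => j ji.
  by rewrite torus_diag ?mul0r // eq_sym.
move=> s s0; have sE : diag2 s s^-1 = s^-1 *: map_mx (horner_eval s) (mx2 ('X^2) 0 0 1).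
  apply/matrixP => a c; rewrite diag2E !mxE /horner_eval.
  by case: (a == 0); case: (c == 0); rewrite ?hornerXn ?hornerC ?mulr0 ?mulr1 // expr2 mulKf.
rewrite sE HP // -?sE; last exact: SL2d.
by have := SL2d s0; rewrite /SL2 /= => ->; rewrite expr1n divr1.
Qed.

Variable w : 'I_m -> int.
Hypothesis wE : forall s, s != 0 -> forall i, M id_W (diag2 s s^-1) i i = s ^ w i.

Lemma torus_mx s : s != 0 -> M id_W (diag2 s s^-1) = diag_mx (\row_i s ^ w i).
Proof.
move=> s0; apply/matrixP => i j; rewrite !mxE.
have [<-|ij] := eqVneq i j; first by rewrite wE.
by rewrite torus_diag.
Qed.

(** The $\mathrm{SL}_2$-component $\mathrm{diag}(|z|,|z|^{-1})$ of the $L$-parameter is divided out;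
    it shifts the exponent by half the $\mathrm{SL}_2$-weight. *)
Lemma Mz_weight z : z != 0 ->
  M (z, false) 1%:M = diag_mx (\row_i zpow (k 0 i) (mu 0 i + (- w i)%:~R / 2) z).
Proof.
move=> z0; have nz : sqrtC (z * z^*) = `|z| by rewrite -normC_def.
have n0 : `|z| != 0 by rewrite normr_eq0.
have n0' : `|z|^-1 != 0 by rewrite invr_eq0.
have -> : M (z, false) 1%:M = zpow_mx k mu z *m M id_W (diag2 `|z|^-1 `|z|^-1^-1).
  rewrite -MD // nz -MM //; [|exact: SL2d|exact: SL2d].
  by rewrite mulWff mulr1 !diag2E mx2M mx2_1; congr (M _ (mx2 _ _ _ _)); rewrite ?invrK; field.
rewrite torus_mx // mulmx_diag; congr diag_mx; apply/rowP => i; rewrite !mxE.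
by rewrite -zpow_normX // exprz_inv.
Qed.

(** Boundedness on $\mathbb{C}^\times$ makes each diagonal character of [M (z, false) 1%:M] unitary.
    This ties the real part of its exponent to $k_i$, and so splits $2\lambda_i$ into the exponent
    of $z/|z|$ and the $\mathrm{SL}_2$-weight. *)
Lemma regE_weights i : r i = k 0 i + w i.
Proof.
have Re_half (a : int) : complex.Re (a%:~R / 2 : C) = a%:~R / 2.
  have -> : a%:~R / 2 = ((a%:~R / 2 : R)%:C)%C :> C; last by [].
  by rewrite rmorphM fmorphV /= rmorph_int rmorph_nat.
have : (k 0 i)%:~R + 2 * complex.Re (mu 0 i + (- w i)%:~R / 2) = 0 :> R.
  apply: (@zpow_bounded _ _ _ b) => z z0.
  have := Mb i i (WR1 false z0); rewrite Mz_weight // !mxE eqxx mulr1n; exact.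
rewrite muE (raddfD (@complex.Re R)) /= !Re_half -mulrDl mulrC divfK ?pnatr_eq0 //.
by rewrite -!intrD => /eqP; rewrite intr_eq0 => /eqP; lia.
Qed.

Lemma Mz z : z != 0 ->
  M (z, false) 1%:M = diag_mx (\row_i zpow (k 0 i) ((- k 0 i)%:~R / 2) z).
Proof.
move=> z0; rewrite Mz_weight //; congr diag_mx; apply/rowP => i; rewrite !mxE.
congr zpow; rewrite muE -mulrDl -intrD; congr (_%:~R / _).
by rewrite regE_weights; lia.
Qed.

Lemma Mz_conj z : z != 0 ->
  M (z^*, false) 1%:M = diag_mx (\row_i zpow (- k 0 i) ((k 0 i)%:~R / 2) z).
Proof.
move=> z0; rewrite Mz ?conjC_eq0 //; congr diag_mx; apply/rowP => i; rewrite !mxE.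
by rewrite zpow_conj //; congr zpow; rewrite rmorphN /=; field.
Qed.

Lemma weights_inj i j : k 0 i = k 0 j -> w i = w j -> i = j.
Proof. by move=> e1 e2; apply: (reg_inj ld); rewrite !regE_weights e1 e2. Qed.

Let exp_base : exists2 c : C, c != 0 & injective (exprz c).
Proof.
exists 2%:R; first by rewrite pnatr_eq0.
move=> x y e; have /eqP : 2%:R ^ (x - y) = 1 :> C.
  by rewrite expfzDr ?pnatr_eq0 // e -expfzDr ?pnatr_eq0 // subrr expr0z.
by rewrite pexprz_eq1 ?ler0n // (eqr_nat _ 2 1) orbF subr_eq0 => /eqP.
Qed.

Section Entries.
Variables (B : 'M[C]_m) (i j : 'I_m).
Hypothesis Bij : B i j != 0.

Lemma entry_k : (forall z, z != 0 -> B *m M (z, false) 1%:M = M (z, false) 1%:M *m B) ->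
  k 0 j = k 0 i.
Proof.
move=> H; have [|ke _ //] := @zpow_inj R (k 0 j) (k 0 i) ((- k 0 j)%:~R / 2) ((- k 0 i)%:~R / 2).
move=> z z0; have := H z z0; rewrite Mz // => /mulmx_diag_entry /(_ i j).
by rewrite !mxE [RHS]mulrC => /(mulfI Bij).
Qed.

Lemma entry_kN : (forall z, z != 0 -> B *m M (z, false) 1%:M = M (z^*, false) 1%:M *m B) ->
  k 0 j = - k 0 i.
Proof.
move=> H; have [|ke _ //] := @zpow_inj R (k 0 j) (- k 0 i) ((- k 0 j)%:~R / 2) ((k 0 i)%:~R / 2).
move=> z z0; have := H z z0; rewrite Mz_conj // Mz // => /mulmx_diag_entry /(_ i j).
by rewrite !mxE [RHS]mulrC => /(mulfI Bij).
Qed.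

Lemma entry_w : (forall s, s != 0 -> B *m M id_W (diag2 s s^-1) = M id_W (diag2 s s^-1) *m B) ->
  w j = w i.
Proof.
have [c c0 cinj] := exp_base.
move=> /(_ _ c0); rewrite torus_mx // => /mulmx_diag_entry /(_ i j).
by rewrite !mxE [RHS]mulrC => /(mulfI Bij) /cinj.
Qed.

Lemma entry_wN : (forall s, s != 0 -> B *m M id_W (diag2 s s^-1) = M id_W (diag2 s^-1 s) *m B) ->
  w j = - w i.
Proof.
have [c c0 cinj] := exp_base; have c0' : c^-1 != 0 by rewrite invr_eq0.
move=> /(_ _ c0); rewrite -[X in diag2 _^-1 X]invrK !torus_mx // => /mulmx_diag_entry /(_ i j).
by rewrite !mxE exprz_inv [RHS]mulrC => /(mulfI Bij) /cinj.
Qed.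

Lemma entry_parity : B *m M id_W (diag2 (-1) (-1)) = M id_W (diag2 (-1) (-1)) *m B ->
  odd `|w j|%N = odd `|w i|%N.
Proof.
have N0 : -1 != 0 :> C by rewrite oppr_eq0 oner_eq0.
have N1 : (-1)^-1 = -1 :> C by rewrite invrN1.
rewrite -{2 4}N1 torus_mx // => /mulmx_diag_entry /(_ i j).
have sgE (a : int) : (-1) ^ a = (-1) ^+ odd `|a|%N :> C.
  by rewrite signr_odd; case: a => n //; rewrite NegzE -exprnN -exprVn N1 abszN.
by rewrite !mxE [RHS]mulrC !sgE => /(mulfI Bij) /signr_inj.
Qed.

End Entries.

Let Wm : 'M[C]_2 := mx2 0 1 (-1) 0.
Let SL2W : SL2 Wm. Proof. by rewrite /SL2 /= det_mx2E; ring. Qed.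
Let SL2N1 : SL2 (diag2 (-1) (-1) : 'M[C]_2). Proof. by rewrite /SL2 /= det_diag2; ring. Qed.

(** $\mathbb{C}^\times$ commutes with itself and with $\mathrm{SL}_2$, and $j$ conjugates it, so $k$
    is kept up to the sign given by the coset; $-1\in\mathrm{SL}_2$ is central, so the parity of $w$
    is kept. *)
Lemma M_support w0 x i j : WR w0 -> SL2 x -> M w0 x i j != 0 ->
  k 0 j = (if w0.2 then - k 0 i else k 0 i) /\ odd `|w j|%N = odd `|w i|%N.
Proof.
move=> w0W xS nz; split; last first.
  apply: (entry_parity nz).
  rewrite -(MM w0W (WRe false) xS SL2N1) mulW1 -(MM (WRe false) w0W SL2N1 xS) mul1W.
  by rewrite diag2E [x]mx2_eta !mx2M; congr (M _ (mx2 _ _ _ _)); ring.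
case: w0 w0W nz => y [] y0 nz.
  apply: (entry_kN nz) => z z0; have z0' : z^* != 0 by rewrite conjC_eq0.
  by rewrite -MM // mulWtf -MM // mulWft mulmx1 mul1mx mulrC.
apply: (entry_k nz) => z z0.
by rewrite -MM // mulWff -MM // mulWff mulmx1 mul1mx mulrC.
Qed.

                                                                                     
                           
Lemma SL2_weyl_support i j : M id_W Wm i j != 0 -> k 0 j = k 0 i /\ w j = - w i.
Proof.
move=> nz; split; first by have [] := M_support (WRe false) SL2W nz.
apply: (entry_wN nz) => s s0; have s0' : s^-1 != 0 by rewrite invr_eq0.
have sV : SL2 (diag2 s^-1 s) by have := SL2d s0'; rewrite invrK.
rewrite -(MM (WRe false) (WRe false) SL2W (SL2d s0)) -(MM (WRe false) (WRe false) sV SL2W).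
rewrite !diag2E /Wm !mx2M.
by congr (M _ (mx2 _ _ _ _)); ring.
Qed.

Lemma j_support i j : M j_W 1%:M i j != 0 -> k 0 j = - k 0 i /\ w j = w i.
Proof.
move=> nz; split; first by have [] := M_support (WRe true) SL21 nz.
apply: (entry_w nz) => s s0; have sS := SL2d s0.
by rewrite -MM // -MM // mul1W mulW1 mulmx1 mul1mx.
Qed.

Lemma jW_support i j : M j_W Wm i j != 0 -> k 0 j = - k 0 i /\ w j = - w i.
Proof.
move=> nz; split; first by have [] := M_support (WRe true) SL2W nz.
apply: (entry_wN nz) => s s0; have s0' : s^-1 != 0 by rewrite invr_eq0.
have sV : SL2 (diag2 s^-1 s) by have := SL2d s0'; rewrite invrK.
rewrite -(MM (WRe true) (WRe false) SL2W (SL2d s0)) -(MM (WRe false) (WRe true) sV SL2W).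
rewrite mul1W mulW1 !diag2E /Wm !mx2M.
by congr (M _ (mx2 _ _ _ _)); ring.
Qed.

(** The element $(j, W)$ carries each index to one where $k$ and $w$, hence [reg l], are negated;
    for a strictly decreasing sequence this can only be the reversal. *)
Lemma weights_rev i : k 0 (rev_ord i) = - k 0 i /\ w (rev_ord i) = - w i.
Proof.
have [f fE] : exists f : 'I_m -> 'I_m, forall i, M j_W Wm i (f i) != 0.
  apply: (@fin_all_exists _ (fun=> 'I_m) (fun i j => M j_W Wm i j != 0)) => i'.
  exact: unitmx_row_neq0 (Mu (WRe true) SL2W).
have <- : f i = rev_ord i; last exact: jW_support.
apply: (decr_eq_rev (f := reg l)); first by move=> ? ?; exact: reg_decr.
by move=> j; rewrite !regE_weights; have [-> ->] := jW_support (fE j); lia.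
Qed.

Lemma jW_antidiag i j : j != rev_ord i -> M j_W Wm i j = 0.
Proof.
move=> ij; apply/eqP; apply: contraNT ij => /jW_support[kj wj].
by have [kr wr] := weights_rev i; apply/eqP/weights_inj; rewrite ?kr ?wr.
Qed.

Let row_exists w0 x i : WR w0 -> SL2 x -> exists j, M w0 x i j != 0.
Proof. by move=> ? ?; apply: unitmx_row_neq0; exact: Mu. Qed.

Local Notation X t := (M id_W (mx2 1 t 0 1)).
Local Notation Y t := (M id_W (mx2 1 0 t 1)).

Let SL2X (t : C) : SL2 (mx2 1 t 0 1). Proof. by rewrite /SL2 /= det_mx2E; ring. Qed.
Let SL2Y (t : C) : SL2 (mx2 1 0 t 1). Proof. by rewrite /SL2 /= det_mx2E; ring. Qed.

Lemma Xpoly i j : exists P : {poly C}, forall t, X t i j = P.[t].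
Proof.
have E (t : C) : map_mx (horner_eval t) (mx2 1 'X 0 1) = mx2 1 t 0 1.
  by apply/matrixP => a c; rewrite !mxE /horner_eval; case: (a == 0); case: (c == 0); rewrite ?hornerX ?hornerC.
have [|P HP] := @Mpoly (mx2 1 'X 0 1) _ i j; first by move=> t; rewrite E.
by exists P => t; rewrite -HP E.
Qed.

Lemma Ypoly i j : exists P : {poly C}, forall t, Y t i j = P.[t].
Proof.
have E (t : C) : map_mx (horner_eval t) (mx2 1 0 'X 1) = mx2 1 0 t 1.
  by apply/matrixP => a c; rewrite !mxE /horner_eval; case: (a == 0); case: (c == 0); rewrite ?hornerX ?hornerC.
have [|P HP] := @Mpoly (mx2 1 0 'X 1) _ i j; first by move=> t; rewrite E.
by exists P => t; rewrite -HP E.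
Qed.

(** Conjugation by $\mathrm{diag}(s,s^{-1})$ makes the entry homogeneous of degree $(w_i-w_j)/2$ in
    $t$. In nonpositive degree it is constant, equal to its value at $t = 0$. *)
Lemma X_entry i j t : w i <= w j -> X t i j = (i == j)%:R.
Proof.
move=> wij; have [P HP] := Xpoly i j.
have -> : X t i j = X 0 i j.
  rewrite !HP; apply: (@unip_entry _ _ (w i - w j)); first by lia.
  move=> s s0; rewrite -!HP.
  have : M id_W (diag2 s s^-1) *m X 1 = X (s ^+ 2) *m M id_W (diag2 s s^-1).
    have sS := SL2d s0; rewrite -(MM (WRe false) (WRe false) sS (SL2X 1)).
    rewrite -(MM (WRe false) (WRe false) (SL2X (s ^+ 2)) sS) diag2E !mx2M.
    by congr (M _ (mx2 _ _ _ _)); field.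
  rewrite torus_mx // => /esym /mulmx_diag_entry /(_ i j); rewrite !mxE => e.
  by apply: (mulIf (expfz_neq0 (w j) s0)); rewrite e mulrAC -expfzDr // subrK.
by rewrite -[mx2 1 0 0 1]mx2_1 M1 mxE.
Qed.

Lemma Y_entry i j t : w j <= w i -> Y t i j = (i == j)%:R.
Proof.
move=> wij; have [P HP] := Ypoly i j.
have -> : Y t i j = Y 0 i j.
  rewrite !HP; apply: (@unip_entry _ _ (w j - w i)); first by lia.
  move=> s s0; rewrite -!HP.
  have : Y 1 *m M id_W (diag2 s s^-1) = M id_W (diag2 s s^-1) *m Y (s ^+ 2).
    have sS := SL2d s0; rewrite -(MM (WRe false) (WRe false) (SL2Y 1) sS).
    rewrite -(MM (WRe false) (WRe false) sS (SL2Y (s ^+ 2))) diag2E !mx2M.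
    by congr (M _ (mx2 _ _ _ _)); field.
  rewrite torus_mx // => /mulmx_diag_entry /(_ i j); rewrite !mxE => e.
  by apply: (mulfI (expfz_neq0 (w i) s0)); rewrite -e mulrA -expfzDr // [w i + _]addrC subrK mulrC.
by rewrite -[mx2 1 0 0 1]mx2_1 M1 mxE.
Qed.

(** The blocks of the representation: by [M_class] no entry joins two classes, and by [reach_top]
    every index of a class is linked to its top. *)
Definition same_class i j := (`|k 0 i| == `|k 0 j|) && (odd `|w i|%N == odd `|w j|%N).

Lemma M_class w0 x i j : WR w0 -> SL2 x -> M w0 x i j != 0 -> same_class i j.
Proof.
move=> w0W xS /(M_support w0W xS)[kj wj]; rewrite /same_class wj eqxx andbT kj.
by case: ifP => _; rewrite ?normrN.
Qed.

Lemma class_top : exists top : 'I_m -> 'I_m, forall i, same_class i (top i) /\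
  forall j, same_class i j -> r j <= r (top i).
Proof.
apply: (@fin_all_exists _ (fun=> 'I_m) (fun i a => same_class i a /\ forall j, same_class i j -> r j <= r a)) => i.
have ii : same_class i i by rewrite /same_class !eqxx.
have [a ia amax] := @Order.TotalTheory.arg_maxP _ _ _ i (same_class i) (reg l) ii.
by exists a; split.
Qed.

Let SL2T x : SL2 x -> SL2 (x^T : 'M[C]_2). Proof. by rewrite /SL2 /= det_tr. Qed.
Let SL2M x y : SL2 x -> SL2 y -> SL2 (x *m y : 'M[C]_2).
Proof. by rewrite /SL2 /= det_mulmx => -> ->; rewrite mulr1. Qed.

Section Class.
Variable i0 : 'I_m.
Hypothesis i0top : forall j, same_class i0 j -> r j <= r i0.

(** The image of $j$ links $i_0$ to an index with the same $w$ and opposite $k$, which cannot have a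
    larger $k+w$. *)
Lemma top_k : 0 <= k 0 i0.
Proof.
have [j] := row_exists i0 (WRe true) SL21; move=> nz.
have [kj wj] := j_support nz.
by have := i0top (M_class (WRe true) SL21 nz); rewrite !regE_weights kj wj; lia.
Qed.

Lemma top_w j : same_class i0 j -> w j <= w i0 /\ - w j <= w i0.
Proof.
have aux a : same_class i0 a -> w a <= w i0.
  move=> ia; have k0 := top_k.
  (* If $k_a$ is negative, $j$ supplies an index with the same $w$ and opposite $k$; maximality of
     $k+w$ then compares the $w$ alone. *)
  have [a' ka' wa'] : exists2 a', k 0 a' = k 0 i0 & w a' = w a.
    case/andP: (ia) => /eqP ka _; have [kp|kn] := leP 0 (k 0 a).
      by exists a => //; move: ka; rewrite !ger0_norm.
    have [a' nz] := row_exists a (WRe true) SL21; have [ka' wa'] := j_support nz.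
    by exists a' => //; move: ka; rewrite ger0_norm // ltr0_norm // ka' => ->.
  have : same_class i0 a' by move: ia; rewrite /same_class ka' wa' eqxx => /andP[].
  by move=> /i0top; rewrite !regE_weights ka' wa'; lia.
move=> ij; split; first exact: aux.
have [j' nz] := row_exists j (WRe false) SL2W; have [kj' wj'] := SL2_weyl_support nz.
by rewrite -wj'; apply: aux; move: ij; rewrite /same_class kj' wj' abszN.
Qed.

Lemma top_row j t : Y t i0 j = (i0 == j)%:R.
Proof.
have [e|nz] := eqVneq (Y t i0 j) 0.
  rewrite e; case: eqP => // ij; move: e; rewrite -ij Y_entry // eqxx.
  by move/eqP; rewrite oner_eq0.
by apply: Y_entry; have [] := top_w (M_class (WRe false) (SL2Y t) nz).
Qed.

Lemma top_col i t : X t i i0 = (i == i0)%:R.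
Proof.
have [e|nz] := eqVneq (X t i i0) 0.
  rewrite e; case: eqP => // ij; move: e; rewrite ij X_entry // eqxx.
  by move/eqP; rewrite oner_eq0.
apply: X_entry; have := M_class (WRe false) (SL2X t) nz.
by rewrite /same_class [`|k 0 i| == _]eq_sym [odd `|w i| == _]eq_sym => /top_w[].
Qed.

(** Gauss decomposition: $x$ is lower unipotent times $\mathrm{diag}(a,a^{-1})$ times upper
    unipotent. The unipotent factors act trivially on the top row and the top column, because
    $w_{i_0}$ is extremal in its class. *)
Lemma top_entry w0 x : WR w0 -> SL2 x -> x 0 0 != 0 ->
  M w0 x i0 i0 = M w0 1%:M i0 i0 * x 0 0 ^ w i0.
Proof.
move=> w0W; rewrite [x]mx2_eta; move: (x 0 0) (x 0 1) (x 1 0) (x 1 1) => a b' c d.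
rewrite /SL2 /= det_mx2E mxE /= => abcd a0; have aS := SL2d a0.
have dE : d = (1 + b' * c) / a by rewrite -abcd; field.
have -> : M w0 (mx2 a b' c d) = Y (c / a) *m (M w0 1%:M *m M id_W (diag2 a a^-1)) *m X (b' / a).
  rewrite -(MM w0W (WRe false) SL21 aS) mul1mx mulW1 -(MM (WRe false) w0W (SL2Y _) aS) mul1W.
  rewrite -(MM w0W (WRe false) (SL2M (SL2Y _) aS) (SL2X _)) mulW1 diag2E !mx2M dE.
  by congr (M _ (mx2 _ _ _ _)); field.
rewrite torus_mx // mul_mx_diag mxE (bigD1 i0) //= top_col eqxx mulr1 big1 ?addr0; last first.
  by move=> j /negPf ji; rewrite top_col ji mulr0.
rewrite mxE (bigD1 i0) //= top_row eqxx mul1r big1 ?addr0; last first.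
  by move=> j ji; rewrite top_row eq_sym (negPf ji) mul0r.
by rewrite !mxE.
Qed.

Lemma tau_diag_entry w0 i : WR w0 -> M (tauW w0) 1%:M i i = M w0 1%:M i i.
Proof.
case: w0 => y []; rewrite {1}/WR /= => y0; rewrite /tauW /=.
  have [ki|ki] := eqVneq (k 0 i) 0.
    have jE (z : C) : z != 0 -> M (z, true) 1%:M i i = M j_W 1%:M i i.
      move=> z0; have -> : M (z, true) 1%:M = M (z, false) 1%:M *m M j_W 1%:M.
        by rewrite -MM // mulWft mulr1 mulmx1.
      by rewrite Mz // mul_diag_mx !mxE ki oppr0 mul0r zpow00 mul1r.
    by rewrite !jE // oppr_eq0 invr_eq0.
  have j0 (z : C) : z != 0 -> M (z, true) 1%:M i i = 0.
    move=> z0; apply/eqP/negPn/negP => /(M_support (WR1 true z0) SL21)[/= e _].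
    by move: ki => /eqP; lia.
  by rewrite !j0 // oppr_eq0 invr_eq0.
have yc0 : y^* != 0 by rewrite conjC_eq0.
have yi0 : (y^*)^-1 != 0 by rewrite invr_eq0.
rewrite !Mz // !mxE eqxx !mulr1n.
apply: (mulIf (zpow_neq0 (k 0 i) ((- k 0 i)%:~R / 2) yc0)).
rewrite -zpowM // mulVf // zpow_conj // zpowMr // subrr.
rewrite rmorphN /= mulNr addrA -opprD -splitr addNr zpow00.
rewrite -[1 in LHS](zpow00 1); apply: (mulIf (zpow_neq0 (k 0 i) (- ((k 0 i)%:~R / 2)) (oner_neq0 C))).
by rewrite zpow00 -zpowM ?oner_neq0 // !mul1r.
Qed.

(** On the cell $x_{00}\neq 0$ both sides are given by [top_entry]. Off it, $x$ times a lower
    unipotent matrix of parameter $t\neq 0$ lies in the cell, and both sides are polynomial in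
    $t$. *)
Lemma top_entry_tau w0 x : WR w0 -> SL2 x -> M (tauW w0) x^T i0 i0 = M w0 x i0 i0.
Proof.
move=> w0W.
have main y : SL2 y -> y 0 0 != 0 -> M (tauW w0) y^T i0 i0 = M w0 y i0 i0.
  move=> yS y0; rewrite (top_entry w0W yS y0).
  have yT0 : y^T 0 0 != 0 by rewrite mxE.
  by rewrite (top_entry (tauW_WR w0W) (SL2T yS) yT0) (tau_diag_entry i0 w0W) [y^T 0 0]mxE.
move=> xS; have [x0|] := eqVneq (x 0 0) 0; last exact: main.
have x01 : x 0 1 != 0.
  apply/eqP => e; move: xS; rewrite [x]mx2_eta /SL2 /= det_mx2E x0 e !mul0r subrr => /eqP.
  by rewrite eq_sym oner_eq0.
have [P HP] : exists P : 'I_m -> {poly C}, forall i t, X t i0 i = (P i).[t].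
  have [P HP] := @fin_all_exists _ (fun=> {poly C}) (fun i P => forall t, X t i0 i = P.[t]) (Xpoly i0).
  by exists P.
have [Q HQ] : exists Q : 'I_m -> {poly C}, forall i t, Y t i i0 = (Q i).[t].
  have [Q HQ] := @fin_all_exists _ (fun=> {poly C}) (fun i P => forall t, Y t i i0 = P.[t]) (fun i => Ypoly i i0).
  by exists Q.
have PQ : \sum_i M (tauW w0) x^T i i0 *: P i = \sum_i M w0 x i0 i *: Q i.
  apply: (@poly_eq_inf _ _ _ 'X); first by rewrite polyX_eq0.
  move=> t; rewrite hornerX => t0.
  have e00 : (x *m mx2 1 0 t 1) 0 0 != 0.
    by rewrite [x]mx2_eta mx2M x0 mxE /= mul0r add0r mulf_neq0.
  have := main _ (SL2M xS (SL2Y t)) e00.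
  have -> : M w0 (x *m mx2 1 0 t 1) = M w0 x *m Y t by rewrite -MM // mulW1.
  have -> : M (tauW w0) (x *m mx2 1 0 t 1)^T = X t *m M (tauW w0) x^T.
    by rewrite trmx_mul tr_mx2 -(MM (WRe false) (tauW_WR w0W) (SL2X t) (SL2T xS)) mul1W.
  rewrite !mxE !horner_sum => e.
  transitivity (\sum_j X t i0 j * M (tauW w0) x^T j i0).
    by apply: eq_bigr => j _; rewrite hornerZ HP mulrC.
  by rewrite e; apply: eq_bigr => j _; rewrite hornerZ HQ.
have := congr1 (fun p => p.[0]) PQ; rewrite !horner_sum.
under eq_bigr => j _ do rewrite hornerZ -HP -mx2_1 M1 mxE mulr_natr mulrb eq_sym.
under [in RHS]eq_bigr => j _ do rewrite hornerZ -HQ -mx2_1 M1 mxE mulr_natr mulrb.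
by rewrite -!big_mkcond !big_pred1_eq.
Qed.

(** The matrix $g = X(1)\,\mathrm{diag}(s,s^{-1})\,Y(1)$ has upper left entry $s+s^{-1}$, so its top
    coefficient expands as $\sum_i c_is^{w_i} = (s+s^{-1})^{w_{i_0}}$. Only indices with $k_i =
    k_{i_0}$ contribute, and their $w_i$ are distinct, so $c_a$ is a binomial coefficient. *)
Lemma reach_top_same_k a : k 0 a = k 0 i0 -> same_class i0 a ->
  X 1 i0 a != 0 /\ Y 1 a i0 != 0.
Proof.
move=> ka ia; have ii : same_class i0 i0 by rewrite /same_class !eqxx.
have [_ w0] := top_w ii; have {}w0 : 0 <= w i0 by lia.
pose c i := X 1 i0 i * Y 1 i i0.
suff : c a != 0 by rewrite mulf_eq0 negb_or => /andP[].
have csupp i : c i != 0 -> k 0 i = k 0 i0 /\ same_class i0 i.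
  rewrite mulf_eq0 negb_or => /andP[nz _].
  by split; [have [] := M_support (WRe false) (SL2X 1) nz | exact: M_class nz].
pose e i := `|(w i0 + w i)%R|%N.
have eE i : same_class i0 i -> (e i)%:Z = w i0 + w i.
  by move=> /top_w[_ h]; rewrite /e gez0_abs //; lia.
pose n := `|w i0|%N; have nE : n%:Z = w i0 by rewrite /n gez0_abs.
have sumE s : s != 0 -> s ^+ 2 + 1 != 0 -> \sum_i c i * s ^ w i = (s + s^-1) ^ w i0.
  move=> s0 s1; have sS := SL2d s0.
  pose g := mx2 1 1 0 1 *m (diag2 s s^-1 *m mx2 1 0 1 1).
  have sY := SL2M sS (SL2Y 1); have gS : SL2 g := SL2M (SL2X 1) sY.
  have g00 : g 0 0 = s + s^-1 by rewrite /g diag2E !mx2M mxE /=; ring.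
  have g0 : g 0 0 != 0.
    rewrite g00; have -> : s + s^-1 = (s ^+ 2 + 1) / s by field.
    by rewrite mulf_neq0 // invr_eq0.
  have := top_entry (WRe false) gS g0.
  rewrite g00 M1 mxE eqxx mul1r => <-.
  have -> : M id_W g = X 1 *m (M id_W (diag2 s s^-1) *m Y 1).
    rewrite -(MM (WRe false) (WRe false) sS (SL2Y 1)) mul1W.
    by rewrite -(MM (WRe false) (WRe false) (SL2X 1) sY) mul1W.
  rewrite torus_mx // mul_diag_mx mxE.
  by apply: eq_bigr => i _; rewrite !mxE /c mulrAC mulrA.
(* The expansion times $s^{w_{i_0}}$, which makes all exponents nonnegative. *)
have PQ : \sum_i c i *: 'X^(e i) = ('X^2 + 1) ^+ n.
  apply: (@poly_eq_inf _ _ _ ('X * ('X^2 + 1))).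
    by rewrite mulf_neq0 ?polyX_eq0 // -[1]polyC1 -size_poly_eq0 size_XnaddC.
  move=> s; rewrite hornerM hornerD hornerXn hornerX hornerC mulf_eq0 negb_or => /andP[s0 s1].
  rewrite horner_exp hornerD hornerXn hornerC horner_sum.
  have -> : s ^+ 2 + 1 = (s + s^-1) * s by field.
  rewrite exprMn -[(_ + _) ^+ n]/((s + s^-1) ^ n%:Z) nE -sumE // mulr_suml.
  apply: eq_bigr => i _; rewrite hornerZ hornerXn -[c i * _ * _]mulrA.
  have [->|/csupp[_ /eE ei]] := eqVneq (c i) 0; first by rewrite !mul0r.
  congr (_ * _); rewrite -[s ^+ e i]/(s ^ (e i)%:Z) -[s ^+ n]/(s ^ n%:Z) ei nE -expfzDr //.
  by rewrite addrC.
have := congr1 (fun p : {poly C} => p`_(e a)) PQ.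
(* Equal parity of $w_a$ and $w_{i_0}$ puts $e_a$ among the even exponents, the only ones that occur
   on the right. *)
have ea : e a = ((e a)./2).*2.
  have : odd (e a) = false; last by have := odd_double_half (e a) => {2}<- ->.
  have := eE a ia; case/andP: ia => _ /eqP; rewrite /e; lia.
rewrite coef_sum (bigD1 a) //= coefZ coefXn eqxx mulr1 big1 ?addr0; last first.
  move=> i ia'; rewrite coefZ coefXn; case: eqP => [ei|]; last by rewrite mulr0.
  have [->|/csupp[ki /eE ei']] := eqVneq (c i) 0; first by rewrite mul0r.
  case/eqP: ia'; apply: weights_inj; rewrite ?ki ?ka //.
  by have := eE a ia; lia.
rewrite [in RHS]ea coef_X2D1_exp => ->; rewrite pnatr_eq0 -lt0n bin_gt0.
by have [h _] := top_w ia; have := eE a ia; lia.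
Qed.

Lemma reach_top a : same_class i0 a -> exists (w1 w2 : weil R) (x1 x2 : 'M[C]_2),
  [/\ WR w1 /\ SL2 x1, WR w2 /\ SL2 x2, M w1 x1 i0 a != 0 & M w2 x2 a i0 != 0].
Proof.
move=> ia; have k0 := top_k.
have [ka|ka] := eqVneq (k 0 a) (k 0 i0).
  by have [? ?] := reach_top_same_k ka ia; exists id_W, id_W, (mx2 1 1 0 1), (mx2 1 0 1 1).
have {}ka : k 0 a = - k 0 i0.
  by case/andP: ia => /eqP h _; move/eqP: ka; lia.
(* When $k_a = -k_{i_0}$, the path to the top goes through the partner $a'$ of $a$ under $j$, where
   the previous case applies. *)
have [a' nz'] := row_exists a (WRe true) SL21; have [ka' wa'] := j_support nz'.
have ka'' : k 0 a' = k 0 i0 by rewrite ka' ka opprK.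
have [a1 nz1] := row_exists a' (WRe true) SL21; have [ka1 wa1] := j_support nz1.
have a1a : a1 = a by apply: weights_inj; rewrite ?ka1 ?wa1 // ka' opprK.
have ia' : same_class i0 a' by move: ia; rewrite /same_class ka' wa' normrN.
have [x0 y0] := reach_top_same_k ka'' ia'; rewrite a1a in nz1.
exists j_W, j_W, (mx2 1 1 0 1), (mx2 1 0 1 1); split=> //.
  have -> : M j_W (mx2 1 1 0 1) = X 1 *m M j_W 1%:M by rewrite -MM // mul1W mulmx1.
  rewrite mxE (bigD1 a') //= big1 ?addr0 ?mulf_neq0 // => i ia1.
  have [->|/j_support[ki wi]] := eqVneq (M j_W 1%:M i a) 0; first by rewrite mulr0.
  by case/eqP: ia1; apply: weights_inj; [rewrite ka' ki opprK | rewrite wa' wi].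
have -> : M j_W (mx2 1 0 1 1) = M j_W 1%:M *m Y 1 by rewrite -MM // mulW1 mul1mx.
rewrite mxE (bigD1 a') //= big1 ?addr0 ?mulf_neq0 // => i ia1.
have [->|/j_support[ki wi]] := eqVneq (M j_W 1%:M a i) 0; first by rewrite mul0r.
by case/eqP: ia1; apply: weights_inj; [rewrite ki ka' | rewrite wi wa'].
Qed.

End Class.

Definition torus_char i (t : C * C) : C := zpow (k 0 i) ((- k 0 i)%:~R / 2) t.1 * t.2 ^ w i.
Definition torus_elt (t : C * C) := t.1 != 0 /\ t.2 != 0.

Lemma torus_char_indep (x : 'I_m -> C) : (forall t, torus_elt t -> \sum_i x i * torus_char i t = 0) -> forall i, x i = 0.
Proof.
apply: (@dedekind _ _ _ (fun t t' : C * C => (t.1 * t'.1, t.2 * t'.2)) torus_elt torus_char (1, 1)).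
- by split=> /=; exact: oner_neq0.
- by move=> i t [t0 t0']; rewrite mulf_neq0 ?zpow_neq0 // expfz_neq0.
- by move=> t t' [? ?] [? ?]; split; rewrite mulf_neq0.
- by move=> i t t' [? ?] [? ?]; rewrite /torus_char /= zpowM // expfzMl; ring.
move=> i j ij; apply: contrapT => H; case/eqP: ij.
have eq_torus_char t : torus_elt t -> torus_char i t = torus_char j t.
  by move=> tok; apply/eqP; apply: contraT => ne; case: H; exists t.
apply: weights_inj.
  have [z z0|//] := @zpow_inj R (k 0 i) (k 0 j) ((- k 0 i)%:~R / 2) ((- k 0 j)%:~R / 2).
  by have := eq_torus_char (z, 1) (conj z0 (oner_neq0 _)); rewrite /torus_char /= !exp1rz !mulr1.
have [c c0 cinj] := exp_base; apply: cinj.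
have := eq_torus_char (1, c) (conj (oner_neq0 _) c0); rewrite /torus_char /=.
have z1 (a : int) (e : C) : zpow a e 1 = 1.
  by rewrite /zpow exp1rz mul1r conjC1 mulr1 /= cpowR1.
by rewrite !z1 !mul1r.
Qed.

Lemma same_class_sym i j : same_class i j = same_class j i.
Proof. by rewrite /same_class ![_ == `|k 0 i|]eq_sym ![_ == odd `|w i|%N]eq_sym. Qed.

Lemma same_class_trans i j a : same_class i j -> same_class j a -> same_class i a.
Proof. by move=> /andP[/eqP e1 /eqP e2]; rewrite /same_class e1 e2. Qed.

(** [contragredient] for the anti-involution $(w,x)\mapsto(jw^{-1}j^{-1},x^T)$, which preserves the
    diagonal torus matrices and, by [top_entry_tau], the top coefficient of each class. *)
Lemma M_adjoint : exists2 rho : 'I_m -> C, forall i, rho i != 0 &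
  forall w0 x, WR w0 -> SL2 x ->
    diag_mx (\row_i rho i) *m M (tauW w0) x^T = (M w0 x)^T *m diag_mx (\row_i rho i).
Proof.
have [top Htop] := class_top.
have top_max i j : same_class (top i) j -> r j <= r (top i).
  by have [it tmax] := Htop i; move=> /(same_class_trans it); exact: tmax.
have tor_diag t : torus_elt t -> M (t.1, false) (diag2 t.2 t.2^-1) = diag_mx (\row_i torus_char i t).
  move=> [t0 t0']; have tS := SL2d t0'.
  have -> : M (t.1, false) (diag2 t.2 t.2^-1) = M (t.1, false) 1%:M *m M id_W (diag2 t.2 t.2^-1).
    by rewrite -MM // mulW1 mul1mx.
  rewrite Mz // torus_mx // mulmx_diag; congr diag_mx.
  by apply/rowP => i; rewrite !mxE.
pose ok (g : weil R * 'M[C]_2) := WR g.1 /\ SL2 g.2.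
pose mul (g h : weil R * 'M[C]_2) := (mulW g.1 h.1, g.2 *m h.2).
pose tau (g : weil R * 'M[C]_2) := (tauW g.1, g.2^T).
pose MG (g : weil R * 'M[C]_2) := M g.1 g.2.
pose tor (t : C * C) : weil R * 'M[C]_2 := ((t.1, false), diag2 t.2 t.2^-1).
have tau1 : tauW id_W = id_W by rewrite /tauW /= conjC1 invr1.
have h1 g h : ok g -> ok h -> ok (mul g h) by move=> [? ?] [? ?]; split; [exact: mulW_WR | exact: SL2M].
have h2 g : ok g -> ok (tau g) by move=> [? ?]; split; [exact: tauW_WR | exact: SL2T].
have h3 t : torus_elt t -> ok (tor t) by move=> [? ?]; split; [exact: WR1 | exact: SL2d].
have h4 : ok (id_W, 1%:M) by split; [exact: WRe | exact: SL21].
have h5 g h : ok g -> ok h -> MG (mul g h) = MG g *m MG h by move=> [? ?] [? ?]; exact: MM.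
have h6 g h : tau (mul g h) = mul (tau h) (tau g) by rewrite /tau /mul tauWM trmx_mul.
have h7 : MG (tau (id_W, 1%:M)) = 1%:M by rewrite /MG /tau tau1 trmx1 M1.
have h8 t : torus_elt t -> MG (tau (tor t)) = MG (tor t).
  move=> [t0 t0']; have tS := SL2d t0'; have tw := tauW_WR (WR1 false t0).
  rewrite /MG /tau /tor /fst /snd; have -> : (diag2 t.2 t.2^-1)^T = diag2 t.2 t.2^-1 by rewrite diag2E tr_mx2.
  have aux w0 : WR w0 -> M w0 (diag2 t.2 t.2^-1) = M w0 1%:M *m M id_W (diag2 t.2 t.2^-1).
    by move=> w0W; rewrite -MM // mulW1 mul1mx.
  rewrite (aux _ tw) (aux _ (WR1 false t0)); congr (_ *m _).
  have tE : tauW (t.1, false) = ((t.1^*)^-1, false) by [].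
  have ti0 : (t.1^*)^-1 != 0 by rewrite invr_eq0 conjC_eq0.
  apply/matrixP => i j; have [<-|ij] := eqVneq i j; first exact: tau_diag_entry (WR1 false t0).
  by rewrite tE !Mz // !mxE (negPf ij) !mulr0n.
have h9 i g : ok g -> MG (tau g) (top i) (top i) = MG g (top i) (top i).
  by move=> [? ?]; apply: top_entry_tau => // j; exact: top_max.
have h10 i : exists a c, [/\ ok a, ok c, MG a (top i) i != 0 & MG c i (top i) != 0].
  have [it _] := Htop i; rewrite same_class_sym in it.
  have [w1 [w2 H]] := reach_top (top_max i) it; have {H}[x1 [x2 H]] := H.
  case: H => o1 o2 n1 n2.
  by exists (w1, x1), (w2, x2).
have h11 g i j : ok g -> MG g i j != 0 -> top i = top j.
  move=> [gW gS] /(M_class gW gS) ij; have [it im] := Htop i; have [jt jm] := Htop j.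
  apply: (reg_inj ld); apply/eqP; rewrite eq_le; apply/andP; split.
    by apply: jm; apply: same_class_trans it; rewrite same_class_sym.
  by apply: im; apply: same_class_trans jt.
have [rho rho0 Hrho] := contragredient h1 h2 h3 h4 h5 h6 M1 h7 tor_diag h8 torus_char_indep h9 h10 h11.
exists rho => // w0 x w0W xS; rewrite mul_diag_mx mul_mx_diag.
apply/matrixP => j i; rewrite !mxE; have := Hrho (w0, x) i j (conj w0W xS).
by rewrite /MG /tau /fst /snd => ->; rewrite mulrCA; congr (_ * _); rewrite mulrCA mulfV ?mulr1.
Qed.

Lemma reg_sign i : (-1) ^ (r i) = (-1) ^+ m.-1 :> C.
Proof.
have N0 : -1 != 0 :> C by rewrite oppr_eq0 oner_eq0.
have -> : r i = (m.-1)%:Z + (l 0 i - (i : nat)%:Z) * 2 by rewrite /reg; have := ltn_ord i; lia.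
rewrite expfzDr // [_ * 2]mulrC -exprz_exp.
have -> : (-1 : C) ^ (2 : int) = 1 by rewrite -exprnP sqrrN expr1n.
by rewrite exp1rz mulr1.
Qed.

(** The square of $(j,W)$ is $(-1,-1)$, which acts at index $i$ by $(-1)^{k_i+w_i}$; by [reg_sign]
    the parity of $k_i+w_i$ is that of $m-1$. *)
Lemma jW_sq : M j_W Wm *m M j_W Wm = ((-1) ^+ m.-1)%:M.
Proof.
have N0 : -1 != 0 :> C by rewrite oppr_eq0 oner_eq0.
have N1 : (-1)^-1 = -1 :> C by rewrite invrN1.
rewrite -MM // mulWtt conjC1 mulr1.
have -> : Wm *m Wm = diag2 (-1) (-1)^-1.
  by rewrite N1 diag2E /Wm mx2M; congr mx2; ring.
have -> : M (-1, false) (diag2 (-1) (-1)^-1) = M (-1, false) 1%:M *m M id_W (diag2 (-1) (-1)^-1).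
  by have := SL2d N0 => ?; rewrite -MM // mulW1 mul1mx.
rewrite Mz // torus_mx // mulmx_diag; apply/matrixP => i j; rewrite !mxE.
case: eqP => [_|]; last by rewrite !mulr0n.
rewrite !mulr1n norm_zpow_half // normrN1 exp1rz mulr1 -expfzDr // -regE_weights.
exact: reg_sign.
Qed.

(** $B$ is the diagonal matrix of [M_adjoint] times $N = M(j,W)$. Invariance comes from
    $\tau(w)\,j\,w = j$ and $x^TWx = W$ for $\det x = 1$. The symmetry sign appears on evaluating
    invariance at $(j,W)$ itself and using the value of $N^2$. *)
Theorem invariant_form : exists B : 'M[C]_m, [/\ B \in unitmx,
  forall i j, j != rev_ord i -> B i j = 0, B^T = (-1) ^+ m.-1 *: B &
  forall w0 x, WR w0 -> SL2 x -> (M w0 x)^T *m B *m M w0 x = B].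
Proof.
have [rho rho0 Hrho] := M_adjoint; set Rho := diag_mx _ in Hrho.
pose N := M j_W Wm; pose eps : C := (-1) ^+ m.-1.
have eps2 : eps * eps = 1 by rewrite /eps -exprMn mulrNN mulr1 expr1n.
have NN : N *m N = eps%:M := jW_sq.
have Rhou : Rho \in unitmx.
  rewrite unitmxE det_diag unitfE; apply/prodf_neq0 => i _; rewrite mxE; exact: rho0.
have inv w0 x : WR w0 -> SL2 x -> (M w0 x)^T *m (Rho *m N) *m M w0 x = Rho *m N.
  move=> w0W xS; rewrite mulmxA -Hrho //.
  have tw := tauW_WR w0W; have tx := SL2T xS.
  have E : M (tauW w0) x^T *m N *m M w0 x = N.
    have pS : SL2 (x^T *m Wm) by exact: SL2M.
    have pW : WR (mulW (tauW w0) j_W) by exact: mulW_WR.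
    rewrite /N -MM // -MM // tauW_mul //; congr (M _ _).
    move: xS; rewrite [x]mx2_eta /SL2 /= det_mx2E => xS.
    rewrite tr_mx2 /Wm !mx2M; congr mx2; first by ring.
    - by rewrite -[RHS]xS; ring.
    - by rewrite -[1 in RHS]xS; ring.
    - by ring.
  by rewrite -!mulmxA [_ *m (N *m _)]mulmxA E.
exists (Rho *m N); split; [| | |exact: inv].
- by rewrite unitmx_mul Rhou; apply: Mu.
- by move=> i j ij; rewrite mul_diag_mx mxE jW_antidiag // mulr0.
have := inv _ _ (WRe true) SL2W; rewrite -/N -!mulmxA NN mulmxA => e.
rewrite trmx_mul tr_diag_mx -[in RHS]e mul_mx_scalar scalerA eps2 scale1r.
by [].
Qed.

End SelfDual.

                                               

(** * Representations compatible with conjugate transposition and their constituents *)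

Section Adjoint.
Variable C : numClosedFieldType.

Definition adjmx m n (A : 'M[C]_(m, n)) : 'M[C]_(n, m) := (map_mx Num.conj A)^T.

Lemma adjmxK m n (A : 'M[C]_(m, n)) : adjmx (adjmx A) = A.
Proof. by apply/matrixP => i j; rewrite !mxE conjCK. Qed.

Lemma adjmxM m n p (A : 'M[C]_(m, n)) (B : 'M[C]_(n, p)) : adjmx (A *m B) = adjmx B *m adjmx A.
Proof. by rewrite /adjmx map_mxM trmx_mul. Qed.

Lemma adjmx0 m n : adjmx (0 : 'M[C]_(m, n)) = 0.
Proof. by rewrite /adjmx map_mx0 trmx0. Qed.

Lemma adjmx_trmx m n (A : 'M[C]_(m, n)) : adjmx A^T = (adjmx A)^T.
Proof. by apply/matrixP => i j; rewrite !mxE. Qed.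

Lemma orthonormal_basis p d (V : 'M[C]_(p, d)) :
  exists2 Q : 'M[C]_(\rank V, d), Q *m adjmx Q = 1%:M & (Q :=: V)%MS.
Proof.
have rd : (\rank V <= d)%N := rank_leq_col V.
exists (schmidt (row_base V)).
  have /unitarymxP <- := schmidt_unitarymx (row_base V) rd.
  by congr (_ *m _); apply/matrixP => i j; rewrite !mxE.
by apply: eqmx_trans (eq_row_base V); apply: eqmx_schmidt_free; exact: row_base_free.
Qed.

                                                                                  
                                                                   
(** The orthonormal rows of $Q$ describe a subspace: [Q^T] is its inclusion and [(adjmx Q)^T] the
    orthogonal projection. Stability under $A$ gives commutation with the inclusion, stability under
    the adjoint gives it for the projection. *)
Lemma compress_stable r d (Q : 'M[C]_(r, d)) (A : 'M[C]_d) :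
  Q *m adjmx Q = 1%:M -> stablemx Q A^T -> stablemx Q (adjmx A)^T ->
  A *m Q^T = Q^T *m ((adjmx Q)^T *m A *m Q^T) /\
  (adjmx Q)^T *m A = ((adjmx Q)^T *m A *m Q^T) *m (adjmx Q)^T.
Proof.
move=> QQ; have QQ' : (adjmx Q)^T *m Q^T = 1%:M by rewrite -trmx_mul QQ trmx1.
have main (D : 'M[C]_d) : stablemx Q D^T -> D *m Q^T = Q^T *m ((adjmx Q)^T *m D *m Q^T).
  move=> /submxP[X QX]; have DQ : D *m Q^T = Q^T *m X^T by rewrite -trmx_mul -QX trmx_mul trmxK.
  by rewrite -(mulmxA _ D) DQ (mulmxA _ Q^T) QQ' mul1mx.
move=> sA sA'; split; first exact: main.
have := congr1 (@adjmx _ _) (main _ sA').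
rewrite !adjmxM !adjmxK (adjmx_trmx Q) (adjmx_trmx (adjmx Q)) adjmxK => e.
by rewrite {1}e !mulmxA.
Qed.

Lemma compress_unit r d (Q : 'M[C]_(r, d)) (A : 'M[C]_d) : Q *m adjmx Q = 1%:M ->
  (adjmx Q)^T *m A = ((adjmx Q)^T *m A *m Q^T) *m (adjmx Q)^T ->
  A \in unitmx -> (adjmx Q)^T *m A *m Q^T \in unitmx.
Proof.
move=> QQ c2 Au; suff : ((adjmx Q)^T *m A *m Q^T) *m ((adjmx Q)^T *m invmx A *m Q^T) = 1%:M.
  by move=> /mulmx1_unit[].
by rewrite !mulmxA -c2 -(mulmxA _ A) mulmxV // mulmx1 -trmx_mul QQ trmx1.
Qed.

Lemma compress_mul r d (Q : 'M[C]_(r, d)) (A D : 'M[C]_d) :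
  (adjmx Q)^T *m A = ((adjmx Q)^T *m A *m Q^T) *m (adjmx Q)^T ->
  (adjmx Q)^T *m (A *m D) *m Q^T = ((adjmx Q)^T *m A *m Q^T) *m ((adjmx Q)^T *m D *m Q^T).
Proof. by move=> c2; rewrite (mulmxA _ A D) {1}c2 !mulmxA. Qed.

Lemma adjmx_compress r d (Q : 'M[C]_(r, d)) (A : 'M[C]_d) :
  (adjmx Q)^T *m adjmx A *m Q^T = adjmx ((adjmx Q)^T *m A *m Q^T).
Proof. by rewrite !adjmxM (adjmx_trmx Q) (adjmx_trmx (adjmx Q)) adjmxK mulmxA. Qed.

Lemma compress_eq0 r d (Q : 'M[C]_(r, d)) (w : 'cV[C]_d) :
  ((adjmx Q)^T *m w == 0) = (Q *m adjmx w^T == 0).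
Proof.
rewrite -[LHS](inj_eq (can_inj (@adjmxK _ _))) adjmx0 adjmxM (adjmx_trmx (adjmx Q)) adjmxK.
by rewrite -[LHS](inj_eq trmx_inj) trmx0 trmx_mul trmxK (adjmx_trmx w).
Qed.

End Adjoint.

Section Constituent.
Variables (R : realType) (N : nat).
Local Notation C := (Cx R).
Variables (G B : set 'M[C]_N) (chi : 'M[C]_N -> C).
Hypothesis Gadj : forall g, G g -> G (adjmx g).
Hypothesis GU : forall g, G g -> g \in unitmx.
Hypothesis BG : forall b, B b -> G b.

(** An algebraic form of unitarity on the compact form: it makes orthogonal complements of stable
    subspaces stable, without integration over a compact group. *)
Definition adj_rep d (rho : 'M[C]_N -> 'M[C]_d) :=
  alg_rep G rho /\ forall g, G g -> rho (adjmx g) = adjmx (rho g).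

Definition weight_vector d (rho : 'M[C]_N -> 'M[C]_d) (w : 'cV[C]_d) :=
  w != 0 /\ forall b, B b -> rho b *m w = chi b *: w.

Lemma regular_compress d e (rho : 'M[C]_N -> 'M[C]_d) (A : 'M[C]_(e, d)) (D : 'M[C]_(d, e)) :
  (forall i j, regular_on G (fun g => rho g i j)) ->
  forall i j, regular_on G (fun g => (A *m rho g *m D) i j).
Proof.
move=> rr i j.
apply: (@regular_ext _ _ _ (fun g => \sum_a (\sum_b A i b * rho g b a) * D a j)).
  by move=> g _; rewrite mxE; apply: eq_bigr => a _; rewrite mxE.
apply: (regular_sum _ GU) => a; apply: regular_mul; last exact: regular_cst.
by apply: (regular_sum _ GU) => b; apply: regular_mul; [exact: regular_cst | exact: rr].
Qed.

Lemma compress_rep d r (rho : 'M[C]_N -> 'M[C]_d) (Q : 'M[C]_(r, d)) (w : 'cV[C]_d) :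
  adj_rep rho -> weight_vector rho w ->
  Q *m adjmx Q = 1%:M -> (forall g, G g -> stablemx Q (rho g)^T) ->
  (adjmx Q)^T *m w != 0 ->
  adj_rep (fun g => (adjmx Q)^T *m rho g *m Q^T) /\
  weight_vector (fun g => (adjmx Q)^T *m rho g *m Q^T) ((adjmx Q)^T *m w).
Proof.
move=> [[ru rM rr] ra] [w0 wB] QQ Qs Qw.
have QQ' : (adjmx Q)^T *m Q^T = 1%:M by rewrite -trmx_mul QQ trmx1.
have cs g : G g -> rho g *m Q^T = Q^T *m ((adjmx Q)^T *m rho g *m Q^T) /\
    (adjmx Q)^T *m rho g = ((adjmx Q)^T *m rho g *m Q^T) *m (adjmx Q)^T.
  by move=> Gg; apply: compress_stable => //; [exact: Qs | rewrite -ra //; apply: Qs; exact: Gadj].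
split; split=> //.
- split; last exact: regular_compress.
  + by move=> g Gg; have [_ c2] := cs g Gg; apply: compress_unit => //; exact: ru.
  + by move=> g h Gg Gh; have [_ c2] := cs g Gg; rewrite rM // compress_mul.
- by move=> g Gg; rewrite ra // adjmx_compress.
move=> b Bb; have [_ c2] := cs b (BG Bb).
by rewrite mulmxA -c2 -mulmxA wB // scalemxAr.
Qed.

(** Induction on the dimension. For a proper nonzero stable subspace, the weight vector has a
    nonzero projection to it or lies in its orthogonal complement, and projection keeps the
    weight. *)
Lemma irr_constituent d (rho : 'M[C]_N -> 'M[C]_d) (w : 'cV[C]_d) :
  adj_rep rho -> weight_vector rho w ->
  exists d' (rho' : 'M[C]_N -> 'M[C]_d') (w' : 'cV[C]_d'),
    [/\ adj_rep rho', irreducible G rho' & weight_vector rho' w'].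
Proof.
have [n] := ubnP d; elim: n d rho w => // n IH d rho w dn rr ww.
have [irr|nirr] := pselect (irreducible G rho); first by exists d, rho, w.
have d0 : (0 < d)%N.
  by case: d {dn rr nirr} rho w ww => // rho w [w0 _]; case/eqP: w0; apply/matrixP => [[]].
have [U [Us U0 Uf]] : exists U : 'M[C]_d, [/\ forall g, G g -> stablemx U (rho g)^T, U <> 0 & ~ row_full U].
  apply: contrapT => H; apply: nirr; split=> // U Us.
  have [|U0] := pselect (U = 0); first by left.
  have [|Uf] := pselect (row_full U); first by right.
  by case: H; exists U.
have step p (V : 'M[C]_(p, d)) : (forall g, G g -> stablemx V (rho g)^T) ->
    (\rank V < d)%N -> (forall Q : 'M[C]_(\rank V, d), (Q :=: V)%MS -> Q *m adjmx Q = 1%:M -> (adjmx Q)^T *m w != 0) ->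
    exists d' (rho' : 'M[C]_N -> 'M[C]_d') (w' : 'cV[C]_d'),
    [/\ adj_rep rho', irreducible G rho' & weight_vector rho' w'].
  move=> Vs Vd Vw; have [Q QQ QV] := orthonormal_basis V.
  have [|c1 c2] := compress_rep rr ww QQ _ (Vw Q QV QQ).
    by move=> g Gg; rewrite (eqmx_stable _ QV); exact: Vs.
  by apply: IH c1 c2; apply: leq_trans Vd _; rewrite -ltnS.
have Ud : (\rank U < d)%N by rewrite ltn_neqAle rank_leq_col andbT; apply/negP => h; apply: Uf.
have [Uw|Uw] := eqVneq (U *m adjmx w^T) 0; last first.
  apply: (step _ U) => // Q QU _; rewrite compress_eq0; apply: contraNneq Uw => Qw.
  have /submxP[Z ->] : (U <= Q)%MS by rewrite QU.
  by rewrite -mulmxA Qw mulmx0.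
pose V := kermx (adjmx U).
have wV : (w^T <= V)%MS.
  apply/sub_kermxP; have := congr1 (@adjmx _ _ _) Uw.
  by rewrite adjmxM adjmxK adjmx0.
apply: (step _ V).
- move=> g Gg; apply/sub_kermxP.
  have /submxP[Y UY] := Us _ (Gadj Gg).
  have E : (rho g)^T *m adjmx U = adjmx U *m adjmx Y.
    rewrite -adjmxM -UY; have [_ ra] := rr; rewrite ra // adjmxM.
    by rewrite (adjmx_trmx (adjmx (rho g))) adjmxK.
  by rewrite -mulmxA E mulmxA mulmx_ker mul0mx.
- rewrite mxrank_ker -[X in (_ < X)%N]subn0 ltn_sub2l // lt0n mxrank_eq0.
  by apply/eqP => /(congr1 (@adjmx _ _ _)); rewrite adjmxK adjmx0.
move=> Q QV QQ; have /submxP[y wy] : (w^T <= Q)%MS by rewrite QV.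
have wE : w = Q^T *m y^T by rewrite -trmx_mul -wy trmxK.
rewrite {1}wE mulmxA -trmx_mul QQ trmx1 mul1mx; have [w0 _] := ww.
by apply: contraNneq w0 => y0; rewrite wE y0 mulmx0.
Qed.

End Constituent.

(** * Dominant weights of $\mathrm{GL}_N$ are realised *)

Section HighestWeightGL.
Variables (R : realType) (N : nat).
Local Notation C := (Cx R).
Local Notation GLN := (GL R N).

Definition weight n (l : 'rV[int]_n) (b : 'M[C]_n) : C := \prod_i b i i ^ l 0 i.

Definition borel : set 'M[C]_N := [set b | GLN b /\ is_trig_mx b^T].

Definition GLhw (l : 'rV[int]_N) : Prop :=
  exists d (rho : 'M[C]_N -> 'M[C]_d) (w : 'cV[C]_d),
    adj_rep GLN rho /\ weight_vector borel (weight l) rho w.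

Lemma alg_rep1 (G : set 'M[C]_N) d (rho : 'M[C]_N -> 'M[C]_d) :
  G 1%:M -> alg_rep G rho -> rho 1%:M = 1%:M.
Proof.
move=> G1 [ru rM _]; apply: (can_inj (mulKmx (ru _ G1))).
by rewrite mulmx1 -rM // mulmx1.
Qed.

Lemma GLN1 : GLN 1%:M. Proof. exact: unitmx1. Qed.

Lemma alg_rep_GL d (rho : 'M[C]_N -> 'M[C]_d) : rho 1%:M = 1%:M ->
  (forall g h, GLN g -> GLN h -> rho (g *m h) = rho g *m rho h) ->
  (forall i j, regular_on GLN (fun g => rho g i j)) -> alg_rep GLN rho.
Proof.
move=> r1 rM rr; split=> // g Gg.
have Gi : GLN (invmx g) by rewrite /GL /= unitmx_inv.
by have /mulmx1_unit[] : rho g *m rho (invmx g) = 1%:M by rewrite -rM // mulmxV.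
Qed.

Lemma upper_entry (b : 'M[C]_N) (i j : 'I_N) : borel b -> (j < i)%N -> b i j = 0.
Proof. by move=> [_ /is_trig_mxP bt] /bt; rewrite mxE. Qed.

Lemma det_upper (b : 'M[C]_N) : borel b -> \det b = \prod_i b i i.
Proof.
by move=> [_ bt]; rewrite -det_tr det_trig //; apply: eq_bigr => i _; rewrite mxE.
Qed.

Lemma upper_diag_neq0 (b : 'M[C]_N) i : borel b -> b i i != 0.
Proof.
move=> bB; have := det_upper bB; case: bB; rewrite /GL /= unitmxE unitfE => d0 _ dE.
by move: d0; rewrite dE => /prodf_neq0 /(_ i isT).
Qed.

Lemma GLhw_eq (l l' : 'rV[int]_N) : (forall i, l 0 i = l' 0 i) -> GLhw l -> GLhw l'.
Proof. by move=> e; have -> : l = l' by apply/rowP. Qed.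

Lemma GLhw_det (z : int) : GLhw (const_mx z).
Proof.
exists 1%N, (fun g => (\det g ^ z)%:M), 1%:M; split; split.
- apply: alg_rep_GL.
  + by rewrite det1 exp1rz.
  + by move=> g h _ _; rewrite det_mulmx expfzMl scalar_mxM.
  + move=> i j; rewrite !ord1; apply: (@regular_ext _ _ _ (fun g => \det g ^ z)).
      by move=> g _; rewrite mxE mulr1n.
    exact: regular_exp_det.
- move=> g _; apply/matrixP => i j; rewrite !ord1 !mxE !mulr1n det_tr.
  by rewrite det_map_mx fmorphXz.
- by apply/eqP => /matrixP /(_ 0 0) /eqP; rewrite !mxE eqxx oner_eq0.
- move=> b bB; rewrite mulmx1 scale_scalar_mx mulr1; congr (_%:M).
  rewrite det_upper // /weight; elim/big_rec2: _ => [|i y x _ <-]; first by rewrite exp1rz.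
  by rewrite expfzMl mxE.
Qed.

Lemma GLhw_add l l' : GLhw l -> GLhw l' -> GLhw (l + l').
Proof.
move=> [d [rho [w [[ra rs] [w0 wB]]]]] [d' [rho' [w' [[ra' rs'] [w'0 w'B]]]]].
have [_ rM rr] := ra; have [_ rM' rr'] := ra'.
exists (d * d')%N, (fun g => rho g *t rho' g), (w *t w' : 'cV[C]_(d * d')); split; split.
- apply: alg_rep_GL.
  + rewrite (alg_rep1 GLN1 ra) (alg_rep1 GLN1 ra'); apply/matrixP => i j.
    case: (mxtens_indexP i) => a a'; case: (mxtens_indexP j) => c c'.
    rewrite tensmxE !mxE (can_eq (@mxtens_indexK _ _)) xpair_eqE.
    by case: (a == c); case: (a' == c'); rewrite /= ?mulr1 ?mulr0 ?mul0r.
  + by move=> g h Gg Gh; rewrite rM // rM' // tensmx_mul.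
  + move=> i j; case: (mxtens_indexP i) => a a'; case: (mxtens_indexP j) => c c'.
    apply: (@regular_ext _ _ _ (fun g => rho g a c * rho' g a' c')).
      by move=> g _; rewrite tensmxE.
    by apply: regular_mul.
- move=> g Gg; rewrite rs // rs' //; apply/matrixP => i j.
  case: (mxtens_indexP i) => a a'; case: (mxtens_indexP j) => c c'.
  by rewrite tensmxE !mxE !mxtens_indexK /= rmorphM.
- have [i wi] : exists i, w i 0 != 0.
    by apply: contrapT => H; case/eqP: w0; apply/matrixP => i j; rewrite ord1 mxE; apply: contrapT => /eqP wi; case: H; exists i.
  have [i' wi'] : exists i, w' i 0 != 0.
    by apply: contrapT => H; case/eqP: w'0; apply/matrixP => i' j; rewrite ord1 mxE; apply: contrapT => /eqP wi'; case: H; exists i'.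
  apply/eqP => /matrixP /(_ (mxtens_index (i, i')) 0).
  rewrite !mxE !mxtens_indexK /= !ord1 => /eqP.
  by rewrite mulf_eq0 (negPf wi) (negPf wi').
- move=> b bB; have -> : (rho b *t rho' b) *m (w *t w' : 'cV[C]_(d * d')) = (rho b *m w) *t (rho' b *m w').
    by rewrite -tensmx_mul.
  rewrite wB // w'B //; apply/matrixP => i j; rewrite !mxE mulrACA; congr (_ * _).
  rewrite /weight -big_split /=; apply: eq_bigr => a _.
  by rewrite mxE expfzDr // upper_diag_neq0.
Qed.

Lemma GLhw0 : GLhw 0.
Proof. by apply: GLhw_eq (GLhw_det 0) => i; rewrite !mxE. Qed.

Lemma GLhw_sum (I : Type) (r : seq I) (n : I -> nat) (l : I -> 'rV[int]_N) :
  (forall i, GLhw (l i)) -> GLhw (\sum_(i <- r) l i *+ n i).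
Proof.
move=> hl; elim/big_rec: _ => [|i x _ hx]; first exact: GLhw0.
apply: GLhw_add => //; elim: (n i) => [|k IH]; first by rewrite mulr0n; exact: GLhw0.
by rewrite mulrS; exact: GLhw_add.
Qed.

Section Fundamental.
Variable k : nat.
Hypothesis kN : (k <= N)%N.
Local Notation T := {ffun 'I_k -> 'I_N}.
Local Notation d := #|{: T}|.

Definition tens_rep (g : 'M[C]_N) : 'M[C]_d :=
  \matrix_(a, c) \prod_i g ((enum_val a : T) i) ((enum_val c : T) i).

Definition alt_mx (f : T) : 'M[C]_k := \matrix_(i, j) (f i == widen_ord kN j)%:R.

Lemma sum_enum_val (F : T -> C) : \sum_(c < d) F (enum_val c) = \sum_(f : T) F f.
Proof. by rewrite [RHS](big_enum_val (A := predT)). Qed.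

Lemma tens_rep_mul g h : tens_rep (g *m h) = tens_rep g *m tens_rep h.
Proof.
apply/matrixP => a c; rewrite !mxE.
under eq_bigr => i _ do rewrite mxE.
rewrite bigA_distr_bigA /=.
rewrite -(sum_enum_val (fun f => \prod_i (g ((enum_val a : T) i) (f i) * h (f i) ((enum_val c : T) i)))).
by apply: eq_bigr => e _; rewrite !mxE big_split.
Qed.

Lemma tens_rep1 : tens_rep 1%:M = 1%:M.
Proof.
apply/matrixP => a c; rewrite !mxE.
have [->|ac] := eqVneq a c; first by rewrite big1 // => i _; rewrite mxE eqxx.
have [i fi] : exists i, (enum_val a : T) i != (enum_val c : T) i.
  apply: contrapT => H; case/eqP: ac; apply: enum_val_inj; apply/ffunP => i.
  by apply: contrapT => /eqP e; apply: H; exists i.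
by rewrite (bigD1 i) //= mxE (negPf fi) mul0r.
Qed.

Lemma tens_rep_alt (b : 'M[C]_N) (f : T) :
  \sum_(f' : T) (\prod_i b (f i) (f' i)) * \det (alt_mx f') =
  \det (\matrix_(i, j) b (f i) (widen_ord kN j)).
Proof.
rewrite /determinant; under eq_bigr => f' _ do rewrite mulr_sumr.
rewrite exchange_big /=; apply: eq_bigr => s _.
under eq_bigr => f' _ do rewrite mulrCA.
rewrite -mulr_sumr; congr (_ * _).
transitivity (\sum_(f' : T) \prod_i (b (f i) (f' i) * (f' i == widen_ord kN (s i))%:R)).
  by apply: eq_bigr => f' _; rewrite -big_split; apply: eq_bigr => i _; rewrite mxE.
rewrite -(bigA_distr_bigA (fun i x => b (f i) x * (x == widen_ord kN (s i))%:R)).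
apply: eq_bigr => i _; rewrite mxE (bigD1 (widen_ord kN (s i))) //= eqxx mulr1.
by rewrite big1 ?addr0 // => x /negPf ->; rewrite mulr0.
Qed.

Lemma det_upper_minor (b : 'M[C]_N) (f : T) : borel b ->
  \det (\matrix_(i, j) b (f i) (widen_ord kN j)) =
  \prod_(j < k) b (widen_ord kN j) (widen_ord kN j) * \det (alt_mx f).
Proof.
move=> bB; pose bk : 'M[C]_k := \matrix_(x, j) b (widen_ord kN x) (widen_ord kN j).
have -> : \matrix_(i, j) b (f i) (widen_ord kN j) = alt_mx f *m bk.
  apply/matrixP => i j; rewrite !mxE.
  have [fk|kf] := ltnP (f i) k.
    have fE : f i = widen_ord kN (Ordinal fk) by apply: val_inj.
    rewrite (bigD1 (Ordinal fk)) //= !mxE -fE eqxx mul1r big1 ?addr0 // => x xf.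
    rewrite !mxE (_ : _ == _ = false) ?mul0r //; apply: contraNF xf => /eqP e.
    by apply/eqP/val_inj; rewrite /= e.
  rewrite upper_entry //=; last exact: leq_trans (ltn_ord j) kf.
  rewrite big1 // => x _; rewrite !mxE (_ : _ == _ = false) ?mul0r //.
  by apply/eqP => e; move: kf; rewrite e /= leqNgt ltn_ord.
rewrite det_mulmx mulrC; congr (_ * _).
rewrite -det_tr det_trig; first by apply: eq_bigr => i _; rewrite !mxE.
by apply/is_trig_mxP => i j ij; rewrite !mxE upper_entry.
Qed.

(** The vector is $e_1\wedge\dots\wedge e_k$ inside the $k$-th tensor power, with coordinate
    [\det (alt_mx f)] at $f$. An upper triangular $b$ multiplies it by its leading $k\times k$
    minor. *)
Lemma GLhw_fundamental : GLhw (\row_i (i < k)%N%:Z).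
Proof.
exists d, tens_rep, (\col_a \det (alt_mx (enum_val a))); split; split.
- apply: alg_rep_GL; [exact: tens_rep1 | by move=> g h _ _; exact: tens_rep_mul |].
  move=> i j; apply: (@regular_ext _ _ _ (fun g => \prod_x g ((enum_val i : T) x) ((enum_val j : T) x))).
    by move=> g _; rewrite mxE.
  by apply: regular_prod => x; exact: regular_entry.
- move=> g _; apply/matrixP => a c; rewrite !mxE rmorph_prod.
  by apply: eq_bigr => x _; rewrite !mxE.
- pose f0 : T := [ffun i => widen_ord kN i].
  apply/eqP => /matrixP /(_ (enum_rank f0) 0); rewrite !mxE enum_rankK.
  have -> : alt_mx f0 = 1%:M.
    by apply/matrixP => i j; rewrite !mxE ffunE -val_eqE.
  by rewrite det1 => /eqP; rewrite oner_eq0.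
move=> b bB; apply/matrixP => a j; rewrite !mxE.
under eq_bigr => c _ do rewrite !mxE.
rewrite (sum_enum_val (fun f' => (\prod_i b ((enum_val a : T) i) (f' i)) * \det (alt_mx f'))).
rewrite tens_rep_alt det_upper_minor //; congr (_ * _).
rewrite /weight -(big_ord_narrow (F := fun i => b i i) kN) big_mkcond; apply: eq_bigr => i _.
by rewrite mxE; case: ifP; rewrite ?expr1z ?expr0z.
Qed.

End Fundamental.

(** A dominant weight is a nonnegative combination of fundamental weights plus a multiple of the
    determinant; tensor products add weights. *)
Theorem GLhw_dominant (l : 'rV[int]_N) : dominant l -> GLhw l.
Proof.
move=> ld; case: (posnP N) => [N0|N0].
  by apply: GLhw_eq GLhw0 => i; have := ltn_ord i; rewrite {2}N0.
have last : (N.-1 < N)%N by rewrite prednK.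
(* Past the end [L] repeats the last entry, so the last difference is $0$ and the determinant
   accounts for that entry. *)
pose L (n : nat) : int := l 0 (insubd (Ordinal last) n).
pose a (i : 'I_N) : int := L i - L i.+1.
have kN (i : 'I_N) : (i.+1 <= N)%N := ltn_ord i.
have := GLhw_add (GLhw_sum (index_enum 'I_N) (fun i => `|a i|%N) (fun i => GLhw_fundamental (kN i)))
  (GLhw_det (l 0 (Ordinal last))).
apply: GLhw_eq => i; rewrite !mxE summxE.
have LE (j : 'I_N) : L j = l 0 j by congr (l 0 _); apply: val_inj; rewrite val_insubd ltn_ord.
have LN : L N = l 0 (Ordinal last) by congr (l 0 _); apply: val_inj; rewrite val_insubd ltnn.
have a0 (j : 'I_N) : `|a j|%N%:Z = a j.
  rewrite gez0_abs // subr_ge0 LE /L; apply: ld; rewrite val_insubd /=.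
  by case: ifP => // _; have := ltn_ord j; lia.
transitivity (\sum_(j < N | (i <= j)%N) (L j - L j.+1) + L N).
  rewrite LN; congr (_ + _); rewrite [RHS]big_mkcond; apply: eq_bigr => j _.
  rewrite mulmxnE mxE ltnS; case: leqP => _; last by rewrite mul0rn.
  by rewrite -[RHS]/(a j) -a0 -mulr_natr mul1r natz.
rewrite (eq_bigl (fun j : 'I_N => predT (j : nat) && (i <= j)%N)) //.
rewrite -(big_geq_mkord i N predT (fun j => L j - L j.+1)) -(LE i).
under eq_bigr => j _ do rewrite -opprB.
by rewrite sumrN telescope_sumr 1?ltnW // opprB subrK.
Qed.

End HighestWeightGL.

                                     

(** * Subgroups $\mathrm{SL}_2$ and the positivity they impose *)

Section Embedding.
Variable F : comNzRingType.
Variables (N k : nat) (f : 'I_k -> 'I_N).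

                                                                      
Definition sel : 'M[F]_(k, N) := \matrix_(a, i) (f a == i)%:R.
Definition embed (X : 'M[F]_k) : 'M[F]_N := 1%:M + sel^T *m (X - 1%:M) *m sel.

Lemma embed1 : embed 1%:M = 1%:M.
Proof. by rewrite /embed subrr mulmx0 mul0mx addr0. Qed.

Lemma embed_entry X i j : embed X i j =
  (i == j)%:R + \sum_a \sum_c (f a == i)%:R * (X a c - (a == c)%:R) * (f c == j)%:R.
Proof.
rewrite !mxE exchange_big; congr (_ + _); apply: eq_bigr => c _.
by rewrite !mxE mulr_suml; apply: eq_bigr => a _; rewrite !mxE.
Qed.

Hypothesis finj : injective f.

Lemma sel_sel : sel *m sel^T = 1%:M.
Proof.
apply/matrixP => a c; rewrite !mxE (bigD1 (f a)) //= !mxE eqxx mul1r big1 ?addr0.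
  by rewrite (inj_eq finj) eq_sym.
by move=> i ia; rewrite mxE eq_sym (negPf ia) mul0r.
Qed.

Lemma embedM X Y : embed (X *m Y) = embed X *m embed Y.
Proof.
rewrite /embed mulmxDl mul1mx mulmxDr mulmx1 -!addrA; congr (_ + _).
have -> : sel^T *m (X - 1%:M) *m sel *m (sel^T *m (Y - 1%:M) *m sel) =
   sel^T *m ((X - 1%:M) *m (Y - 1%:M)) *m sel.
  by rewrite !mulmxA -(mulmxA _ sel sel^T) sel_sel mulmx1.
have -> : X *m Y - 1%:M = (X - 1%:M) + ((Y - 1%:M) + (X - 1%:M) *m (Y - 1%:M)).
  rewrite [in RHS]mulmxBr mulmx1 addrCA;
  rewrite [X - 1%:M + _]addrC subrK mulmxBl mul1mx.
  by rewrite [RHS]addrC addrA subrK.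
by rewrite !(mulmxDr, mulmxDl) addrCA.
Qed.

Lemma det_embed X : \det (embed X) = \det X.
Proof.
have sylvester n p (A : 'M[F]_(n, p)) (D : 'M[F]_(p, n)) :
    \det (1%:M + A *m D) = \det (1%:M + D *m A).
  pose M : 'M[F]_(n + p) := block_mx 1%:M (- A) D 1%:M.
  transitivity (\det M).
    have -> : M = block_mx (1%:M + A *m D) (- A) 0 1%:M *m block_mx 1%:M 0 D 1%:M.
      by rewrite mulmx_block !(mulmx1, mulmx0, mul0mx, mul1mx, add0r) mulNmx addrK.
    by rewrite det_mulmx det_ublock det_lblock !det1 !mulr1.
  have -> : M = block_mx 1%:M 0 D 1%:M *m block_mx 1%:M (- A) 0 (1%:M + D *m A).
    by rewrite mulmx_block !(mulmx1, mulmx0, mul0mx, mul1mx, add0r, addr0) mulmxN addrC addrK.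
  by rewrite det_mulmx det_ublock det_lblock !det1 !mul1r.
rewrite /embed -mulmxA sylvester -mulmxA sel_sel mulmx1.
by rewrite addrC subrK.
Qed.

(** By the first hypothesis $J$ splits into a form on the coordinates in the image of $f$ and one on
    the remaining coordinates, where [embed X] is the identity. *)
Lemma embed_isometry (J : 'M[F]_N) X :
  (forall i a, (forall c, f c != i) -> J (f a) i = 0 /\ J i (f a) = 0) ->
  X *m (sel *m J *m sel^T) *m X^T = sel *m J *m sel^T ->
  embed X *m J *m (embed X)^T = J.
Proof.
move=> Jf XJ; set K := sel *m J *m sel^T in XJ.
have selE a i : sel a i = (f a == i)%:R by rewrite mxE.
have selJ : sel *m J = K *m sel.
  apply/matrixP => a i; rewrite /K -mulmxA.
  have -> : (sel *m J *m (sel^T *m sel)) a i = \sum_c J (f a) (f c) * (f c == i)%:R.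
    rewrite mulmxA mxE; apply: eq_bigr => c _; rewrite selE; congr (_ * _).
    rewrite mxE (bigD1 (f c)) //= big1 ?addr0; last first.
      by move=> x xc; rewrite [in X in _ * X]mxE selE eq_sym (negPf xc) mulr0.
    rewrite [in X in _ * X]mxE selE eqxx mulr1 mxE (bigD1 (f a)) //= big1 ?addr0.
      by rewrite selE eqxx mul1r.
    by move=> x xa; rewrite selE eq_sym (negPf xa) mul0r.
  rewrite mxE (bigD1 (f a)) //= big1 ?addr0; last first.
    by move=> x xa; rewrite selE eq_sym (negPf xa) mul0r.
  rewrite selE eqxx mul1r.
  have [[c ci]|ni] := pselect (exists c, f c = i).
    rewrite (bigD1 c) //= ci eqxx mulr1 big1 ?addr0 // => c' cc'.
    by rewrite -ci (inj_eq finj) (negPf cc') mulr0.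
  have ni' c : f c != i by apply/eqP => ci; apply: ni; exists c.
  have [-> _] := Jf i a ni'; rewrite big1 // => c _.
  by rewrite (negPf (ni' c)) mulr0.
have Jsel : J *m sel^T = sel^T *m K.
  apply/matrixP => i a; rewrite /K 2!mulmxA -(mulmxA _ J).
  have -> : (sel^T *m sel *m (J *m sel^T)) i a = \sum_c (f c == i)%:R * J (f c) (f a).
    rewrite -mulmxA mxE; apply: eq_bigr => c _; rewrite [in LHS]mxE selE; congr (_ * _).
    rewrite mxE (bigD1 (f c)) //= big1 ?addr0; last first.
      by move=> x xc; rewrite selE eq_sym (negPf xc) mul0r.
    rewrite selE eqxx mul1r mxE (bigD1 (f a)) //= big1 ?addr0.
      by rewrite mxE selE eqxx mulr1.
    by move=> x xa; rewrite [in X in _ * X]mxE selE eq_sym (negPf xa) mulr0.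
  rewrite mxE (bigD1 (f a)) //= big1 ?addr0; last first.
    by move=> x xa; rewrite [in X in _ * X]mxE selE eq_sym (negPf xa) mulr0.
  rewrite mxE selE eqxx mulr1.
  have [[c ci]|ni] := pselect (exists c, f c = i).
    rewrite (bigD1 c) //= ci eqxx mul1r big1 ?addr0 // => c' cc'.
    by rewrite -ci (inj_eq finj) (negPf cc') mul0r.
  have ni' c : f c != i by apply/eqP => ci; apply: ni; exists c.
  have [_ ->] := Jf i a ni'; rewrite big1 // => c _.
  by rewrite (negPf (ni' c)) mul0r.
have XJ1 : (X - 1%:M) *m K + (K *m (X - 1%:M)^T + (X - 1%:M) *m K *m (X - 1%:M)^T) = 0.
  rewrite mulmxBl mul1mx raddfB /= trmx1 !mulmxBr !mulmx1 mulmxBl XJ.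
  by rewrite -[K - _]opprB (addrA (K *m X^T - K)) subrr add0r subrr.
pose A := X - 1%:M; rewrite -/A in XJ1.
have XE : embed X = 1%:M + sel^T *m A *m sel by [].
clearbody A.
have -> : embed X *m J *m (embed X)^T =
    J + sel^T *m (A *m K + (K *m A^T + A *m K *m A^T)) *m sel.
  have -> : (embed X)^T = 1%:M + sel^T *m A^T *m sel.
    by rewrite XE raddfD /= trmx1 !trmx_mul trmxK mulmxA.
  rewrite XE !(mulmxDl, mulmxDr) !mul1mx !mulmx1 -!addrA; congr (_ + _).
  have -> : sel^T *m A *m sel *m J = sel^T *m (A *m K) *m sel.
    by rewrite -mulmxA selJ !mulmxA.
  have -> : J *m (sel^T *m A^T *m sel) = sel^T *m (K *m A^T) *m sel.
    by rewrite 2!(mulmxA J) Jsel -!mulmxA.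
  congr (_ + (_ + _)).
  by rewrite -!mulmxA (mulmxA sel sel^T) sel_sel mul1mx.
by rewrite XJ1 mulmx0 mul0mx addr0.
Qed.

End Embedding.

Lemma map_embed (F F' : comNzRingType) (phi : {rmorphism F -> F'}) N k (f : 'I_k -> 'I_N) X :
  map_mx phi (embed f X) = embed f (map_mx phi X).
Proof.
rewrite /embed map_mxD !map_mxM -map_trmx map_mxB !map_mx1.
have -> : map_mx phi (sel F f) = sel F' f by apply/matrixP => i j; rewrite !mxE rmorph_nat.
by [].
Qed.

Lemma horner_mx2 (F : comNzRingType) (a b c d : {poly F}) t :
  map_mx (horner_eval t) (mx2 a b c d) = mx2 a.[t] b.[t] c.[t] d.[t].
Proof.
by apply/matrixP => i j; rewrite !mxE; case: (i == 0); case: (j == 0).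
Qed.

Lemma horner_weyl_curve (F : comNzRingType) (t : F) :
  map_mx (horner_eval t) (mx2 'X (-1) 1 0) = mx2 t (-1) 1 0.
Proof. by rewrite horner_mx2 hornerX hornerN !hornerC. Qed.

Lemma horner_lower_curve (F : comNzRingType) (t : F) :
  map_mx (horner_eval t) (mx2 1 0 'X 1) = mx2 1 0 t 1.
Proof. by rewrite horner_mx2 hornerX !hornerC. Qed.

Section SL2Dominance.
Variable R : realType.
Local Notation C := (Cx R).

(** For $e<0$ the right side would tend to $0$ at infinity. Formally, with $D$ the size of $P$, the
    reversed polynomial $a^DP(a^{-1})$ has coefficient $P(0)$ in degree $D$, whereas it would be
    divisible by a higher power of $a$. *)
Lemma poly_inv_nonneg (P Q : {poly C}) (e : int) : P.[0] != 0 ->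
  (forall a, a != 0 -> Q.[a] = a ^ e * P.[a^-1]) -> 0 <= e.
Proof.
move=> P0; case: e => // n H; exfalso; move: P0; apply/negP; rewrite negbK.
pose D := size P; pose P' := \sum_(i < D) P`_i *: 'X^(D - i).
have E : Q * 'X^(n.+1 + D) = P'.
  apply: (@poly_eq_inf _ _ _ 'X); first by rewrite polyX_eq0.
  move=> a; rewrite hornerX => a0; rewrite hornerM hornerXn H // NegzE -exprnN.
  rewrite exprD mulrACA mulVf ?expf_neq0 // mul1r horner_coef mulr_suml horner_sum.
  apply: eq_bigr => i _; rewrite hornerZ hornerXn -mulrA; congr (_ * _).
  rewrite exprVn mulrC; apply: (mulIf (expf_neq0 i a0)).
  by rewrite divfK ?expf_neq0 // -exprD subnK // ltnW.
have := congr1 (fun p : {poly C} => p`_D) E.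
rewrite coefMXn -[X in (X < _)%N]add0n ltn_add2r /= /P' coef_sum.
have [D0|D0] := posnP D.
  by move=> _; have /eqP := D0; rewrite size_poly_eq0 => /eqP ->; rewrite horner0.
rewrite (bigD1 (Ordinal D0)) //= coefZ coefXn subn0 eqxx mulr1 big1 ?addr0.
  by move=> e; rewrite horner_coef0 -e.
move=> i i0; rewrite coefZ coefXn; case: eqP => [e|]; last by rewrite mulr0.
by case/eqP: i0; apply: val_inj => /=; have := ltn_ord i; lia.
Qed.

Definition polynomial_map k N (phi : 'M[C]_k -> 'M[C]_N) :=
  forall xt : 'M[{poly C}]_k, exists gt : 'M[{poly C}]_N,
    forall t, phi (map_mx (horner_eval t) xt) = map_mx (horner_eval t) gt.

Lemma polynomial_embed k N (f : 'I_k -> 'I_N) : polynomial_map (embed f).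
Proof. by move=> xt; exists (embed f xt) => t; rewrite map_embed. Qed.

Lemma polynomial_mul k N (phi : 'M[C]_k -> 'M[C]_N) (A B : 'M[C]_N) :
  polynomial_map phi -> polynomial_map (fun x => A *m phi x *m B).
Proof.
move=> phip xt; have [gt H] := phip xt.
exists (map_mx polyC A *m gt *m map_mx polyC B) => t.
rewrite !map_mxM H; congr (_ *m _ *m _); apply/matrixP => i j; rewrite !mxE /=;
  by rewrite /horner_eval hornerC.
Qed.

Lemma polynomial_comp k N p (phi : 'M[C]_k -> 'M[C]_N) (psi : 'M[C]_p -> 'M[C]_k) :
  polynomial_map phi -> polynomial_map psi -> polynomial_map (phi \o psi).
Proof.
move=> phip psip xt; have [yt yE] := psip xt; have [gt gE] := phip yt.
by exists gt => t /=; rewrite yE gE.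
Qed.

                                                                          
                                                       
(** The matrix with rows $(a,-1)$ and $(1,0)$ is lower unipotent of parameter $a^{-1}$ times upper
    triangular. Applied to $v$, a coordinate gives $Q(a) = a^eP(a^{-1})$ with $P$, $Q$ polynomials
    and $P(0)$ a nonzero coordinate of $v$. *)
Lemma SL2_dominance N (G : set 'M[C]_N) d (rho : 'M[C]_N -> 'M[C]_d) (v : 'cV[C]_d)
    (phi : 'M[C]_2 -> 'M[C]_N) (e : int) :
  (forall g h, G g -> G h -> rho (g *m h) = rho g *m rho h) -> rho 1%:M = 1%:M ->
  (forall i j, regular_on G (fun g => rho g i j)) -> v != 0 ->
  polynomial_map phi -> (forall x, SL2 x -> G (phi x)) -> (forall x, SL2 x -> \det (phi x) = 1) ->
  (forall x y, SL2 x -> SL2 y -> phi (x *m y) = phi x *m phi y) -> phi 1%:M = 1%:M ->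
  (forall a, a != 0 -> rho (phi (mx2 a (-1) 0 a^-1)) *m v = a ^ e *: v) -> 0 <= e.
Proof.
move=> rM r1 rr v0 phip phiG phid phiM phi1 He.
have [r vr] : exists r, v r 0 != 0.
  apply: contrapT => H; case/eqP: v0; apply/matrixP => i j; rewrite ord1 mxE.
  by apply: contrapT => /eqP vi; case: H; exists i.
have curve (xt : 'M[{poly C}]_2) : (forall t, SL2 (map_mx (horner_eval t) xt)) ->
    exists P : {poly C}, forall t, (rho (phi (map_mx (horner_eval t) xt)) *m v) r 0 = P.[t].
  move=> xS; have [gt gE] := phip xt.
  have [P HP] : exists P : 'I_d -> {poly C}, forall c t, rho (phi (map_mx (horner_eval t) xt)) r c = (P c).[t].
    apply: (@fin_all_exists _ (fun=> {poly C}) (fun c P => forall t, rho (phi (map_mx (horner_eval t) xt)) r c = P.[t])) => c.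
    have [P [k HP]] := regular_curve gt (rr r c).
    exists P => t; have pG := phiG _ (xS t); have pd := phid _ (xS t).
    by rewrite gE in pG pd *; rewrite HP // pd expr1n divr1.
  exists (\sum_c v c 0 *: P c) => t; rewrite mxE horner_sum; apply: eq_bigr => c _.
  by rewrite HP hornerZ mulrC.
have [|Q HQ] := curve (mx2 'X (-1) 1 0).
  by move=> t; rewrite horner_weyl_curve /SL2 /= det_mx2E; ring.
have [|P HP] := curve (mx2 1 0 'X 1).
  by move=> t; rewrite horner_lower_curve /SL2 /= det_mx2E; ring.
apply: (@poly_inv_nonneg P Q).
  by rewrite -HP horner_lower_curve -mx2_1 phi1 r1 mul1mx.
move=> a a0; rewrite -HP -HQ horner_weyl_curve horner_lower_curve.
have S1 : SL2 (mx2 1 0 a^-1 1) by rewrite /SL2 /= det_mx2E; ring.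
have S2 : SL2 (mx2 a (-1) 0 a^-1) by rewrite /SL2 /= det_mx2E; field.
have -> : mx2 a (-1) 1 0 = mx2 1 0 a^-1 1 *m mx2 a (-1) 0 a^-1.
  by rewrite mx2M; congr mx2; field.
rewrite phiM // rM; [|exact: phiG|exact: phiG].
by rewrite -mulmxA He // -scalemxAr mxE.
Qed.

End SL2Dominance.

Section EmbedEntries.
Variable F : fieldType.
Variables (N k : nat) (f : 'I_k -> 'I_N).
Hypothesis finc : forall a c : 'I_k, (a < c)%N -> (f a < f c)%N.

Lemma finc_inj : injective f.
Proof.
move=> a c fac; apply: val_inj; case: (ltngtP a c) => // /finc; rewrite fac ltnn //.
Qed.

Lemma sel_form (J : 'M[F]_N) a c : (sel F f *m J *m (sel F f)^T) a c = J (f a) (f c).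
Proof.
rewrite mxE (bigD1 (f c)) //= big1 ?addr0; last first.
  by move=> x xc; rewrite !mxE eq_sym (negPf xc) mulr0.
rewrite [in X in _ * X]mxE [in X in _ * X]mxE eqxx mulr1 mxE (bigD1 (f a)) //= big1 ?addr0.
  by rewrite mxE eqxx mul1r.
by move=> x xa; rewrite mxE eq_sym (negPf xa) mul0r.
Qed.

Lemma embed_image (X : 'M[F]_k) a c : embed f X (f a) (f c) = X a c.
Proof.
rewrite embed_entry (bigD1 a) //= (bigD1 c) //= !eqxx mul1r mulr1.
rewrite big1; last by move=> x xc; rewrite (inj_eq finc_inj) (negPf xc) mulr0.
rewrite big1; last first.
  by move=> x xa; rewrite big1 // => y _; rewrite (inj_eq finc_inj) (negPf xa) !mul0r.
by rewrite !addr0 (inj_eq finc_inj) addrC subrK.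
Qed.

Lemma embed_outside (X : 'M[F]_k) i j : (forall a, f a != i) \/ (forall a, f a != j) ->
  embed f X i j = (i == j)%:R.
Proof.
move=> H; rewrite embed_entry big1 ?addr0 // => a _; rewrite big1 // => c _.
by case: H => H; rewrite (negPf (H _)) ?mulr0 // !mul0r.
Qed.

Lemma image_or i : (exists a, f a = i) \/ (forall a, f a != i).
Proof.
have [e|ne] := pselect (exists a, f a = i); first by left.
by right=> a; apply/eqP => e; apply: ne; exists a.
Qed.

Lemma embed_upper (X : 'M[F]_k) : is_trig_mx X^T -> is_trig_mx (embed f X)^T.
Proof.
move=> /is_trig_mxP Xt; apply/is_trig_mxP => i j ij; rewrite mxE.
have ji : (j == i) = false by apply/eqP => e; move: ij; rewrite e ltnn.
case: (image_or i) => [[a ai]|ni]; last by rewrite embed_outside ?ji //; right.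
case: (image_or j) => [[c cj]|nj]; last by rewrite embed_outside ?ji //; left.
rewrite -ai -cj embed_image; have := Xt a c; rewrite mxE; apply.
case: (ltngtP a c) => // [/finc|/val_inj ac]; first by rewrite ai cj ltnNge ltnW.
by move: ij; rewrite -ai -cj ac ltnn.
Qed.

End EmbedEntries.

Lemma weight_embed (R : realType) N k (f : 'I_k -> 'I_N) (l : 'rV[int]_N) X :
  (forall a c : 'I_k, (a < c)%N -> (f a < f c)%N) ->
  weight l (embed f X) = \prod_a X a a ^ l 0 (f a) :> Cx R.
Proof.
move=> finc; have finj := finc_inj finc.
rewrite [RHS](partition_big f predT) //=; apply: eq_bigr => i _.
case: (image_or f i) => [[a ai]|ni].
  by rewrite (big_pred1 a) => [|c]; rewrite -?ai ?(inj_eq finj) // embed_image.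
rewrite big_pred0 => [|c]; last exact: negPf.
by rewrite embed_outside ?eqxx ?exp1rz //; left.
Qed.

                                                                              
                               
(** The symmetric square in the basis $e_1^2, 2e_1e_2, 2e_2^2$, for which the invariant form is
    antidiagonal with alternating signs. The parameter [u] stands for $1/2$, so that the formula can
    be used over polynomials. *)
Definition sym2 (F : comNzRingType) (u : F) (x : 'M[F]_2) : 'M[F]_3 :=
  \matrix_(i, j) nth 0 (nth [::]
    [:: [:: x 0 0 ^+ 2; x 0 0 * x 0 1 *+ 2; x 0 1 ^+ 2 *+ 2];
        [:: x 0 0 * x 1 0; x 0 0 * x 1 1 + x 0 1 * x 1 0; x 0 1 * x 1 1 *+ 2];
        [:: x 1 0 ^+ 2 * u; x 1 0 * x 1 1; x 1 1 ^+ 2]] i) j.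

Lemma map_sym2 (F F' : comNzRingType) (phi : {rmorphism F -> F'}) u x :
  map_mx phi (sym2 u x) = sym2 (phi u) (map_mx phi x).
Proof.
apply/matrixP => -[[|[|[|//]]] Hi] -[[|[|[|//]]] Hj]; rewrite !mxE /=;
  by rewrite ?rmorphMn ?rmorphD ?rmorphM ?rmorphXn.
Qed.

Lemma sym2M (F : fieldType) (x y : 'M[F]_2) : 2%:R != 0 :> F ->
  sym2 2^-1 (x *m y) = sym2 2^-1 x *m sym2 2^-1 y.
Proof.
move=> nz2; rewrite [x]mx2_eta [y]mx2_eta mx2M.
move: (x 0 0) (x 0 1) (x 1 0) (x 1 1) (y 0 0) (y 0 1) (y 1 0) (y 1 1) => a b c d a' b' c' d'.
apply/matrixP => i j; rewrite [RHS]mxE !big_ord_recl big_ord0 !mxE addr0.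
case: i j => [[|[|[|//]]] Hi] [[|[|[|//]]] Hj] /=; by field.
Qed.

Lemma det_sym2 (F : fieldType) (x : 'M[F]_2) : 2%:R != 0 :> F ->
  \det (sym2 2^-1 x) = \det x ^+ 3.
Proof.
move=> nz2; rewrite (expand_det_row _ ord0) !big_ord_recl big_ord0 /cofactor !det_mx2 !mxE /=.
have [-> ->] : (bump 0 0 = 1 /\ bump 0 1 = 2)%N by [].
rewrite !add0n expr0 expr1 sqrrN expr1n.
move: (x 0 0) (x 0 1) (x 1 0) (x 1 1) => a b c d; by field.
Qed.

Lemma sym2_isometry (F : fieldType) (s : F) x : 2%:R != 0 :> F ->
  let K := \matrix_(i, j) (if j == rev_ord i then (-1) ^+ i * s else 0) in
  sym2 2^-1 x *m K *m (sym2 2^-1 x)^T = \det x ^+ 2 *: K.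
Proof.
move=> nz2; rewrite det_mx2; apply/matrixP => i j.
rewrite mxE !big_ord_recl big_ord0 !mxE !big_ord_recl !big_ord0 !mxE.
move: (x 0 0) (x 0 1) (x 1 0) (x 1 1) => a b c d.
rewrite -!val_eqE; case: i j => [[|[|[|//]]] Hi] [[|[|[|//]]] Hj] /=.
all: have [b1 b2] : (bump 0 0 = 1 /\ bump 0 1 = 2)%N by [].
all: rewrite ?b1 ?b2 ?expr0 ?expr1 ?sqrrN ?expr1n ?mulr0 ?mul0r ?addr0 ?add0r; by field.
Qed.

Lemma sym2_1 (F : comNzRingType) (u : F) : sym2 u 1%:M = 1%:M.
Proof.
by apply/matrixP => -[[|[|[|//]]] Hi] -[[|[|[|//]]] Hj]; rewrite !mxE /=; ring.
Qed.

Lemma block_diag_antidiag (F : comNzRingType) k (x A B : 'M[F]_k) :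
  block_mx x 0 0 x *m block_mx 0 A B 0 *m (block_mx x 0 0 x)^T =
  block_mx 0 (x *m A *m x^T) (x *m B *m x^T) 0.
Proof.
rewrite tr_block_mx !trmx0 !mulmx_block.
by rewrite ?(mulmx0, mul0mx, addr0, add0r).
Qed.

Lemma prod_block_diag (F : fieldType) (x : 'M[F]_2) (n : 'I_(2 + 2) -> int) :
  \prod_c block_mx x 0 0 x c c ^ n c =
  x 0 0 ^ n (lshift 2 0) * x 1 1 ^ n (lshift 2 1) * (x 0 0 ^ n (rshift 2 0) * x 1 1 ^ n (rshift 2 1)).
Proof.
have o1 : lift ord0 ord0 = 1 :> 'I_2 by exact: val_inj.
rewrite big_split_ord /= !big_ord_recl !big_ord0 !mulr1 !block_mxEul !block_mxEdr.
by rewrite o1.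
Qed.

Lemma conj_mulmx (F : fieldType) N (h X Y : 'M[F]_N) : h \in unitmx ->
  h *m (X *m Y) *m invmx h = (h *m X *m invmx h) *m (h *m Y *m invmx h).
Proof. by move=> hu; rewrite !mulmxA mulmxKV. Qed.

(** * Highest weights of $\mathrm{GL}_N$ and of the classical groups are dominant *)

Section Dominance.
Variable R : realType.
Local Notation C := (Cx R).

Lemma dominant_adjacent N (l : 'rV[int]_N) :
  (forall i j : 'I_N, j = i.+1 :> nat -> l 0 j <= l 0 i) -> dominant l.
Proof.
move=> H i j ij; have [n] := ubnP (j - i)%N; elim: n j ij => // n IH j ij jn.
have [e|ne] := eqVneq (i : nat) j; first by have -> : i = j by apply: val_inj.
have j1 : (j.-1 < N)%N by apply: leq_ltn_trans (ltn_ord j); exact: leq_pred.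
apply: (le_trans (H (Ordinal j1) j _)) => /=; first by lia.
by apply: IH => /=; lia.
Qed.

Definition pair_idx N (i j : 'I_N) (a : 'I_2) : 'I_N := if a == 0 then i else j.

Lemma pair_idx_inc N (i j : 'I_N) : (i < j)%N ->
  forall a c : 'I_2, (a < c)%N -> (pair_idx i j a < pair_idx i j c)%N.
Proof. by move=> ij a c; case: (ord2P a) => ->; case: (ord2P c) => ->. Qed.

Lemma upper_mx2 (F : fieldType) (a b d : F) : is_trig_mx (mx2 a b 0 d)^T.
Proof.
apply/is_trig_mxP => i j; rewrite !mxE.
by case: (ord2P i) => ->; case: (ord2P j) => ->.
Qed.

Lemma GL_hw_dominant N d (rho : 'M[C]_N -> 'M[C]_d) (v : 'cV[C]_d) (l : 'rV[int]_N) :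
  alg_rep (GL R N) rho -> v != 0 ->
  (forall b, borel b -> rho b *m v = weight l b *: v) -> dominant l.
Proof.
move=> ra v0 vB; have [_ rM rr] := ra; apply: dominant_adjacent => i j ji.
have ij : (i < j)%N by rewrite ji.
have finc := pair_idx_inc ij.
have dphi x : SL2 x -> \det (embed (pair_idx i j) x) = 1 :> C by move=> xS; rewrite det_embed //; exact: finc_inj.
have Gphi x : SL2 x -> GL R N (embed (pair_idx i j) x).
  by move=> xS; rewrite /GL /= unitmxE dphi // unitr1.
rewrite -subr_ge0.
apply: (@SL2_dominance R N (GL R N) d rho v (embed (pair_idx i j))) => //.
- exact: alg_rep1 (GLN1 R N) ra.
- exact: polynomial_embed.
- by move=> x y _ _; rewrite embedM //; exact: finc_inj.
- exact: embed1.
move=> a a0; rewrite vB.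
  rewrite weight_embed // !big_ord_recl big_ord0 mulr1 !mxE /= exprz_inv -expfzDr //.
split; last by apply: embed_upper => //; exact: upper_mx2.
by apply: Gphi; rewrite /SL2 /= det_mx2E; field.
Qed.

Section Classical.
Variables (N : nat) (G : set 'M[C]_N) (h : 'M[C]_N) (d : nat).
Variables (rho : 'M[C]_N -> 'M[C]_d) (v : 'cV[C]_d) (l : 'rV[int]_N).
Hypothesis hu : h \in unitmx.
Hypothesis Gh : forall g, classical g -> G (h *m g *m invmx h).
Hypothesis rM : forall g g', G g -> G g' -> rho (g *m g') = rho g *m rho g'.
Hypothesis r1 : rho 1%:M = 1%:M.
Hypothesis rr : forall i j, regular_on G (fun g => rho g i j).
Hypothesis v0 : v != 0.
Hypothesis vB : forall b, classical b -> is_trig_mx b^T ->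
  rho (h *m b *m invmx h) *m v = weight l b *: v.

(** Common frame for the simple roots: $\mathrm{SL}_2$ acts through [psi] on a set of coordinates
    closed under reversal, preserving the form there. *)
Lemma classical_root k (f : 'I_k -> 'I_N) (psi : 'M[C]_2 -> 'M[C]_k) (e : int) :
  (forall a c : 'I_k, (a < c)%N -> (f a < f c)%N) -> (forall a, exists c, f c = rev_ord (f a)) ->
  polynomial_map psi -> (forall x y, psi (x *m y) = psi x *m psi y) -> psi 1%:M = 1%:M ->
  (forall x, SL2 x -> \det (psi x) = 1) ->
  (forall x, SL2 x -> let K := sel C f *m antidiag R N *m (sel C f)^T in psi x *m K *m (psi x)^T = K) ->
  (forall a, is_trig_mx (psi (mx2 a (-1) 0 a^-1))^T) ->
  (forall a, a != 0 -> \prod_c psi (mx2 a (-1) 0 a^-1) c c ^ l 0 (f c) = a ^ e) -> 0 <= e.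
Proof.
move=> finc frev psip psiM psi1 psid psiK psiU psiw; have finj := finc_inj finc.
have cl x : SL2 x -> classical (embed f (psi x)).
  move=> xS; split; last by rewrite det_embed // psid.
  apply: embed_isometry; [exact: finj | | exact: psiK].
  move=> i a ni; rewrite !mxE; split; case: eqP => // e'.
    by have [c ca] := frev a; have := ni c; rewrite ca e' eqxx.
  by have [c ca] := frev a; have := ni c; rewrite ca e' rev_ordK eqxx.
apply: (@SL2_dominance R N G d rho v (fun x => h *m embed f (psi x) *m invmx h)) => //.
- apply: polynomial_mul; exact: (polynomial_comp (@polynomial_embed R k N f) psip).
- by move=> x xS; apply/Gh/cl.
- have dh : \det h != 0 by rewrite -unitfE -unitmxE.
  by move=> x xS; rewrite !det_mulmx det_inv mulrAC divff // mul1r det_embed // psid.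
- by move=> x y xS yS; rewrite psiM (embedM finj) (conj_mulmx _ _ hu).
- by rewrite psi1 embed1 mulmx1 mulmxV.
move=> a a0; have bS : SL2 (mx2 a (-1) 0 a^-1) by rewrite /SL2 /= det_mx2E; field.
rewrite vB; [| exact: cl | by apply: embed_upper => //; exact: psiU].
by rewrite weight_embed // psiw.
Qed.

Definition quad_idx (i j : 'I_N) (a : 'I_4) : 'I_N := nth i [:: i; j; rev_ord j; rev_ord i] a.

(** The root $f_i-f_j$. The pair $(\mathrm{rev}\,j,\mathrm{rev}\,i)$ carries the dual action, which
    for $\mathrm{SL}_2$ can be taken to be the same matrix. *)
Lemma classical_short_diff (i j : 'I_N) : j = i.+1 :> nat -> (j < N./2)%N ->
  l 0 (rev_ord i) = 0 -> l 0 (rev_ord j) = 0 -> l 0 j <= l 0 i.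
Proof.
move=> ji jn li lj; rewrite -subr_ge0.
pose f : 'I_(2 + 2) -> 'I_N := quad_idx i j.
pose psi (x : 'M[C]_2) : 'M[C]_(2 + 2) := block_mx x 0 0 x.
have finc (a c : 'I_(2 + 2)) : (a < c)%N -> (f a < f c)%N.
  case: a c => [[|[|[|[|//]]]] Ha] [[|[|[|[|//]]]] Hc] //= _; rewrite /f /quad_idx /=; lia.
have s2 (x : nat) : (-1) ^+ x.+1 = - (-1) ^+ x :> C by rewrite exprS mulN1r.
pose s : C := (-1) ^+ i; pose s' : C := (-1) ^+ rev_ord j.
set K := sel C f *m antidiag R N *m (sel C f)^T.
have KE a c : K a c = antidiag R N (f a) (f c) by rewrite /K sel_form.
have Kblock : K = block_mx 0 (mx2 0 s (- s) 0) (mx2 0 s' (- s') 0) 0.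
  have sj : (-1) ^+ (j : nat) = - s :> C by rewrite ji s2.
  have s'i : (-1) ^+ (N - i.+1)%N = - s' :> C.
    by rewrite -s2 /=; congr (_ ^+ _); have := ltn_ord j; lia.
  have s'j : (-1) ^+ (N - j.+1)%N = s' :> C by [].
  have ltj := ltn_ord j.
  clearbody K; rewrite -[LHS]submxK; congr block_mx; apply/matrixP => a c;
    rewrite 2!mxE KE !mxE /f /quad_idx -val_eqE /=; case: (ord2P a) => ->; case: (ord2P c) => -> /=;
    case: eqP => e; rewrite ?sj ?s'i ?s'j //; exfalso; move: e; lia.
have scE (x : 'M[C]_2) y : SL2 x -> x *m mx2 0 y (- y) 0 *m x^T = mx2 0 y (- y) 0.
  rewrite [x]mx2_eta /SL2 /= det_mx2E tr_mx2 !mx2M => xS.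
  by congr mx2; rewrite -1?[y in RHS]mul1r -?xS; ring.
apply: (@classical_root _ f psi (l 0 i - l 0 j)) => //.
- move=> a; exists (rev_ord a); apply: val_inj; rewrite /f /quad_idx.
  have := ltn_ord i; have := ltn_ord j.
  by case: a => [[|[|[|[|//]]]] Ha] //=; lia.
- move=> xt; exists (block_mx xt 0 0 xt) => t.
  by rewrite /psi map_block_mx !map_mx0.
- by move=> x y; rewrite /psi mulmx_block !mulmx0 !mul0mx !addr0 !add0r.
- by rewrite /psi -scalar_mx_block.
- by move=> x; rewrite /SL2 /= /psi det_ublock => ->; rewrite mulr1.
- by move=> x xS; rewrite -/K /= Kblock /psi block_diag_antidiag !scE.
- move=> a; rewrite /psi tr_block_mx !trmx0 is_trig_block_mx // eqxx.
  by rewrite upper_mx2.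
move=> a a0; rewrite (prod_block_diag _ (fun c => l 0 (f c))) !mxE /= /f /quad_idx /= li lj.
by rewrite !expr0z !mulr1 exprz_inv -expfzDr.
Qed.

                                               
(** The long simple root of the symplectic group: $\mathrm{SL}_2$ acts on the two middle
    coordinates. *)
Lemma classical_even_nonneg (i : 'I_N) : ~~ odd N -> i.+1 = N./2 ->
  l 0 (rev_ord i) = 0 -> 0 <= l 0 i.
Proof.
move=> eN iN li; have ltN := ltn_ord i.
have ij : (i < rev_ord i)%N by rewrite /=; lia.
pose f := pair_idx i (rev_ord i); pose s : C := (-1) ^+ i.
set K := sel C f *m antidiag R N *m (sel C f)^T.
have finc := pair_idx_inc ij.
have KE a c : K a c = antidiag R N (f a) (f c) by rewrite /K sel_form.
have K2 : K = mx2 0 s (- s) 0.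
  have s'i : (-1) ^+ (N - i.+1)%N = - s :> C.
    have -> : (N - i.+1)%N = i.+1 by lia.
    by rewrite exprS mulN1r.
  clearbody K; apply/matrixP => a c; rewrite KE !mxE /f /pair_idx -val_eqE /=.
  by case: (ord2P a) => ->; case: (ord2P c) => -> /=; case: eqP => e; rewrite ?s'i //; exfalso; move: e; lia.
apply: (@classical_root _ f id (l 0 i)) => //.
- move=> a; exists (rev_ord a); rewrite /f /pair_idx.
  by case: (ord2P a) => -> /=; rewrite ?rev_ordK.
- by move=> xt; exists xt.
- move=> x xS; rewrite -/K /= K2; move: xS; rewrite [x]mx2_eta /SL2 /= det_mx2E tr_mx2 !mx2M => xS.
  by congr mx2; rewrite -1?[s in RHS]mul1r -?xS; ring.
- by move=> a; exact: upper_mx2.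
move=> a a0; rewrite !big_ord_recl !big_ord0 !mulr1 !mxE /= /f /pair_idx /= li.
by rewrite expr0z mulr1.
Qed.

Definition triple_idx (i j : 'I_N) (a : 'I_3) : 'I_N := nth i [:: i; j; rev_ord i] a.

                                         
(** The short simple root of the odd orthogonal group: $\mathrm{SL}_2$ acts by its symmetric square
    on the three middle coordinates, so the torus acts by $a^2$ and the exponent is $2l_i$. *)
Lemma classical_odd_nonneg (i : 'I_N) : odd N -> i.+1 = N./2 ->
  (forall j : 'I_N, (N./2 <= j)%N -> l 0 j = 0) -> 0 <= l 0 i.
Proof.
move=> oN iN lz; have ltN := ltn_ord i.
have j1 : (i.+1 < N)%N by lia.
pose j := Ordinal j1; pose f : 'I_3 -> 'I_N := triple_idx i j; pose s : C := (-1) ^+ i.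
set K := sel C f *m antidiag R N *m (sel C f)^T.
have KE a c : K a c = antidiag R N (f a) (f c) by rewrite /K sel_form.
have finc (a c : 'I_3) : (a < c)%N -> (f a < f c)%N.
  case: a c => [[|[|[|//]]] Ha] [[|[|[|//]]] Hc] //= _; rewrite /f /triple_idx /=; lia.
have K3 : K = \matrix_(a, c) (if c == rev_ord a then (-1) ^+ a * s else 0).
  clearbody K; apply/matrixP => a c; rewrite KE !mxE /f /triple_idx -!val_eqE /=.
  case: a c => [[|[|[|//]]] Ha] [[|[|[|//]]] Hc] /=; rewrite ?expr0 ?mul1r.
  all: try (case: eqP => e //; exfalso; move: e; lia).
  all: try (case: eqP => e //; try (exfalso; move: e; lia)).
  + by rewrite /s exprS expr1.
  + rewrite /s (_ : (N - i.+1)%N = (2 + i)%N); last by lia.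
    by rewrite exprD.
have nz2 : 2%:R != 0 :> C by rewrite pnatr_eq0.
rewrite -(pmulr_lge0 _ (_ : 0 < 2%:Z)) //.
apply: (@classical_root _ f (sym2 2^-1) (l 0 i * 2)) => //.
- move=> a; exists (rev_ord a); apply: val_inj; rewrite /f /triple_idx.
  by case: a => [[|[|[|//]]] Ha] //=; lia.
- by move=> xt; exists (sym2 (polyC (2^-1 : C)) xt) => t; rewrite map_sym2; congr sym2; exact/esym/hornerC.
- by move=> x y; exact: sym2M.
- exact: sym2_1.
- by move=> x; rewrite /SL2 /= => xS; rewrite det_sym2 // xS expr1n.
- by move=> x; rewrite /SL2 /= => xS; rewrite -/K K3 sym2_isometry // xS expr1n scale1r.
- move=> a; apply/is_trig_mxP => -[[|[|[|//]]] Ha] -[[|[|[|//]]] Hc] //= _;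
    by rewrite !mxE /= ?mulr0 ?mul0r ?mul0rn ?expr0n ?mul0r.
move=> a a0; rewrite !big_ord_recl big_ord0 !mxE /= /f /triple_idx /=.
rewrite (lz j) ?(lz (rev_ord i)) /=; [|lia|lia]; rewrite !expr0z.
by rewrite !mulr1 mulrC -exprz_exp.
Qed.

Lemma classical_hw_dominant : (forall j : 'I_N, (N./2 <= j)%N -> l 0 j = 0) -> dominant l.
Proof.
move=> lz; apply: dominant_adjacent => i j ji; have ltN := ltn_ord j.
case: (ltnP j N./2) => jN; first by apply: classical_short_diff => //; apply: lz => /=; lia.
rewrite (lz j) //; case: (ltnP i N./2) => iN; last by rewrite lz.
have e : i.+1 = N./2 by lia.
case: (boolP (odd N)) => oN; first exact: classical_odd_nonneg.
by apply: classical_even_nonneg => //; apply: lz => /=; lia.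
Qed.

End Classical.

End Dominance.

                                          

(** * The big cell, and matrix coefficients as invariants of representations *)

Lemma span_family (F : fieldType) d (P : 'rV[F]_d -> Prop) :
  exists n (A : 'M[F]_(n, d)), (forall i, P (row i A)) /\ forall r, P r -> (r <= A)%MS.
Proof.
pose Q k := `[< exists n (A : 'M[F]_(n, d)), (forall i, P (row i A)) /\ \rank A = k >].
have Q0 : exists k, Q k.
  by exists 0; apply/asboolP; exists 0, 0; split; [case | rewrite mxrank0].
have Qd k : Q k -> (k <= d)%N by move=> /asboolP[n [A [_ <-]]]; exact: rank_leq_col.
case: (ex_maxnP Q0 Qd) => k /asboolP[n [A [AP Ak]]] kmax.
exists n, A; split=> // r Pr; have AC : (A <= col_mx A r)%MS by rewrite -addsmxE addsmxSl.
have [rle req] := mxrank_leqif_sup AC.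
have : (col_mx A r <= A)%MS.
  rewrite -req eqn_leq rle /= Ak; apply: kmax; apply/asboolP; exists (n + 1)%N, (col_mx A r); split=> // i.
  by case: (split_ordP i) => j ->; rewrite ?rowKu ?rowKd ?row_id.
by rewrite col_mx_sub => /andP[].
Qed.

Lemma trig_inv (F : fieldType) n (b : 'M[F]_n) : b \in unitmx -> is_trig_mx b ->
  is_trig_mx (invmx b) /\ forall i, invmx b i i = (b i i)^-1.
Proof.
move=> bu bt; have b0 i : b i i != 0.
  have : \prod_i b i i != 0 by rewrite -det_trig // -unitfE -unitmxE.
  by move=> /prodf_neq0 /(_ i isT).
have bE i j : \sum_k b i k * invmx b k j = (i == j)%:R by have /matrixP/(_ i j) := mulmxV bu; rewrite !mxE.
have /is_trig_mxP bz := bt.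
have ct (i j : 'I_n) : (i < j)%N -> invmx b i j = 0.
  have [k] := ubnP i; elim: k i j => // k IH i j ik ij.
  have ne : (i == j) = false by apply/eqP => e; move: ij; rewrite e ltnn.
  have := bE i j; rewrite ne (bigD1 i) //= big1 ?addr0.
    by move/eqP; rewrite mulf_eq0 (negPf (b0 i)) => /eqP.
  move=> x xi; case: (ltngtP x i) => [xlt|/bz ->|/val_inj e]; last by rewrite e eqxx in xi.
    by rewrite (IH x j) ?mulr0 //; [exact: leq_trans xlt _ | exact: ltn_trans xlt ij].
  by rewrite mul0r.
split; first exact/is_trig_mxP.
move=> i; apply: (mulfI (b0 i)); rewrite divff //; have := bE i i; rewrite eqxx (bigD1 i) //= big1 ?addr0 //.
move=> x xi; case: (ltngtP x i) => [/ct ->|/bz ->|/val_inj e]; rewrite ?mulr0 ?mul0r //.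
by rewrite e eqxx in xi.
Qed.

Lemma LU_step (F : fieldType) n p (A : 'M[F]_n) (u : 'M[F]_(n, p)) (v : 'M[F]_(p, n)) (x : 'M[F]_p)
    (L U : 'M[F]_n) :
  L \in unitmx -> U \in unitmx -> A = L *m U ->
  block_mx A u v x = block_mx L 0 (v *m invmx U) 1%:M *m
    block_mx U (invmx L *m u) 0 (x - v *m invmx U *m (invmx L *m u)).
Proof.
move=> Lu Uu ->; rewrite mulmx_block !(mul0mx, mulmx0, mul1mx, addr0, add0r) mulKVmx //.
by rewrite mulmxKV // addrC subrK.
Qed.

Lemma horner_shift (F : comNzRingType) n (g : 'M[F]_n) t :
  map_mx (horner_eval t) (map_mx polyC g + 'X%:M) = g + t%:M.
Proof.
rewrite map_mxD map_scalar_mx; congr (_ + _); last by congr (_%:M); exact: hornerX.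
by apply/matrixP => i j; rewrite !mxE; exact: hornerC.
Qed.

(** The determinant of each leading block of $g+t$ is a characteristic polynomial in $t$, hence
    nonzero. Where none of these polynomials vanishes, the factorization grows by one row and column
    at a time through the Schur complement. *)
Lemma generic_LU (F : fieldType) n (g : 'M[F]_n) : exists2 q : {poly F}, q != 0 &
  forall t, q.[t] != 0 -> exists L U : 'M[F]_n,
    [/\ is_trig_mx L, is_trig_mx U^T & g + t%:M = L *m U].
Proof.
elim: n g => [|n IH] g.
  exists 1; first exact: oner_neq0.
  move=> t _; exists 0, 0; rewrite trmx0 mx0_is_trig; split=> //.
  by apply/matrixP => [[]].
move: g; rewrite -addn1 => g; have [q q0 Hq] := IH (ulsubmx g).
pose D := \det (map_mx polyC (ulsubmx g) + 'X%:M).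
have DE t : D.[t] = \det (ulsubmx g + t%:M).
  by rewrite -horner_evalE -det_map_mx horner_shift.
have D0 : D != 0.
  have : char_poly (- ulsubmx g) != 0 by rewrite monic_neq0 // char_poly_monic.
  by rewrite /char_poly /char_poly_mx map_mxN opprK addrC.
exists (q * D); first by rewrite mulf_neq0.
move=> t; rewrite hornerM mulf_eq0 negb_or => /andP[qt]; rewrite DE => dt.
have [L [U [Lt Ut LU]]] := Hq t qt.
have /andP[Lu Uu] : (L \in unitmx) && (U \in unitmx) by rewrite -unitmx_mul -LU unitmxE unitfE.
have -> : g + t%:M = block_mx (ulsubmx g + t%:M) (ursubmx g) (dlsubmx g) (drsubmx g + t%:M).
  by rewrite -{1}[g]submxK scalar_mx_block add_block_mx !addr0.
rewrite (LU_step _ _ _ Lu Uu LU); do 2 eexists; split; last reflexivity.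
  by rewrite is_trig_block_mx // eqxx Lt scalar_mx_is_trig.
by rewrite tr_block_mx is_trig_block_mx // trmx0 eqxx Ut mx11_is_trig.
Qed.

Lemma intertwiner_of_factors (F : fieldType) d (A B A' B' X Y : 'M[F]_d) :
  A \in unitmx -> B' \in unitmx ->
  B *m A = B' *m A' -> B *m X *m A = B' *m Y *m A' ->
  A' *m invmx A *m X = Y *m (A' *m invmx A).
Proof.
move=> Au B'u e1 e2; apply: (can_inj (mulKmx B'u)); apply: (can_inj (mulmxK Au)).
by rewrite !mulmxA mulmxKV // -e2 -e1 mulmxK.
Qed.

Section MatrixCoefficients.
Variables (R : realType) (N : nat).
Local Notation C := (Cx R).
Variables (G : set 'M[C]_N).
Hypothesis Gadj : forall g, G g -> G (adjmx g).
Hypothesis G1 : G 1%:M.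
Hypothesis GM : forall g h, G g -> G h -> G (g *m h).

Lemma orbit_basis d (rho : 'M[C]_N -> 'M[C]_d) (w : 'cV[C]_d) :
  alg_rep G rho -> irreducible G rho -> w != 0 ->
  exists2 g : 'I_d -> 'M[C]_N, (forall i, G (g i)) &
    \matrix_(i, j) (rho (g i) *m w) j 0 \in unitmx.
Proof.
move=> ra [_ irr] w0; have [_ rM _] := ra; have r1 := alg_rep1 G1 ra.
have [n [A [AP Asup]]] := span_family (fun r => exists2 g, G g & r = (rho g *m w)^T).
have Af : row_full A.
  have [|U0|Uf] := irr <<A>>%MS; last by rewrite -sub1mx -(genmxE A) sub1mx.
    move=> g Gg; rewrite (eqmx_stable _ (genmxE A)); apply/row_subP => i.
    have [h Gh e] := AP i; rewrite row_mul e -trmx_mul mulmxA -rM //.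
    by apply: Asup; exists (g *m h) => //; exact: GM.
  case/negP: w0; have : (w^T <= A)%MS by apply: Asup; exists 1%:M; rewrite ?r1 ?mul1mx.
  by rewrite -(genmxE A) U0 submx0 => /eqP e; rewrite -[w]trmxK e trmx0.
have [g Hg] : exists g : 'I_d -> 'M[C]_N, forall i, G (g i) /\ row (fullrankfun Af i) A = (rho (g i) *m w)^T.
  apply: (@fin_all_exists _ (fun=> 'M[C]_N)
    (fun i h => G h /\ row (fullrankfun Af i) A = (rho h *m w)^T)) => i.
  by have [h Gh e] := AP (fullrankfun Af i); exists h.
exists g; first by move=> i; case: (Hg i).
suff -> : \matrix_(i, j) (rho (g i) *m w) j 0 = rowsub (fullrankfun Af) A by exact: fullrowsub_unit.
apply/matrixP => i j; have [_ /rowP/(_ j)] := Hg i.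
by rewrite mxE [RHS]mxE [LHS]mxE => <-; rewrite mxE.
Qed.

(** Let the translates $g_jw$ form a basis. Equality of the coefficients at $g_i^{*}hg_j$ reads
    $B\rho(h)A = B'\rho'(h)A'$. At $h = 1$ invertibility passes from $A$, $B$ to $A'$, $B'$, and
    then $A'A^{-1}$ intertwines. *)
Lemma matrix_coefficient_iso d (rho rho' : 'M[C]_N -> 'M[C]_d) (w w' : 'cV[C]_d) (u' : 'rV[C]_d) :
  adj_rep G rho -> irreducible G rho -> w != 0 ->
  (forall g h, G g -> G h -> rho' (g *m h) = rho' g *m rho' h) -> rho' 1%:M = 1%:M ->
  (forall g, G g -> adjmx w *m rho g *m w = u' *m rho' g *m w') ->
  rep_iso G rho rho'.
Proof.
move=> [ra rs] irr w0 rM' r1' ff; have [_ rM _] := ra; have r1 := alg_rep1 G1 ra.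
have [g Gg] := orbit_basis ra irr w0; set A0 := \matrix_(i, j) _ => A0u.
pose A := A0^T; pose B := adjmx A.
pose A' : 'M[C]_d := \matrix_(i, j) (rho' (g j) *m w') i 0.
pose B' : 'M[C]_d := \matrix_(i, j) (u' *m rho' (adjmx (g i))) 0 j.
have Au : A \in unitmx by rewrite unitmx_tr.
have Bu : B \in unitmx by rewrite /B /adjmx unitmx_tr map_unitmx.
have colA j : col j A = rho (g j) *m w by apply/matrixP => i k; rewrite !mxE ord1.
have colA' j : col j A' = rho' (g j) *m w' by apply/matrixP => i k; rewrite !mxE ord1.
have rowB i : row i B = adjmx w *m rho (adjmx (g i)).
  by rewrite rs // -adjmxM -colA; apply/matrixP => a k; rewrite !mxE.
have rowB' i : row i B' = u' *m rho' (adjmx (g i)) by apply/matrixP => a k; rewrite !mxE ord1.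
have E h : G h -> B *m rho h *m A = B' *m rho' h *m A'.
  have ent (X Y Z : 'M[C]_d) i j : (X *m Y *m Z) i j = (row i X *m Y *m col j Z) 0 0.
    by rewrite -row_mul colE mulmxA -row_mul -colE !mxE.
  move=> Gh; apply/matrixP => i j; rewrite !ent colA colA' rowB rowB'.
  have Ga := Gadj (Gg i).
  have Gah := GM Ga Gh; have Gahg := GM Gah (Gg j).
  have -> : adjmx w *m rho (adjmx (g i)) *m rho h *m (rho (g j) *m w) =
      adjmx w *m rho (adjmx (g i) *m h *m g j) *m w by rewrite (rM _ _ Gah) // (rM _ _ Ga) // !mulmxA.
  by rewrite ff // (rM' _ _ Gah) // (rM' _ _ Ga) // !mulmxA.
have E1 := E _ G1; rewrite r1 r1' !mulmx1 in E1.
have /andP[B'u A'u] : (B' \in unitmx) && (A' \in unitmx).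
  by rewrite -unitmx_mul -E1 unitmx_mul Bu.
clearbody A B A' B'; exists (A' *m invmx A); first by rewrite unitmx_mul A'u unitmx_inv.
by move=> h Gh; apply: intertwiner_of_factors E1 (E h Gh).
Qed.

End MatrixCoefficients.

(** * The pinned automorphism and self-duality of representations of $\mathrm{GL}_N$ *)

Section PinnedAut.
Variables (R : realType) (N : nat).
Local Notation C := (Cx R).
Local Notation J := (antidiag R N).
Local Notation GLN := (GL R N).

Lemma GLN_M (g h : 'M[C]_N) : GLN g -> GLN h -> GLN (g *m h).
Proof. by rewrite /GL /= unitmx_mul => -> ->. Qed.

Lemma GLN_adj (g : 'M[C]_N) : GLN g -> GLN (adjmx g).
Proof. by rewrite /GL /= unitmx_tr map_unitmx. Qed.

Lemma antidiag_conj (A : 'M[C]_N) i j :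
  (J *m A *m invmx J) i j = (-1) ^+ i * (-1) ^+ j * A (rev_ord i) (rev_ord j).
Proof.
have -> : invmx J = (-1) ^+ N.-1 *: J.
  apply: (can_inj (mulKmx (antidiag_unit R N))); rewrite mulmxV ?antidiag_unit //.
  by rewrite -scalemxAr antidiag_sq scale_scalar_mx -exprMn mulrNN mulr1 expr1n.
rewrite -scalemxAr mxE mul_mx_antidiag mul_antidiag_mx sign_rev_ord.
rewrite (mulrC _ (_ * (-1) ^+ j)) !mulrA; congr (_ * _).
by rewrite -(mulrA _ ((-1) ^+ j)) -exprMn mulrNN mulr1 expr1n mul1r mulrC.
Qed.

Lemma pinned_aut_GL (g : 'M[C]_N) : GLN g -> GLN (pinned_aut g).
Proof.
rewrite /GL /= /pinned_aut => gu.
by rewrite !unitmx_mul unitmx_inv unitmx_tr gu unitmx_inv antidiag_unit.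
Qed.

Lemma pinned_autM (g h : 'M[C]_N) : GLN g -> GLN h ->
  pinned_aut (g *m h) = pinned_aut g *m pinned_aut h.
Proof.
move=> gu hu; rewrite /pinned_aut trmx_mul invmxM ?unitmx_tr // !mulmxA.
by rewrite mulmxKV ?antidiag_unit.
Qed.

(** The pinned automorphism inverts and reverses the diagonal, and an antisymmetric weight does not
    see this. *)
Lemma pinned_aut_lower (b : 'M[C]_N) (l : 'rV[int]_N) : GLN b -> is_trig_mx b -> antisym l ->
  is_trig_mx (pinned_aut b) /\ weight l (pinned_aut b) = weight l b.
Proof.
move=> bu bt la; have [ct cE] := trig_inv bu bt.
have e i j : pinned_aut b i j = (-1) ^+ i * (-1) ^+ j * invmx b (rev_ord j) (rev_ord i).
  by rewrite /pinned_aut antidiag_conj -trmx_inv mxE.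
split.
  apply/is_trig_mxP => i j ij; rewrite e; move/is_trig_mxP: ct => -> /=; first by rewrite mulr0.
  by have := ltn_ord j; lia.
rewrite /weight [RHS](reindex_inj rev_ord_inj); apply: eq_bigr => i _.
by rewrite e cE -exprMn mulrNN mulr1 expr1n mul1r la exprz_inv.
Qed.

Lemma pinned_aut_upper (b : 'M[C]_N) (l : 'rV[int]_N) : GLN b -> is_trig_mx b^T -> antisym l ->
  is_trig_mx (pinned_aut b)^T /\ weight l (pinned_aut b) = weight l b.
Proof.
move=> bu bt la; have bTu : GLN b^T by rewrite /GL /= unitmx_tr.
have [ct cE] := trig_inv bTu bt.
have e i j : pinned_aut b i j = (-1) ^+ i * (-1) ^+ j * invmx b^T (rev_ord i) (rev_ord j).
  by rewrite /pinned_aut antidiag_conj.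
split.
  apply/is_trig_mxP => i j ij; rewrite mxE e; move/is_trig_mxP: ct => -> /=; first by rewrite mulr0.
  by have := ltn_ord j; lia.
rewrite /weight [RHS](reindex_inj rev_ord_inj); apply: eq_bigr => i _.
by rewrite e cE mxE -exprMn mulrNN mulr1 expr1n mul1r la exprz_inv.
Qed.

End PinnedAut.

Section SelfDualGL.
Variables (R : realType) (N d : nat).
Local Notation C := (Cx R).
Local Notation J := (antidiag R N).
Local Notation GLN := (GL R N).
Variables (rho : 'M[C]_N -> 'M[C]_d) (w : 'cV[C]_d) (l : 'rV[int]_N).
Hypothesis arho : adj_rep GLN rho.
Hypothesis irr : irreducible GLN rho.
Hypothesis ww : weight_vector (@borel R N) (weight l) rho w.
Hypothesis la : antisym l.

Lemma GLN_scalar (c : C) : c != 0 -> GLN c%:M.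
Proof. by move=> c0; rewrite /GL /= unitmxE det_scalar unitfE expf_neq0. Qed.

(** A scalar acts on $w$ by $c^{\sum l_i} = 1$; the fixed space of its image is stable and nonzero,
    hence everything by irreducibility. *)
Lemma rho_scalar (c : C) : c != 0 -> rho c%:M = 1%:M.
Proof.
move=> c0; have [[_ rM _] _] := arho; have [w0 wB] := ww; have cG := GLN_scalar c0.
have cw : rho c%:M *m w = w.
  rewrite wB; last by split=> //; rewrite tr_scalar_mx scalar_mx_is_trig.
  suff -> : weight l c%:M = 1 by rewrite scale1r.
  rewrite /weight (eq_bigr (fun i => c ^ l 0 i)); last by move=> i _; rewrite mxE eqxx.
  have -> : \prod_i c ^ l 0 i = c ^ (\sum_i l 0 i).
    by elim/big_rec2: _ => [|i x y _ ->]; rewrite ?expr0z // expfzDr.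
  by rewrite antisym_sum // expr0z.
have [_ ir] := irr; case: (ir (kermx ((rho c%:M)^T - 1%:M))).
- move=> g Gg; apply/sub_kermxP.
  have com : (rho g)^T *m ((rho c%:M)^T - 1%:M) = ((rho c%:M)^T - 1%:M) *m (rho g)^T.
    by rewrite mulmxBr mulmxBl mulmx1 mul1mx -!trmx_mul -!rM // scalar_mxC.
  by rewrite -mulmxA com mulmxA mulmx_ker mul0mx.
- move=> k0; case/eqP: w0; apply: trmx_inj; apply/eqP; rewrite trmx0 -submx0 -k0.
  by apply/sub_kermxP; rewrite mulmxBr mulmx1 -trmx_mul cw subrr.
move=> kf; have /eqP : (rho c%:M)^T - 1%:M = 0.
  have := mulmx_ker ((rho c%:M)^T - 1%:M).
  move=> /(congr1 (mulmx (pinvmx (kermx ((rho c%:M)^T - 1%:M))))).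
  by rewrite mulmxA mulVpmx // mul1mx mulmx0.
by rewrite subr_eq0 => /eqP e; apply: trmx_inj; rewrite e trmx1.
Qed.

Lemma conjCXzK (x : C) (n : int) : (x^* ^ n)^* = x ^ n.
Proof. by case: n => n; rewrite ?NegzE -?exprnP -?exprnN ?fmorphV rmorphXn /= conjCK. Qed.

Lemma lower_row (b : 'M[C]_N) : GLN b -> is_trig_mx b ->
  adjmx w *m rho b = weight l b *: adjmx w.
Proof.
move=> bG bt; have [_ ra] := arho; have [_ wB] := ww.
have bB : borel (adjmx b).
  split; first exact: GLN_adj.
  by rewrite trmxK; apply/is_trig_mxP => i j ij; rewrite mxE; move/is_trig_mxP: bt => ->; rewrite ?rmorph0.
have := congr1 (@adjmx _ _ _) (wB _ bB); rewrite adjmxM -ra ?adjmxK; last exact: GLN_adj.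
move=> ->; apply/matrixP => i j; rewrite !mxE rmorphM; congr (_ * _).
rewrite /weight rmorph_prod; apply: eq_bigr => k _; rewrite !mxE.

exact: conjCXzK.
Qed.

Lemma coef_big_cell (L U : 'M[C]_N) : GLN L -> GLN U -> is_trig_mx L -> is_trig_mx U^T ->
  adjmx w *m rho (L *m U) *m w = weight l L * weight l U *: (adjmx w *m w).
Proof.
move=> LG UG Lt Ut; have [[_ rM _] _] := arho; have [_ wB] := ww.
by rewrite rM // mulmxA lower_row // -mulmxA wB // -scalemxAr -scalemxAl scalerA mulrC.
Qed.

Lemma coef_pinned_big_cell (L U : 'M[C]_N) : GLN L -> GLN U -> is_trig_mx L -> is_trig_mx U^T ->
  adjmx w *m rho (pinned_aut (L *m U)) *m w = adjmx w *m rho (L *m U) *m w.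
Proof.
move=> LG UG Lt Ut.
have [Lt' wL] := pinned_aut_lower LG Lt la; have [Ut' wU] := pinned_aut_upper UG Ut la.
rewrite (coef_big_cell LG UG Lt Ut) (pinned_autM LG UG).
by rewrite (coef_big_cell (pinned_aut_GL LG) (pinned_aut_GL UG) Lt' Ut') wL wU.
Qed.

                                                                                
                                                        
(** On a product $LU$ both sides are the two weights times the norm of $w$. The identity extends to
    all $g$ along the curve $g+t$. To keep that curve polynomial, the adjugate replaces the inverse;
    they differ by the scalar $\det$, which acts trivially. *)
Lemma coef_pinned_aut (g : 'M[C]_N) : GLN g ->
  adjmx w *m rho (pinned_aut g) *m w = adjmx w *m rho g *m w.
Proof.
move=> Gg; have [[_ rM rr] _] := arho.
pose f (h : 'M[C]_N) := (adjmx w *m rho h *m w) 0 0.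
have fr : regular_on GLN f by apply: regular_compress.
pose cJ := map_mx polyC J; pose cJ' := map_mx polyC (invmx J).
pose gt := map_mx polyC g + 'X%:M; pose gt' := cJ *m (\adj gt)^T *m cJ'.
have evC (A : 'M[C]_N) t : map_mx (horner_eval t) (map_mx polyC A) = A.
  by apply/matrixP => i j; rewrite !mxE; exact: hornerC.
have gtE t : map_mx (horner_eval t) gt = g + t%:M by exact: horner_shift.
have gt'E t : map_mx (horner_eval t) gt' = J *m (\adj (g + t%:M))^T *m invmx J.
  by rewrite !map_mxM !evC -map_trmx map_mx_adj gtE.
have sE h : GLN h -> J *m (\adj h)^T *m invmx J = (\det h)%:M *m pinned_aut h.
  move=> hu; have d0 : \det h != 0 by rewrite -unitfE -unitmxE.
  have -> : \adj h = \det h *: invmx h by rewrite /invmx hu scalerA divff // scale1r.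
  by rewrite linearZ /= mul_scalar_mx /pinned_aut trmx_inv -scalemxAr -scalemxAl.
have sG h : GLN h -> GLN (J *m (\adj h)^T *m invmx J).
  move=> hu; rewrite sE //; apply: GLN_M; last exact: pinned_aut_GL.
  by apply: GLN_scalar; rewrite -unitfE -unitmxE.
have fs h : GLN h -> f (J *m (\adj h)^T *m invmx J) = f (pinned_aut h).
  move=> hu; have d0 : \det h != 0 by rewrite -unitfE -unitmxE.
  have rs : rho ((\det h)%:M *m pinned_aut h) = rho (pinned_aut h).
    rewrite rM; [|exact: GLN_scalar|exact: pinned_aut_GL].
    by rewrite (rho_scalar d0) mul1mx.
  by rewrite /f (sE h hu) rs.
have [P [k HP]] := regular_curve gt fr; have [P' [k' HP']] := regular_curve gt' fr.
have [q q0 Hq] := generic_LU g.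
pose D := \det gt; pose D' := \det gt'.
have DE t : D.[t] = \det (g + t%:M) by rewrite -horner_evalE -det_map_mx gtE.
have D'E t : D'.[t] = \det (J *m (\adj (g + t%:M))^T *m invmx J) by rewrite -horner_evalE -det_map_mx gt'E.
have D0 : D.[0] != 0 by rewrite DE raddf0 addr0 -unitfE -unitmxE.
have GD t : D.[t] != 0 -> GLN (g + t%:M) by rewrite DE /GL /= unitmxE unitfE.
have D'0 t : D.[t] != 0 -> D'.[t] != 0.
  by move=> /GD/sG; rewrite D'E /GL /= unitmxE unitfE.
have PE : P * D' ^+ k' = P' * D ^+ k.
  apply: (@poly_eq_inf _ _ _ (q * D)).
    by rewrite mulf_neq0 //; apply: contraNneq D0 => ->; rewrite horner0.
  move=> t; rewrite hornerM mulf_eq0 negb_or => /andP[qt Dt].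
  have Dt' := D'0 t Dt; have Gt := GD t Dt; have [L [U [Lt Ut LU]]] := Hq t qt.
  have /andP[Lu Uu] : (L \in unitmx) && (U \in unitmx) by rewrite -unitmx_mul -LU.
  have := HP t; have := HP' t; rewrite gtE gt'E /= -DE -D'E => /(_ (sG _ Gt)) f'E /(_ Gt) fE.
  have ff : f (J *m (\adj (g + t%:M))^T *m invmx J) = f (g + t%:M).
    by rewrite (fs _ Gt) /f LU (coef_pinned_big_cell Lu Uu Lt Ut).
  rewrite !hornerM !horner_exp; move: ff; rewrite f'E fE => /eqP.
  by rewrite eqr_div ?expf_neq0 // => /eqP.
have := congr1 (fun p => p.[0]) PE; rewrite !hornerM !horner_exp => E0.
have := HP 0; have := HP' 0; rewrite gtE gt'E /= -DE -D'E (_ : g + 0%:M = g); last by rewrite raddf0 addr0.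
move=> /(_ (sG _ Gg)); rewrite (fs _ Gg) => f'E /(_ Gg) fE.
suff e : f (pinned_aut g) = f g by apply/matrixP => i j; rewrite !ord1; exact: e.
rewrite f'E fE; apply/eqP; by rewrite eqr_div ?expf_neq0 ?D'0 // E0.
Qed.

(** The pinned automorphism is $g\mapsto g^{-T}$ followed by conjugation by $J$; the factors $J$ and
    $J^{-1}$ are moved into the row and column vectors of the coefficient. *)
Lemma GL_rep_iso_opp_inv_tr : rep_iso GLN rho (fun g => rho (invmx g^T)).
Proof.
have [ra _] := arho; have [_ rM _] := ra; have [w0 _] := ww.
have Ju : GLN J := antidiag_unit R N; have JG : GLN (invmx J) by rewrite /GL /= unitmx_inv.
have tG (g : 'M[C]_N) : GLN g -> GLN (invmx g^T) by rewrite /GL /= unitmx_inv unitmx_tr.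
apply: (matrix_coefficient_iso (@GLN_adj R N) (GLN1 R N) (@GLN_M R N) (w := w) (w' := rho (invmx J) *m w) (u' := adjmx w *m rho J) arho irr w0).
- move=> g h Gg Gh; rewrite trmx_mul invmxM ?unitmx_tr //.
  exact: rM (tG g Gg) (tG h Gh).
- by rewrite trmx1 invmx1; apply: (alg_rep1 (GLN1 R N) ra).
move=> g Gg; rewrite -coef_pinned_aut // /pinned_aut (rM _ _ (GLN_M Ju (tG _ Gg))) // (rM _ _ Ju) ?tG //; last exact: tG.
by rewrite !mulmxA.
Qed.

End SelfDualGL.

                                                

(** * Representations of isometry groups by restriction from $\mathrm{GL}_N$ *)

Section IsometryGroups.
Variables (R : realType) (N : nat).
Local Notation C := (Cx R).

Lemma special_isometries_unit (K g : 'M[C]_N) : special_isometries K g -> g \in unitmx.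
Proof. by move=> [_ d]; rewrite unitmxE d unitr1. Qed.

Lemma tr_isometry (F : fieldType) (K g : 'M[F]_N) (c : F) : c != 0 -> K *m K = c%:M ->
  g \in unitmx -> g *m K *m g^T = K -> g^T *m K *m g = K.
Proof.
move=> c0 KK gu gK; have Ku : K \in unitmx.
  suff /mulmx1_unit[] : K *m (c^-1 *: K) = 1%:M by [].
  by rewrite -scalemxAr KK scale_scalar_mx mulVf.
have /mulmx1C e : g *m (c^-1 *: (K *m g^T *m K)) = 1%:M.
  by rewrite -scalemxAr !mulmxA gK KK scale_scalar_mx mulVf.
apply: (can_inj (mulKmx Ku)); rewrite KK -(mulr1 c) -scale_scalar_mx -e -scalemxAl scalerA divff //.
by rewrite scale1r !mulmxA.
Qed.

Lemma special_isometries_adj (K g : 'M[C]_N) (c : C) : c != 0 -> K *m K = c%:M ->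
  map_mx Num.conj K = K -> special_isometries K g -> special_isometries K (adjmx g).
Proof.
move=> c0 KK Kr gK; have gu := special_isometries_unit gK; case: gK => gK gd; split.
  have := congr1 (map_mx Num.conj) (tr_isometry c0 KK gu gK).
  by rewrite !map_mxM Kr -map_trmx /adjmx trmxK.
by rewrite /adjmx det_tr det_map_mx gd rmorph1.
Qed.

Lemma antidiag_real : map_mx Num.conj (antidiag R N) = antidiag R N.
Proof.
apply/matrixP => i j; rewrite !mxE; case: ifP => _; last by rewrite rmorph0.
by rewrite rmorphXn rmorphN rmorph1.
Qed.

Lemma conj_rep_iso (G : set 'M[C]_N) d (rho : 'M[C]_N -> 'M[C]_d) (x : 'M[C]_N) :
  alg_rep G rho -> (forall g h, G g -> G h -> G (g *m h)) -> x \in unitmx -> G x -> G (invmx x) ->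
  rep_iso G rho (fun g => rho (x *m g *m invmx x)).
Proof.
move=> [ru rM _] GM xu Gx Gx'; exists (rho x); first exact: ru.
move=> g Gg; rewrite -!rM //; last exact: GM (GM _ _ Gx Gg) Gx'.
by rewrite mulmxKV.
Qed.

(** A highest weight vector for $\mathrm{GL}_N$, moved by $h$, stays a weight vector for the Borel
    subgroup of $G$ given by $h$. Closure of $G$ under adjoints allows passing to an irreducible
    constituent. *)
Lemma restricted_rep (G : set 'M[C]_N) (h : 'M[C]_N) (l : 'rV[int]_N) :
  (forall g, G g -> G (adjmx g)) -> (forall g, G g -> g \in unitmx) ->
  h \in unitmx -> dominant l ->
  exists d (rho : 'M[C]_N -> 'M[C]_d),
    [/\ alg_rep G rho, irreducible G rho &
        exists2 v : 'cV[C]_d, v != 0 &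
          forall b, is_trig_mx b^T -> G (h *m b *m invmx h) ->
            rho (h *m b *m invmx h) *m v = weight l b *: v].
Proof.
move=> Gadj GU hu ld; have [d [rho [w [[ra rs] [w0 wB]]]]] := GLhw_dominant R ld.
have [ru rM rr] := ra.
pose B (x : 'M[C]_N) := G x /\ is_trig_mx (invmx h *m x *m h)^T.
pose chi x : C := weight l (invmx h *m x *m h).
have hv' (x : 'M[C]_N) : invmx h *m (h *m x *m invmx h) *m h = x.
  by rewrite !mulmxA mulVmx // mul1mx mulmxKV.
have aG : adj_rep G rho.
  split; last by move=> g /GU; exact: rs.
  split; first by move=> g /GU; exact: ru.
    by move=> g g' /GU Gg /GU Gg'; exact: rM.
  by move=> i j; apply: regular_sub (rr i j) => g /GU.
have wG : weight_vector B chi rho (rho h *m w).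
  split.
    apply: contraNneq w0 => e; apply/eqP; apply: (can_inj (mulKmx (ru _ hu))).
    by rewrite e mulmx0.
  move=> x [Gx xt]; have xu := GU _ Gx.
  have bu : GL R N (invmx h *m x *m h) by rewrite /GL /= !unitmx_mul unitmx_inv hu xu.
  rewrite mulmxA -rM // (_ : x *m h = h *m (invmx h *m x *m h)); last by rewrite !mulmxA mulmxV // mul1mx.
  by rewrite rM // -mulmxA wB // -scalemxAr.
have BG : forall b, B b -> G b by move=> b [].
have [d' [rho' [w' [[ra' _] irr [w'0 w'B]]]]] := irr_constituent Gadj GU BG aG wG.
exists d', rho'; split=> //; exists w' => // b bt Gb.
by rewrite w'B; [rewrite /chi hv' | split=> //; rewrite hv'].
Qed.

End IsometryGroups.

Lemma congruence_unit (F : fieldType) N (h J K : 'M[F]_N) : K \in unitmx ->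
  h *m J *m h^T = K -> h \in unitmx.
Proof. by move=> Ku e; move: Ku; rewrite -e !unitmx_mul => /andP[/andP[]]. Qed.

Lemma isometry_inv_tr (F : fieldType) N (g J : 'M[F]_N) : J \in unitmx -> g \in unitmx ->
  g *m J *m g^T = J -> invmx J *m g *m J = invmx g^T.
Proof.
move=> Ju gu gJ; have gTu : g^T \in unitmx by rewrite unitmx_tr.
apply: (can_inj (mulmxK gTu)); rewrite mulVmx //.
by rewrite -(mulmxA (invmx J) g) -(mulmxA (invmx J)) gJ mulVmx.
Qed.

Section OrthogonalFrame.
Variable R : realType.
Local Notation C := (Cx R).

Lemma Ipq_diag p q : Ipq R p q = diag_mx (\row_i (-1) ^+ (p <= i)%N).
Proof.
apply/matrixP => i j; rewrite /Ipq; case: (split_ordP i) => a ->; case: (split_ordP j) => c ->.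
- by rewrite block_mxEul !mxE (inj_eq (@lshift_inj _ _)) /= leqNgt ltn_ord.
- by rewrite block_mxEur !mxE eq_lrshift.
- by rewrite block_mxEdl !mxE eq_rlshift.
by rewrite block_mxEdr !mxE (inj_eq (@rshift_inj _ _)) /= leq_addr mulNrn.
Qed.

Lemma antidiag_frame (F : fieldType) N (J A B E : 'M[F]_N) : J *m J = 1%:M -> J^T = J ->
  A^T = A -> B^T = B -> A *m B = B *m A -> A *m B *+ 2 = E ->
  A *m J *m A + B *m J *m B = 0 -> (A + B *m J) *m J *m (A + B *m J)^T = E.
Proof.
move=> JJ JT AT BT AB <- H; rewrite linearD /= trmx_mul JT AT BT mulmxDl -(mulmxA B) JJ mulmx1.
rewrite mulmxDr !mulmxDl (mulmxA _ J B) -(mulmxA A J J) JJ mulmx1 (mulmxA B J B).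
by rewrite (addrC (A *m B)) addrACA H add0r -AB.
Qed.

Lemma frame_double (F : fieldType) (x y : F) : 2 != 0 :> F -> x != 0 ->
  x * (y / (2 * x)) + x * (y / (2 * x)) = y.
Proof. by move=> n2 x0; field; rewrite ?x0 ?n2. Qed.

Lemma frame_isotropic (F : fieldType) (x y z : F) : 2 != 0 :> F -> 4 != 0 :> F -> x != 0 ->
  x ^+ 2 ^+ 2 = - (y * z) / 4 -> x * x + y / (2 * x) * (z / (2 * x)) = 0.
Proof.
move=> n2 n4 x0 x4; have yz : y * z = - (4 * x ^+ 2 ^+ 2) by rewrite x4 mulrCA mulfV // mulr1 opprK.
have -> : y / (2 * x) * (z / (2 * x)) = y * z / (2 * 2 * x ^+ 2) by field; rewrite ?x0 ?n2 ?n4.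
by rewrite yz; field; rewrite ?x0 ?n2 ?n4.
Qed.

(** Sought as $h = A + BJ$ with $A$, $B$ diagonal. With $e$ the diagonal of $I_{p,q}$, the
    conditions are $2a_ib_i = e_i$ on the diagonal and
    $a_ia_{\mathrm{rev}\,i}+b_ib_{\mathrm{rev}\,i} = 0$ on the antidiagonal. For $a$ invariant under
    reversal they amount to $a_i^4 = -e_ie_{\mathrm{rev}\,i}/4$. *)
Lemma SO_frame p q : odd (p + q) -> exists2 h : 'M[C]_(p + q), h \in unitmx &
  h *m antidiag R (p + q) *m h^T = Ipq R p q.
Proof.
move=> oN; have oN1 : odd (p + q).-1 = false by move: oN; case: (p + q)%N => //= k /negbTE.
set N := (p + q)%N in oN oN1 *; set J := antidiag R N.
pose e (i : 'I_N) : C := (-1) ^+ (p <= i)%N.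
pose a (i : 'I_N) : C := sqrtC (sqrtC (- (e i * e (rev_ord i)) / 4)).
have e0 i : e i != 0 by rewrite signr_eq0.
have n4 : 4 != 0 :> C by rewrite pnatr_eq0.
have a4 i : a i ^+ 2 ^+ 2 = - (e i * e (rev_ord i)) / 4 by rewrite !sqrtCK.
have a0 i : a i != 0.
  by rewrite !sqrtC_eq0 mulf_neq0 ?oppr_eq0 ?mulf_neq0 ?invr_eq0.
have ar i : a (rev_ord i) = a i by rewrite /a rev_ordK (mulrC (e (rev_ord i))).
pose b i := e i / (2 * a i).
have n2 : 2 != 0 :> C by rewrite pnatr_eq0.
have ab2 i : a i * b i + a i * b i = e i by exact: frame_double.
have abr i : a i * a (rev_ord i) + b i * b (rev_ord i) = 0.
  by rewrite /b ar; exact: frame_isotropic.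
clearbody b; pose A := diag_mx (\row_i a i); pose B := diag_mx (\row_i b i).
have JJ : J *m J = 1%:M.
  by rewrite antidiag_sq -signr_odd oN1.
have JT : J^T = J.
  by rewrite tr_antidiag -signr_odd oN1 scale1r.
have E : (A + B *m J) *m J *m (A + B *m J)^T = Ipq R p q.
  apply: (antidiag_frame JJ JT (tr_diag_mx _) (tr_diag_mx _) (diag_mxC _ _)).
    rewrite mulmx_diag Ipq_diag; apply/matrixP => i j; rewrite !mxE.
    by case: (i == j); rewrite ?mulr0n ?addr0 // !mulr1n ab2.
  apply/matrixP => i j; rewrite mxE !mul_mx_diag !mul_diag_mx !mxE.
  case: eqP => [->|_]; last by rewrite !mulr0 !mul0r addr0.
  by rewrite !(mulrAC _ ((-1) ^+ i)) -mulrDl abr mul0r.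
exists (A + B *m J) => //; apply: congruence_unit E.
by have /mulmx1_unit[] := Ipq_sq R p q.
Qed.

End OrthogonalFrame.

(** * Weights of $G$ against cocharacters of the dual torus *)

Section Truncation.
Variables (m N r : nat).

(** The weight behind [weight_char]: the first [r] entries of a cocharacter of the dual torus,
    padded by zeros. The sum over [j == i] passes between the two index types, with value $0$ out of
    range. *)
Definition trunc (l : 'rV[int]_m) : 'rV[int]_N :=
  \row_i (if (i < r)%N then \sum_(j < m | j == i :> nat) l 0 j else 0).

Lemma trunc_lt (l : 'rV[int]_m) (i : 'I_N) (j : 'I_m) : (i < r)%N -> j = i :> nat ->
  trunc l 0 i = l 0 j.
Proof.
by move=> ir ji; rewrite mxE ir (big_pred1 j) // => x; rewrite -ji.
Qed.

Lemma trunc_ge (l : 'rV[int]_m) (i : 'I_N) : (r <= i)%N -> trunc l 0 i = 0.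
Proof. by rewrite mxE leqNgt => /negbTE ->. Qed.

Hypothesis rm : r = m./2.
Hypothesis rN : (r <= N)%N.

Lemma antisym_mid (l : 'rV[int]_m) (i : 'I_m) : antisym l -> (r <= i)%N -> (r <= rev_ord i)%N ->
  l 0 i = 0.
Proof.
move=> la ri ri'; have e : rev_ord i = i by apply: val_inj => /=; move: ri' => /=; have := ltn_ord i; lia.
by have /eqP := la i; rewrite e -subr_eq0 opprK -mulr2n mulrn_eq0 => /eqP.
Qed.

(** The step down to the zero padding holds because an entry of the first half dominates its own
    negative. *)
Lemma trunc_dominant (l : 'rV[int]_m) : antisym l -> dominant l -> dominant (trunc l).
Proof.
move=> la ld i j ij; have [jr|rj] := ltnP j r.
  have jm : (j < m)%N by lia.
  have im : (i < m)%N by lia.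
  rewrite (@trunc_lt l i (Ordinal im)) ?(@trunc_lt l j (Ordinal jm)) //; first exact: ld.
  exact: leq_ltn_trans jr.
rewrite (trunc_ge l rj); have [ir|ri] := ltnP i r; last by rewrite trunc_ge.
have im : (i < m)%N by lia.
rewrite (@trunc_lt l i (Ordinal im)) //; have := ld (Ordinal im) (rev_ord (Ordinal im)).
by rewrite la /= => H; have := H _; lia.
Qed.

(** Comparison with a zero of the padding makes the first half of $l$ nonnegative; antisymmetry
    gives the other comparisons. *)
Lemma dominant_of_trunc (l : 'rV[int]_m) : (0 < r -> r < N)%N -> antisym l ->
  dominant (trunc l) -> dominant l.
Proof.
move=> rN' la ld.
have D (i j : 'I_m) : (i <= j)%N -> (j < r)%N -> l 0 j <= l 0 i.
  move=> ij jr; have jN : (j < N)%N by lia.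
  have iN : (i < N)%N by lia.
  have := ld (Ordinal iN) (Ordinal jN) ij.
  by rewrite (@trunc_lt l (Ordinal iN) i) ?(@trunc_lt l (Ordinal jN) j) //=; lia.
have P (i : 'I_m) : (i < r)%N -> 0 <= l 0 i.
  move=> ir; have rN1 : (r < N)%N by lia.
  have iN : (i < N)%N by lia.
  have := ld (Ordinal iN) (Ordinal rN1); rewrite (@trunc_lt l (Ordinal iN) i) //.
  by rewrite trunc_ge //=; apply; lia.
move=> i j ij; have := ltn_ord j.
have [jr|rj] := ltnP j r; first by move=> _; exact: D.
have Lj : l 0 j <= 0.
  have [rj'|rj'] := ltnP (rev_ord j) r; last by rewrite (antisym_mid la rj).
  by have := P _ rj'; rewrite la oppr_ge0.
move=> jm; have [ir|ri] := ltnP i r; first by have := P i ir; lia.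
have [ri'|ri'] := ltnP (rev_ord i) r; last by rewrite (antisym_mid la ri ri').
rewrite -lerN2 -!la; apply: D ri'; exact: leq_sub2l.
Qed.

End Truncation.

Lemma weight_charE (R : realType) (G : real_group R) (l : 'rV[int]_(dsize G)) b :
  weight_char l b = weight (trunc (gsize G) (grank G) l) b.
Proof.
rewrite /weight_char /weight [RHS](bigID (fun i : 'I_(gsize G) => (i < grank G)%N)) /=.
rewrite [X in _ = _ * X]big1 ?mulr1; last by move=> i; rewrite -leqNgt => ri; rewrite trunc_ge // expr0z.
apply: eq_bigr => i ir; have [im|mi] := ltnP i (dsize G).
  rewrite (@trunc_lt _ _ _ l i (Ordinal im)) // (big_pred1 (Ordinal im)) // => j; rewrite -val_eqE //.
rewrite mxE ir !big_pred0 ?expr0z // => j; apply/eqP => e; have := ltn_ord j; rewrite e ltnNge mi //.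
Qed.

(** * The $\theta$-invariant representations of $\mathrm{PGL}_N$, $\mathrm{Sp}_{2n}$ and
    $\mathrm{SO}(p,q)$ *)

Section RepresentationsOfG.
Variable R : realType.
Local Notation C := (Cx R).

Definition selfdual_rep (G : real_group R) (l : 'rV[int]_(dsize G)) : Prop :=
  exists (d : nat) (rho : 'M[C]_(gsize G) -> 'M[C]_d),
    [/\ irrep rho, rep_iso (@cpoints _ G) rho (fun g => rho (theta g)) & has_highest_weight rho l].

Lemma trunc_id N (l : 'rV[int]_N) : trunc N N l = l.
Proof. by apply/rowP => i; rewrite (@trunc_lt _ _ _ l i i). Qed.

Lemma PGL_rep N (l : 'rV[int]_N) : antisym l -> dominant l -> selfdual_rep (G := PGL R N) l.
Proof.
move=> la ld; have [d0 [rho0 [w0 [ar0 wv0]]]] := GLhw_dominant R ld.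
have BG : forall b, @borel R N b -> GL R N b by move=> b [].
have [d [rho [w [ar irr wv]]]] := irr_constituent (@GLN_adj R N) (fun g Gg => Gg) BG ar0 wv0.
have [ra _] := ar; exists d, rho; split.
- by split=> // z [c c0 ->]; apply: (rho_scalar ar irr wv la c0).
- exact: GL_rep_iso_opp_inv_tr ar irr wv la.
exists 1%:M => //; have [w1 wB] := wv; exists w => // b bt.
rewrite invmx1 mulmx1 mul1mx => Gb; rewrite weight_charE /= trunc_id; exact: wB.
Qed.

Lemma PGL_dominant N (l : 'rV[int]_N) d (rho : 'M[C]_N -> 'M[C]_d) :
  alg_rep (GL R N) rho -> has_highest_weight (G := PGL R N) rho l -> dominant l.
Proof.
move=> ra [h -> [v v0 vB]]; apply: (GL_hw_dominant ra v0) => b [Gb bt].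
by have := vB b bt; rewrite invmx1 mulmx1 mul1mx weight_charE /= trunc_id; apply.
Qed.

(** On $\mathrm{Sp}_{2n}$ one has $g^{-T} = J^{-1}gJ$ with $J$ itself symplectic, so $\theta$ is
    inner. *)
Lemma Sp_rep n (l : 'rV[int]_n.*2.+1) : antisym l -> dominant l -> selfdual_rep (G := Sp2n R n) l.
Proof.
move=> la ld; set N := n.*2; pose J := antidiag R N; pose G := @classical R N.
have Ju : J \in unitmx := antidiag_unit R N.
have GU : forall g, G g -> g \in unitmx by move=> g; exact: classical_unit.
have s0 : (-1) ^+ N.-1 != 0 :> C by rewrite signr_eq0.
have Gadj : forall g, G g -> G (adjmx g).
  by move=> g; apply: (special_isometries_adj s0); [exact: antidiag_sq | exact: antidiag_real].
have tld : dominant (trunc N n l).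
  by apply: trunc_dominant => //; rewrite /N; lia.
have [d [rho [ra irr [v v0 vB]]]] := restricted_rep Gadj GU (unitmx1 _ _) tld.
have JJT : J *m J *m J^T = J.
  by rewrite tr_antidiag antidiag_sq -scalemxAr mul_scalar_mx scalerA -exprMn mulrNN mulr1 expr1n scale1r.
have GJ : G J by split=> //; apply: det_isometry_antidiag => //; rewrite odd_double.
exists d, rho; split.
- split=> // z ->; exact: (alg_rep1 (special_isometries1 (antidiag R N)) ra).
- have Ju' : invmx J \in unitmx by rewrite unitmx_inv.
  have GJ' : G (invmx (invmx J)) by rewrite invmxK.
  have [P Pu HP] := conj_rep_iso ra (@special_isometriesM R N J) Ju' (classicalV GJ) GJ'.
  exists P => // g Gg; have [gJ _] := Gg.
  by rewrite (HP g Gg) invmxK (isometry_inv_tr Ju (GU g Gg) gJ).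
exists 1%:M => //; exists v => // b bt Gb; rewrite weight_charE; exact: vB.
Qed.

Lemma Sp_dominant n (l : 'rV[int]_n.*2.+1) d (rho : 'M[C]_n.*2 -> 'M[C]_d) :
  alg_rep (@classical R n.*2) rho -> has_highest_weight (G := Sp2n R n) rho l ->
  antisym l -> dominant l.
Proof.
move=> ra [h -> [v v0 vB]] la; have [_ rM rr] := ra.
apply: (@dominant_of_trunc _ n.*2 n) => //; try lia.
apply: (@classical_hw_dominant R n.*2 (@classical R n.*2) 1%:M d rho v) => //.
- exact: unitmx1.
- by move=> g; rewrite invmx1 mulmx1 mul1mx.
- exact: alg_rep1 (special_isometries1 (antidiag R n.*2)) ra.
- by move=> b Gb bt; have := vB b bt; rewrite weight_charE invmx1 mulmx1 mul1mx; apply.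
by move=> j nj; rewrite trunc_ge //; move: nj; rewrite doubleK.
Qed.

Lemma conj_form (F : fieldType) N (h g J : 'M[F]_N) : h \in unitmx ->
  (h *m g *m invmx h) *m (h *m J *m h^T) *m (h *m g *m invmx h)^T = h *m (g *m J *m g^T) *m h^T.
Proof.
move=> hu; rewrite 2!trmx_mul !mulmxA mulmxKV // -(mulmxA _ h^T) -trmx_mul mulVmx //.
by rewrite trmx1 mulmx1.
Qed.

Lemma Ipq_tr p q : (Ipq R p q)^T = Ipq R p q.
Proof. by rewrite Ipq_diag tr_diag_mx. Qed.

Lemma Ipq_real p q : map_mx Num.conj (Ipq R p q) = Ipq R p q.
Proof.
rewrite Ipq_diag map_diag_mx; congr diag_mx; apply/rowP => i; rewrite !mxE.
by rewrite rmorphXn rmorphN rmorph1.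
Qed.

                                                                           
                                   
(** The sign is $\det I_{p,q}$ itself: in odd dimension it turns the determinant into its own even
    power. Hence $\theta$ is inner on the complex $\mathrm{SO}(p,q)$. *)
Lemma Ipq_scaled_special p q : odd (p + q) -> exists2 e : C, e * e = 1 &
  special_isometries (Ipq R p q) (e *: Ipq R p q).
Proof.
move=> oN; exists (\det (Ipq R p q)).
  by rewrite -det_mulmx Ipq_sq det1.
have dd : \det (Ipq R p q) * \det (Ipq R p q) = 1 by rewrite -det_mulmx Ipq_sq det1.
split.
  by rewrite linearZ /= Ipq_tr -!scalemxAl -scalemxAr scalerA dd scale1r Ipq_sq mul1mx.
rewrite detZ; move: (\det _) dd => e dd; rewrite -exprSr -(odd_double_half (p + q)) oN addSn add0n -doubleS -muln2 mulnC exprM.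
by rewrite expr2 dd expr1n.
Qed.

Lemma SO_rep p q (l : 'rV[int]_(p + q).-1) : odd (p + q) -> antisym l -> dominant l ->
  selfdual_rep (G := SO R p q) l.
Proof.
move=> oN la ld; set N := (p + q)%N in oN l la ld *.
pose K := Ipq R p q; pose G : set 'M[C]_N := special_isometries K.
have KK : K *m K = 1%:M := Ipq_sq R p q.
have GU : forall g, G g -> g \in unitmx by move=> g; exact: special_isometries_unit.
have Gadj : forall g, G g -> G (adjmx g).
  by move=> g; apply: (special_isometries_adj (oner_neq0 C) KK); exact: Ipq_real.
have [h hu hJ] := SO_frame R oN.
have tld : dominant (trunc N N./2 l) by apply: trunc_dominant => //; lia.
have [d [rho [ra irr [v v0 vB]]]] := restricted_rep Gadj GU hu tld.
have [e ee Ge] := Ipq_scaled_special oN; pose x := e *: K.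
have xx : x *m x = 1%:M by rewrite /x -scalemxAl -scalemxAr scalerA ee scale1r.
have xu : x \in unitmx by have [] := mulmx1_unit xx.
have xV : invmx x = x by apply: (can_inj (mulKmx xu)); rewrite mulmxV.
exists d, rho; split.
- split=> // z ->; exact: (alg_rep1 (special_isometries1 K) ra).
- have Gx' : G (invmx x) by rewrite xV.
  have [P Pu HP] := conj_rep_iso ra (@special_isometriesM R N K) xu Ge Gx'.
  have xE (g : 'M[C]_N) : x *m g *m invmx x = K *m g *m K.
    by rewrite xV /x -!scalemxAl -scalemxAr scalerA ee scale1r.
  by exists P => // g Gg; rewrite (HP g Gg) xE.
by exists h => //; exists v => // b bt Gb; rewrite weight_charE; exact: vB.
Qed.

Lemma SO_dominant p q (l : 'rV[int]_(p + q).-1) d (rho : 'M[C]_(p + q) -> 'M[C]_d) :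
  odd (p + q) -> alg_rep (special_isometries (Ipq R p q)) rho ->
  has_highest_weight (G := SO R p q) rho l -> antisym l -> dominant l.
Proof.
move=> oN ra [h hJ [v v0 vB]] la; have [_ rM rr] := ra.
have Ku : Ipq R p q \in unitmx by have /mulmx1_unit[] := Ipq_sq R p q.
have hu : h \in unitmx := congruence_unit Ku hJ.
have Gh (g : 'M[C]_(p + q)) : classical g -> special_isometries (Ipq R p q) (h *m g *m invmx h).
  move=> [gJ gd]; split.
    by rewrite -hJ (conj_form g (antidiag R (p + q)) hu) gJ.
  by rewrite !det_mulmx gd mulr1 -det_mulmx mulmxV // det1.
apply: (@dominant_of_trunc _ (p + q) (p + q)./2) => //; try lia.
apply: (@classical_hw_dominant R (p + q) (special_isometries (Ipq R p q)) h d rho v) => //.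
- exact: alg_rep1 (special_isometries1 _) ra.
- by move=> b cb bt; rewrite (vB b bt (Gh b cb)) weight_charE.
by move=> j nj; rewrite trunc_ge.
Qed.

End RepresentationsOfG.

                                                     

(** * Conjugation preserves parameters; diagonalizability of blocks *)

Section Continuity.
Variables (R : realType) (T : topologicalType).
Local Notation K := (Cx R).

Lemma continuous_mx m n (f : T -> 'M[K]_(m, n)) :
  (forall i j, continuous (fun x => f x i j)) -> continuous f.
Proof.
move=> fc x A [P Pn PA]; apply: (filterS PA).
have : \forall y \near x, forall ij : 'I_m * 'I_n, P ij.1 ij.2 (f y ij.1 ij.2).
  by apply: filter_forall => -[i j] /=; exact: (fc i j x) (Pn i j).
by apply: filterS => y H i j; exact: (H (i, j)).
Qed.

Lemma continuous_sum (I : Type) (r : seq I) (f : I -> T -> K) :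
  (forall i, continuous (f i)) -> continuous (fun x => \sum_(i <- r) f i x).
Proof.
move=> fc; elim: r => [|i r IH] x.
  under eq_fun do rewrite big_nil; exact: cvg_cst.
under eq_fun do rewrite big_cons; apply: cvgD; [exact: fc | exact: IH].
Qed.

Lemma continuous_conj m (f : T -> 'M[K]_m) (h h' : 'M[K]_m) :
  continuous f -> continuous (fun x => h *m f x *m h').
Proof.
move=> fc; apply: continuous_mx => i j x.
have -> : (fun x => (h *m f x *m h') i j) = fun x => \sum_b \sum_a h i a * f x a b * h' b j.
  by apply/funext => y; rewrite mxE; apply: eq_bigr => b _; rewrite mxE mulr_suml.
move: x; apply: continuous_sum => b; apply: continuous_sum => a x.
apply: cvgMr_tmp; apply: cvgMl_tmp; exact: (continuous_comp (fc x) (@coord_continuous K m m a b (f x))).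
Qed.

End Continuity.

Section Diagonalizable.
Variable F : fieldType.

Lemma diagonalizable_unitP m (A : 'M[F]_m) :
  diagonalizable A <-> exists2 P, P \in unitmx & is_diag_mx (P *m A *m invmx P).
Proof.
by split=> -[P Pu]; rewrite /similar_to /= ?conjumx // => PA; exists P; rewrite //= ?conjumx.
Qed.

Lemma diagonalizable_conj m (A h : 'M[F]_m) : h \in unitmx ->
  diagonalizable A -> diagonalizable (h *m A *m invmx h).
Proof.
move=> hu /diagonalizable_unitP[P Pu PA]; apply/diagonalizable_unitP.
exists (P *m invmx h); first by rewrite unitmx_mul Pu unitmx_inv.
have Phu : P *m invmx h \in unitmx by rewrite unitmx_mul Pu unitmx_inv.
have -> : invmx (P *m invmx h) = h *m invmx P.
  by apply: (can_inj (mulKmx Phu)); rewrite mulmxV // mulmxA mulmxKV // mulmxV.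
by rewrite !mulmxA !mulmxKV.
Qed.

Lemma block_diag_conj m (A B h : 'M[F]_m) : h \in unitmx ->
  block_mx h 0 0 h *m block_mx A 0 0 B *m invmx (block_mx h 0 0 h) =
  block_mx (h *m A *m invmx h) 0 0 (h *m B *m invmx h).
Proof.
move=> hu; have bu : block_mx h 0 0 h \in unitmx by rewrite unitmxE det_ublock unitrM -unitmxE hu.
apply: (can_inj (mulmxK bu)); rewrite mulmxKV // !mulmx_block.
by rewrite ?(mulmx0, mul0mx, addr0, add0r) !mulmxKV.
Qed.

Lemma block_antidiag_conj m (A B h : 'M[F]_m) : h \in unitmx ->
  block_mx h 0 0 h *m block_mx 0 A B 0 *m invmx (block_mx h 0 0 h) =
  block_mx 0 (h *m A *m invmx h) (h *m B *m invmx h) 0.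
Proof.
move=> hu; have bu : block_mx h 0 0 h \in unitmx by rewrite unitmxE det_ublock unitrM -unitmxE hu.
apply: (can_inj (mulmxK bu)); rewrite mulmxKV // !mulmx_block.
by rewrite ?(mulmx0, mul0mx, addr0, add0r) !mulmxKV.
Qed.

(** The left halves of a basis of row eigenvectors span the first factor and satisfy the eigenvector
    equation for $A$; a subset of them is a basis. *)
Lemma diagonalizable_block m (A B : 'M[F]_m) :
  diagonalizable (block_mx A 0 0 B) -> diagonalizable A.
Proof.
move=> /diagonalizable_unitP[P Pu /is_diag_mxP PD]; set D := P *m _ *m _ in PD.
have PA : lsubmx P *m A = D *m lsubmx P.
  have : P *m block_mx A 0 0 B = D *m P by rewrite /D mulmxKV.
  clearbody D; move/(congr1 lsubmx).
  rewrite -[X in lsubmx (X *m _) = _](hsubmxK P) mul_row_block -[X in _ = lsubmx (_ *m X)](hsubmxK P) mul_mx_row.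
  by rewrite !row_mxKl mulmx0 addr0.
have Pf : row_full (lsubmx P).
  rewrite -sub1mx; apply/submxP; exists (usubmx (invmx P)).
  have := mulVmx Pu; rewrite -{2}[P]hsubmxK -{1}[invmx P]vsubmxK mul_col_row.
  by rewrite scalar_mx_block => /eq_block_mx[].
pose Q := rowsub (fullrankfun Pf) (lsubmx P); have Qu : Q \in unitmx by exact: fullrowsub_unit.
apply/diagonalizable_unitP; exists Q => //.
have QE : Q *m A = (\matrix_(i, j) (if i == j then D (fullrankfun Pf i) (fullrankfun Pf i) else 0)) *m Q.
  apply/matrixP => i j; have /matrixP/(_ (fullrankfun Pf i) j) := PA; rewrite !mxE => e.
  transitivity (\sum_k lsubmx P (fullrankfun Pf i) k * A k j).
    by apply: eq_bigr => k _; rewrite mxE.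
  rewrite e (bigD1 (fullrankfun Pf i)) //= [X in _ + X]big1 ?addr0; last first.
    by move=> k ki; rewrite PD ?mul0r // eq_sym.
  rewrite [RHS](bigD1 i) //= mxE eqxx [X in _ = _ + X]big1 ?addr0 ?mxE //.
  by move=> k ki; rewrite mxE eq_sym (negPf ki) mul0r.
rewrite QE mulmxK //; apply/is_diag_mxP => i j ij; rewrite mxE; case: eqP => // e; by rewrite e eqxx in ij.
Qed.

End Diagonalizable.

Section ConjugateParameter.
Variables (R : realType) (m : nat).
Local Notation C := (Cx R).
Local Notation PG := (PGL R m).
Variable h : 'M[C]_m.
Hypothesis hS : SL R m h.

Let hu : h \in unitmx. Proof. by rewrite unitmxE hS unitr1. Qed.

Lemma conj_paramE (psi : parameter PG) w x :
  conj_param (G := PG) h psi w x = (h *m (psi w x).1 *m invmx h, (psi w x).2).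
Proof.
by rewrite /conj_param /conjL /mulL /actL /= /PGL /= !if_same mul1W mulW1.
Qed.

Lemma A_parameter_conj (psi : parameter PG) : A_parameter psi -> A_parameter (conj_param (G := PG) h psi).
Proof.
move=> [val [mul cont ss reg [b bd]]]; split; [|split].
- move=> w x wW xS; have [dv sv] := val w x wW xS; rewrite conj_paramE; split=> //.
  by rewrite /dual /= /SL /= !det_mulmx det_inv mulrAC dv mulr1 divff // -unitfE -unitmxE.
- move=> w w' x x' wW w'W xS x'S; rewrite !conj_paramE mul // /mulL /actL /=.
  rewrite !if_same; congr (_, _); rewrite !mulmxA mulmxKV //.
- move=> e; have -> : (fun p : C * 'M[C]_2 => (conj_param (G := PG) h psi (p.1, e) p.2).1) =
      fun p => h *m (psi (p.1, e) p.2).1 *m invmx h by apply/funext => p; rewrite conj_paramE.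
  exact: (@continuous_conj R _ m _ h (invmx h) (cont e)).
- move=> w wW; have := ss w wW; rewrite /semisimpleL conj_paramE /Lrep /=.
  have bu : block_mx h 0 0 h \in unitmx by rewrite unitmxE det_ublock unitrM -unitmxE hu.
  case: ifP => _ /(diagonalizable_conj bu).
    by rewrite block_antidiag_conj.
  by rewrite block_diag_conj.
- move=> i j; under eq_fun do rewrite conj_paramE /=.
  by apply: regular_compress reg i j => x; rewrite /SL2 /= unitmxE => ->; rewrite unitr1.
(* The bound for one entry of $hMh^{-1}$ is summed over all entries to become independent of $i$ and
   $j$. *)
exists (\sum_i \sum_j \sum_k (\sum_k' `|h i k'| * b) * `|invmx h k j|) => w i j wW.
rewrite conj_paramE /=.
have b0 : 0 <= b := le_trans (normr_ge0 _) (bd w i j wW).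
have sge (n : nat) (F : 'I_n -> C) (k : 'I_n) : (forall k, 0 <= F k) -> F k <= \sum_k F k.
  by move=> F0; rewrite (bigD1 k) //= lerDl sumr_ge0.
have pos i' j' : 0 <= \sum_k (\sum_k' `|h i' k'| * b) * `|invmx h k j'|.
  by apply: sumr_ge0 => k _; rewrite mulr_ge0 // sumr_ge0 // => k' _; rewrite mulr_ge0.
apply: le_trans (sge _ (fun i => \sum_j \sum_k (\sum_k' `|h i k'| * b) * `|invmx h k j|) i _); last first.
  by move=> i'; apply: sumr_ge0.
apply: le_trans (sge _ (fun j => \sum_k (\sum_k' `|h i k'| * b) * `|invmx h k j|) j _); last by [].
rewrite mxE; apply: le_trans (ler_norm_sum _ _ _) _; apply: ler_sum => k _.
rewrite normrM ler_wpM2r // mxE; apply: le_trans (ler_norm_sum _ _ _) _; apply: ler_sum => k' _.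
by rewrite normrM ler_wpM2l // bd.
Qed.

Lemma Lparam_conj (psi : parameter PG) z :
  Lparam (G := PG) (conj_param (G := PG) h psi) z = h *m Lparam (G := PG) psi z *m invmx h.
Proof. by rewrite /Lparam /L_parameter conj_paramE. Qed.

Lemma torus_form_conj (D : C -> 'M[C]_m) l : torus_form (SL R m) D l ->
  torus_form (SL R m) (fun z => h *m D z *m invmx h) l.
Proof.
move=> [g [k [mu [gS c lmu gD]]]]; exists (g *m invmx h), k, mu; split=> //.
  by rewrite /SL /= det_mulmx gS det_inv hS invr1 mulr1.
have gu : g \in unitmx by rewrite unitmxE gS unitr1.
have hu' : invmx h \in unitmx by rewrite unitmx_inv.
by move=> z z0; rewrite -(gD z z0) (invmxM gu hu') invmxK !mulmxA !mulmxKV.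
Qed.

End ConjugateParameter.

Lemma conj_invariant_form (F : fieldType) m (c B M : 'M[F]_m) : c \in unitmx ->
  M^T *m B *m M = B ->
  c *m M^T *m invmx c *m (c *m B *m c) *m (invmx c *m M *m c) = c *m B *m c.
Proof.
move=> cu MB; rewrite !mulmxA mulmxKV // mulmxK //.
by rewrite -(mulmxA c) -(mulmxA c) MB.
Qed.

Lemma scale_conj (F : fieldType) m (e : F) (X h g : 'M[F]_m) : e != 0 ->
  X \in unitmx -> h \in unitmx ->
  e *: X *m h *m g *m invmx (e *: X *m h) = X *m (h *m g *m invmx h) *m invmx X.
Proof.
move=> e0 Xu hu; have Yu : e *: X *m h \in unitmx by rewrite unitmx_mul unitmxZ ?unitfE // Xu.
apply: (can_inj (mulmxK Yu)); rewrite mulmxKV // -!scalemxAl -scalemxAr.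
by rewrite !mulmxA !mulmxKV.
Qed.

(** * Transfer between $G$ and $\mathrm{PGL}_m$, for $\mathrm{Sp}_{2n}$ and $\mathrm{SO}(p,q)$
    together *)

Section Transfer.
Variables (R : realType) (Gr : real_group R).
Local Notation C := (Cx R).
Local Notation m := (dsize Gr).
Local Notation PG := (PGL R (dsize Gr)).
Hypothesis Gdual : @dual _ Gr = @classical R m.
Hypothesis Ggal : @gal _ Gr = id.
Hypothesis Grho : drho Gr = rho_classical R m.
Hypothesis Grep : forall l : 'rV[int]_m, antisym l -> dominant l -> selfdual_rep l.
Hypothesis Gdom : forall (l : 'rV[int]_m) d (rho : 'M[C]_(gsize Gr) -> 'M[C]_d),
  alg_rep (@cpoints _ Gr) rho -> has_highest_weight rho l -> antisym l -> dominant l.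

Lemma mulL_transfer (x y : Lgroup Gr) : mulL (G := Gr) x y = mulL (G := PG) x y.
Proof. by rewrite /mulL /actL Ggal. Qed.

Lemma Lrep_transfer (x : Lgroup Gr) : Lrep (G := Gr) x = Lrep (G := PG) x.
Proof. by rewrite /Lrep Ggal. Qed.

Lemma A_parameter_PGL (psi : parameter Gr) : A_parameter psi -> A_parameter (G := PG) psi.
Proof.
move=> [val [mul cont ss reg bd]]; split; [|split; [|exact: cont| |exact: reg|exact: bd]].
- by move=> w x wW xS; have [dv sv] := val w x wW xS; split=> //; move: dv; rewrite Gdual => -[].
- by move=> w w' x x' wW w'W xS x'S; rewrite (mul w w' x x' wW w'W xS x'S) mulL_transfer.
- by move=> w wW; have := ss w wW; rewrite /semisimpleL Lrep_transfer.
Qed.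

Lemma A_parameter_of_PGL (psi : parameter Gr) :
  (forall w x, WR w -> SL2 x -> classical (psi w x).1) ->
  A_parameter (G := PG) psi -> A_parameter psi.
Proof.
move=> cl [val [mul cont ss reg bd]]; split; [|split; [|exact: cont| |exact: reg|exact: bd]].
- by move=> w x wW xS; have [_ sv] := val w x wW xS; rewrite Gdual; split=> //; exact: cl.
- by move=> w w' x x' wW w'W xS x'S; rewrite mulL_transfer -(mul w w' x x' wW w'W xS x'S).
- by move=> w wW; have := ss w wW; rewrite /semisimpleL Lrep_transfer.
Qed.

Lemma over_WR_A (G : real_group R) (psi : parameter G) : A_parameter psi -> over_WR psi.
Proof. by move=> [val _] w x wW xS; have [] := val w x wW xS. Qed.

Lemma SL_unit (g : 'M[C]_m) : SL R m g -> g \in unitmx.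
Proof. by move=> gS; rewrite unitmxE gS unitr1. Qed.

Lemma SL_M (g h : 'M[C]_m) : SL R m g -> SL R m h -> SL R m (g *m h).
Proof. by move=> gS hS; rewrite /SL /= det_mulmx gS hS mulr1. Qed.

(** The same $l$ and the same conjugating element serve in $\mathrm{SL}_m$. Being a cocharacter of
    the dual torus, $l$ is antisymmetric, and [Gdom] makes it dominant, so $\mathrm{PGL}_m$ has a
    self-dual representation of this weight. *)
Lemma cohomological_PGL (psi : parameter Gr) : cohomological psi -> cohomological (G := PG) psi.
Proof.
move=> [pA [d [rho [l [irr _ [lc hw] ic]]]]].
have PA := A_parameter_PGL pA; split=> //.
have la : antisym l by apply: (@cochar_classical_antisym R); rewrite -Gdual.
have [ra _ _] := irr; have ld := Gdom ra hw la.
rewrite Grho rho_classicalE in ic.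
have tf : torus_form (@classical R m) (Lparam psi) (map_mx (fun a : int => a%:~R) l + rhoGL R m).
  rewrite -Gdual; apply: in_inf_char_torus_form ic.
  - by rewrite Gdual => g; exact: classical_unit.
  - by rewrite Gdual => g h; exact: special_isometriesM.
  - exact: over_WR_A.
  - exact: regular_inj.
have [d' [rho' [irr' iso' hw']]] := PGL_rep R la ld.
exists d', rho', l; split=> //.
  split=> //; apply: (@mono_cochar _ _ (@classical R m)); first exact: classical_sub_SL.
  by rewrite -Gdual.
apply: (@torus_form_in_inf_char R PG psi); rewrite /dual /=.
- by rewrite /SL /= det1.
- exact: over_WR_A PA.
- by apply: torus_form_mono tf; exact: classical_sub_SL.
Qed.

Lemma PGL_torus_form (psi : parameter PG) : cohomological psi ->
  exists2 l : 'rV[int]_m, dominant l &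
    torus_form (SL R m) (Lparam psi) (map_mx (fun a : int => a%:~R) l + rhoGL R m).
Proof.
move=> [PA [d [rho [l [[ra _ _] _ [lc hw] ic]]]]].
have ld : dominant l := PGL_dominant ra hw.
exists l => //; apply: (in_inf_char_torus_form (G := PG) _ _ (over_WR_A PA) (regular_inj ld) ic).
  exact: SL_unit.
exact: SL_M.
Qed.

Lemma isometry_entry (A : 'M[C]_m) (t : 'rV[C]_m) i j :
  diag_mx t *m A *m (diag_mx t)^T = A -> A i j != 0 -> t 0 i * t 0 j = 1.
Proof.
rewrite tr_diag_mx mul_mx_diag mul_diag_mx => /matrixP/(_ i j); rewrite !mxE => e A0.
by apply: (mulIf A0); rewrite mul1r -[RHS]e mulrAC.
Qed.

(** The diagonalizing $h$ lies only in $\mathrm{SL}_m$, so the form becomes $A = hJh^T$. Its nonzero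
    entries pair inverse characters, which for regular $\lambda$ leaves the antidiagonal alone, and
    a diagonal factor brings $h$ into the classical group. *)
Lemma cohomological_of_PGL (psi : parameter Gr) : A_parameter psi ->
  cohomological (G := PG) psi -> cohomological psi.
Proof.
move=> pA coh; split=> //; have [l ld [h [k [mu [hS _ lmu hD]]]]] := PGL_torus_form coh.
have hu : h \in unitmx := SL_unit hS.
pose J := antidiag R m; pose A := h *m J *m h^T.
have Dcl z : z != 0 -> classical (Lparam psi z).
  move=> z0; have [val _] := pA; rewrite -Gdual.
  have [] // := val (z, false) (diag2 (sqrtC (absW (z, false))) (sqrtC (absW (z, false)))^-1).
  by apply: SL2_diag2; exact: sqrt_absW_neq0.
have TA z : z != 0 -> zpow_mx k mu z *m A *m (zpow_mx k mu z)^T = A.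
  by move=> z0; have [DJ _] := Dcl z z0; rewrite -(hD z z0) (conj_form (Lparam psi z) J hu) DJ.
have Au : A \in unitmx by rewrite !unitmx_mul unitmx_tr hu antidiag_unit.
have Ainv i j : A i j != 0 -> k 0 j = - k 0 i /\ mu 0 j = - mu 0 i.
  move=> Aij; apply: zpow_inv => z z0; have := isometry_entry (TA z z0) Aij.
  by rewrite !mxE.
have lE a : (reg l a)%:~R / 2 = mu 0 a + (k 0 a)%:~R :> C.
  by have /rowP/(_ a) := lmu; rewrite mxE regE !mxE => <-; rewrite addrCA subrr addr0.
have regA i j : A i j != 0 -> reg l j = - reg l i.
  move=> /Ainv[kj muj].
  have : (reg l j)%:~R / 2 = (- reg l i)%:~R / 2 :> C.
    by rewrite rmorphN mulNr !lE kj muj rmorphN opprD.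
  by move=> /(mulIf _); rewrite invr_eq0 pnatr_eq0 => /(_ isT) /intr_inj.
have [s sA] : exists s : 'I_m -> 'I_m, forall i, A i (s i) != 0.
  by apply: (@fin_all_exists _ (fun=> 'I_m) (fun i j => A i j != 0)) => i; exact: unitmx_row_neq0.
(* Picking one nonzero entry of $A$ in each row gives a map negating [reg l], which must be the
   reversal. *)
have srev := decr_eq_rev (fun i j => @reg_decr m l i j ld) (fun i => regA i (s i) (sA i)).
have Arev i : A i (rev_ord i) != 0 by rewrite -srev.
have la : antisym l by apply/reg_antisym => i; exact: regA.
have ka : antisym k by move=> i; have [] := Ainv i _ (Arev i).
have mua : antisym mu by move=> i; have [] := Ainv i _ (Arev i).
have A0 i j : j != rev_ord i -> A i j = 0.
  move=> ji; apply: contraNeq ji => /regA e; apply/eqP/(reg_inj ld).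
  by rewrite e (regA _ _ (Arev i)).
have [c c0 cl] := antidiag_congr_classical hu erefl A0.
have tf : torus_form (@classical R m) (Lparam psi) (map_mx (fun a : int => a%:~R) l + rhoGL R m).
  exists (diag_mx c *m h), k, mu; split=> //.
    split; [|exact: cocharC_classical|exact: cochar_classical].
    by apply: cocharC_classical => i; rewrite !regE (proj1 (reg_antisym l) la) rmorphN mulNr.
  have cu : diag_mx c \in unitmx.
    by rewrite unitmxE det_diag unitfE; apply/prodf_neq0 => i _; exact: c0.
  move=> z z0; rewrite (invmxM cu hu) !mulmxA -2!(mulmxA (diag_mx c)) hD // diag_mxC mulmxK //.
have [d [rho [irr iso hw]]] := Grep la ld.
exists d, rho, l; split=> //; first by split=> //; rewrite Gdual; exact: cochar_classical.
rewrite Grho rho_classicalE; apply: torus_form_in_inf_char; rewrite ?Gdual //.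
- exact: special_isometries1.
- exact: over_WR_A.
Qed.

Lemma conj_cohomological (psi : parameter PG) h : SL R m h ->
  cohomological psi -> cohomological (G := PG) (conj_param (G := PG) h psi).
Proof.
move=> hS coh; have [PA [d [rho [l' [[ra ir ck] iso [lc hw] ic]]]]] := coh.
have ld' : dominant l' := PGL_dominant ra hw.
have tf' := in_inf_char_torus_form (G := PG) SL_unit SL_M (over_WR_A PA) (regular_inj ld') ic.
have PA' := A_parameter_conj hS PA; split=> //; exists d, rho, l'; split=> //.
apply: (@torus_form_in_inf_char R PG).
- by rewrite /dual /= /SL /= det1.
- exact: over_WR_A PA'.
have -> : Lparam (G := PG) (conj_param (G := PG) h psi) =
    fun z => h *m Lparam (G := PG) psi z *m invmx h by apply/funext => z; exact: Lparam_conj.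
exact: torus_form_conj.
Qed.

Lemma SL_rescale (A : 'M[C]_m) : A \in unitmx -> exists2 c : C, c != 0 & SL R m (c *: A).
Proof.
move=> Au; have [m0|m0] := posnP m.
  exists 1; rewrite ?oner_neq0 // scale1r /SL /=; move: A Au; rewrite m0 => A _; exact: det_mx00.
have d0 : \det A != 0 by rewrite -unitfE -unitmxE.
exists (m.-root (\det A))^-1; first by rewrite invr_eq0 rootC_eq0.
by rewrite /SL /= detZ exprVn rootCK // mulVf.
Qed.

(** The invariant form satisfies $M^TBM = B$, while [classical] asks for $gJg^T = J$. As $J^2$ is a
    scalar, [tr_isometry] passes between the two. *)
Lemma conj_classical (c B M : 'M[C]_m) : c \in unitmx -> c *m B *m c^T = antidiag R m ->
  M \in unitmx -> M^T *m B *m M = B -> c^T = c -> \det M = 1 ->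
  classical (invmx c *m M *m c).
Proof.
move=> cu cB Mu MB cT Md; have s0 : (-1) ^+ m.-1 != 0 :> C by rewrite signr_eq0.
have cMu : (invmx c *m M *m c)^T \in unitmx by rewrite unitmx_tr !unitmx_mul unitmx_inv cu Mu.
have E : (invmx c *m M *m c)^T = c *m M^T *m invmx c by rewrite !trmx_mul trmx_inv cT mulmxA.
split; last by rewrite !det_mulmx Md mulr1 -det_mulmx mulVmx // det1.
have := tr_isometry (K := antidiag R m) (g := (invmx c *m M *m c)^T) s0 (antidiag_sq R m) cMu.
by rewrite trmxK; apply; rewrite -cB E cT; exact: conj_invariant_form.
Qed.

(** A diagonal $c$ turns the form of [invariant_form] into $J$. Conjugation by $c^{-1}h$ makes the
    values classical; a scalar puts this element into $\mathrm{SL}_m$ without changing the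
    conjugation. *)
Lemma PGL_to_classical (psi : parameter PG) : cohomological psi ->
  exists2 h, SL R m h & cohomological (G := Gr) (conj_param (G := PG) h psi).
Proof.
move=> coh; have [l ld [h [k [mu [hS _ lmu hD]]]]] := PGL_torus_form coh.
have hu : h \in unitmx := SL_unit hS.
pose psi1 := conj_param (G := PG) h psi; pose M w x : 'M[C]_m := (psi1 w x).1.
have [[val [mul cont ss reg [b bd]]] _] : cohomological (G := PG) psi1 := conj_cohomological hS coh.
have Md w x : WR w -> SL2 x -> \det (M w x) = 1 by move=> wW xS; have [] := val w x wW xS.
have Mu w x : WR w -> SL2 x -> M w x \in unitmx by move=> wW xS; apply: SL_unit; exact: Md.
have MM w w' x x' : WR w -> WR w' -> SL2 x -> SL2 x' ->
    M (mulW w w') (x *m x') = M w x *m M w' x'.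
  by move=> wW w'W xS x'S; rewrite /M mul // /mulL /actL /= if_same.
have MD z : z != 0 -> M (z, false) (diag2 (sqrtC (z * z^*)) (sqrtC (z * z^*))^-1) = zpow_mx k mu z.
  by move=> z0; rewrite -(hD z z0) -Lparam_conj.
have [wt wE] := torus_weights ld MM Mu reg MD lmu.
have [B [Bu B0 BT MB]] := invariant_form ld MM Mu reg bd MD lmu wE.
have [c c0 cB] := antidiag_scaling Bu B0 BT.
have cu : diag_mx c \in unitmx.
  by rewrite unitmxE det_diag unitfE; apply/prodf_neq0 => i _; exact: c0.
have [e e0 eS] : exists2 e : C, e != 0 & SL R m (e *: invmx (diag_mx c)).
  by apply: SL_rescale; rewrite unitmx_inv.
have h2S : SL R m (e *: invmx (diag_mx c) *m h) by exact: SL_M.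
exists (e *: invmx (diag_mx c) *m h); first exact: h2S.
have coh2 := conj_cohomological h2S coh; have [PA2 _] := coh2.
apply: cohomological_of_PGL coh2; apply: A_parameter_of_PGL PA2.
move=> w x wW xS; rewrite conj_paramE /=.
have -> : e *: invmx (diag_mx c) *m h *m (psi w x).1 *m invmx (e *: invmx (diag_mx c) *m h) =
    invmx (diag_mx c) *m M w x *m diag_mx c.
  rewrite /M /psi1 conj_paramE /= scale_conj ?unitmx_inv // invmxK //.
by apply: conj_classical cB (Mu _ _ wW xS) (MB _ _ wW xS) (tr_diag_mx _) (Md _ _ wW xS).
Qed.

End Transfer.

                       

(** * Unitary groups and restriction to $W_{\mathbb{C}}$ *)

Section UnitaryGroup.
Variables (R : realType) (p q : nat).
Local Notation C := (Cx R).
Local Notation m := (p + q)%N.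
Local Notation UG := (U R p q).
Local Notation GLm := (GL R m).

Lemma GL_weyl_orbit (n : 'M[C]_m) (l l' : 'rV[C]_m) : n \in unitmx -> injective (l' 0) ->
  n *m diag_mx l = diag_mx l' *m n -> weyl_orbit GLm l l'.
Proof.
move=> nu linj e; have E : n *m diag_mx l *m invmx n = diag_mx l' by rewrite e mulmxK.
exists n => //; split=> // t; have [s _ Hs] := monomial_of_diag nu linj E; split=> -[tG td].
  have [d td'] := diag_mxP _ td.
  split; first by rewrite /GL /= !unitmx_mul nu unitmx_inv nu tG.
  by rewrite td' Hs diag_mx_is_diag.
have tu : t \in unitmx by move: tG; rewrite /GL /= !unitmx_mul unitmx_inv => /andP[/andP[]].
have [d td'] := diag_mxP _ td; split=> //.
suff -> : t = diag_mx (col_perm s^-1 d) by exact: diag_mx_is_diag.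
apply: (can_inj (mulKmx nu)); apply: (can_inj (mulmxK (_ : invmx n \in unitmx))).
  by rewrite unitmx_inv.
by rewrite Hs td' -col_permM mulgV col_perm1.
Qed.

Lemma weyl_orbit_refl (l : 'rV[C]_m) : weyl_orbit GLm l l.
Proof.
exists 1%:M; last by rewrite invmx1 mulmx1 mul1mx.
by split=> [|t]; [exact: GLN1 | rewrite invmx1 mulmx1 mul1mx].
Qed.

Lemma cochar_GL (k : 'rV[int]_m) : cochar GLm k.
Proof.
move=> z z0; split; last exact: diag_mx_is_diag.
rewrite /GL /= unitmxE det_diag unitfE; apply/prodf_neq0 => i _.
by rewrite mxE expfz_neq0.
Qed.

Lemma cocharC_GL (l : 'rV[C]_m) : cocharC GLm l.
Proof.
exists m, (fun i => l 0 i), (fun i => delta_mx 0 i); split; first by move=> i; exact: cochar_GL.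
rewrite {1}[l]row_sum_delta; apply: eq_bigr => i _; congr (_ *: _).
by apply/rowP => j; rewrite !mxE; case: (_ && _).
Qed.

Lemma A_parameter_restr (psi : parameter UG) : A_parameter psi -> A_parameter_GLC (restr_WC psi).
Proof.
move=> [val [mul cont ss reg [b bd]]]; split; [|split].
- by move=> z x z0 xS; have [] := val (z, false) x z0 xS.
- move=> z z' x x' z0 z'0 xS x'S; rewrite /restr_WC -mulWff mul //.
  by rewrite /mulL /actL; have [_ ->] := val (z, false) x z0 xS.
- exact: cont false.
- move=> z z0; have := ss (z, false) z0; rewrite /semisimpleL /Lrep.
  have [|_ ->] := val (z, false) 1%:M z0; first by rewrite /SL2 /= det1.
  exact: diagonalizable_block.
- exact: reg.
by exists b => z i j z0; exact: bd.
Qed.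

Lemma has_hw_GL d (rho : 'M[C]_m -> 'M[C]_d) (l : 'rV[int]_m) :
  has_highest_weight (G := UG) rho l <->
  exists2 v : 'cV[C]_d, v != 0 & forall b, is_trig_mx b^T -> GLm b ->
    rho b *m v = (\prod_i b i i ^ l 0 i) *: v.
Proof.
have wE (b : 'M[C]_m) : weight_char (G := UG) l b = \prod_i b i i ^ l 0 i.
  by rewrite weight_charE /= trunc_id.
split=> [[h -> [v v0 vB]]|[v v0 vB]].
  exists v => // b bt Gb; have := vB b bt; rewrite invmx1 mulmx1 mul1mx => /(_ Gb) ->.
  by rewrite wE.
exists 1%:M => //; exists v => // b bt; rewrite invmx1 mulmx1 mul1mx => Gb.
by rewrite wE; exact: vB.
Qed.

                                                                            
                                                           
(** The parameter applied to $jz = \bar zj$; in the $L$-group $j$ acts on the value at $z$ by the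
    pinned automorphism. *)
Lemma U_conj_relation (psi : parameter UG) : A_parameter psi ->
  exists2 B : 'M[C]_m, B \in unitmx &
    forall z, z != 0 -> B *m pinned_aut (Lparam psi z) = Lparam psi z^* *m B.
Proof.
move=> [val [mul _ _ _ _]]; have S1 : SL2 (1%:M : 'M[C]_2) by rewrite /SL2 /= det1.
have W1 : WR ((1, true) : weil R) by rewrite /WR /= oner_neq0.
have [Bu B2] := val (1, true) 1%:M W1 S1; exists (psi (1, true) 1%:M).1 => // z z0.
have zS : SL2 (diag2 (sqrtC (z * z^*)) (sqrtC (z * z^*))^-1) by apply: SL2_diag2; exact: sqrt_absW_neq0.
have z'0 : z^* != 0 by rewrite conjC_eq0.
have zW : WR ((z, false) : weil R) := z0; have z'W : WR ((z^*, false) : weil R) := z'0.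
have e1 := mul _ _ _ _ W1 zW S1 zS; have e2 := mul _ _ _ _ z'W W1 zS S1.
have [_ p2] := val _ _ z'W zS.
have : psi (mulW (1, true) (z, false)) (1%:M *m diag2 (sqrtC (z * z^*)) (sqrtC (z * z^*))^-1) =
       psi (mulW (z^*, false) (1, true)) (diag2 (sqrtC (z * z^*)) (sqrtC (z * z^*))^-1 *m 1%:M).
  by rewrite mulmx1 mul1mx mulWtf mulWft mulr1 mul1r.
rewrite e1 e2 => /(congr1 fst); rewrite /mulL /actL B2 p2 /=.
by rewrite /Lparam /L_parameter /absW /= conjCK (mulrC z^*).
Qed.

Lemma conj_pinned_aut (F : fieldType) (B D J h T T' : 'M[F]_m) :
  B \in unitmx -> J \in unitmx -> h \in unitmx -> D \in unitmx ->
  h *m D *m invmx h = T -> B *m (J *m invmx D^T *m invmx J) = invmx h *m T' *m h *m B ->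
  (h *m B *m J *m h^T) = T' *m (h *m B *m J *m h^T) *m T^T.
Proof.
move=> Bu Ju hu Du <- e.
have hTu : h^T \in unitmx by rewrite unitmx_tr.
have DTu : D^T \in unitmx by rewrite unitmx_tr.
have e' : h *m B *m J *m invmx D^T = T' *m h *m B *m J.
  have := congr1 (fun X => h *m X *m J) e; rewrite !mulmxA mulmxKV // => ->.
  by rewrite !mulmxV // mul1mx.
rewrite (trmx_mul (h *m D)) (trmx_mul h D) trmx_inv !mulmxA mulmxK //.
by rewrite -e' mulmxKV.
Qed.

(** In diagonal form, the matrix $Q = hBJh^T$ built from $\psi(j)$ intertwines the dual of
    $z^\lambda\bar z^\mu$ with $z^\mu\bar z^\lambda$. A nonzero $Q_{ij}$ thus gives $\mu_j =
    -\lambda_i$, and $Q$ itself carries $\mu$ to $-\lambda$ as a Weyl element. *)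
Lemma U_infinitesimal_character (psi : parameter UG) (l : 'rV[int]_m) : A_parameter psi ->
  dominant l -> let L := map_mx (fun a : int => a%:~R) l + rhoGL R m in
  in_inf_char psi L -> in_inf_char_GLC (restr_WC psi) L (- L).
Proof.
move=> pA ld L ic; have Linj := regular_inj (R := R) ld.
have [h [k [mu [hu _ lmu hD]]]] : torus_form GLm (Lparam psi) L.
  exact: (in_inf_char_torus_form (G := UG) (fun g gu => gu) (@GLN_M R m) (over_WR_A pA) Linj ic).
have [B Bu BD] := U_conj_relation pA.
have Du z : z != 0 -> Lparam psi z \in unitmx.
  move=> z0; have [val _] := pA; have [] // := val (z, false) (diag2 (sqrtC (absW (z, false))) (sqrtC (absW (z, false)))^-1) z0.
  by apply: SL2_diag2; exact: sqrt_absW_neq0.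
pose J := antidiag R m; have Ju : J \in unitmx := antidiag_unit R m.
pose Q := h *m B *m J *m h^T.
have Qu : Q \in unitmx by rewrite !unitmx_mul unitmx_tr Ju Bu hu.
have QT z : z != 0 -> Q = zpow_mx k mu z^* *m Q *m (zpow_mx k mu z)^T.
  move=> z0; apply: (conj_pinned_aut Bu Ju hu (Du z z0) (hD z z0)).
  have z'0 : z^* != 0 by rewrite conjC_eq0.
  by rewrite -(hD _ z'0) -(mulmxA h) (mulKmx hu) (mulmxKV hu); exact: BD.
clearbody Q; have Qmu i j : Q i j != 0 -> mu 0 j = - L 0 i.
  move=> Qij; have lE : L 0 i = mu 0 i + (k 0 i)%:~R.
    have /rowP/(_ i) := lmu; rewrite mxE [(- mu) 0 i]mxE [RHS]mxE => <-.
    by rewrite addrCA subrr addr0.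
  have [|_ ->] := @zpow_inv R (- k 0 i) (k 0 j) (mu 0 i + (k 0 i)%:~R) (mu 0 j); last by rewrite lE.
  move=> z z0; rewrite -zpow_conj //; have := congr1 (fun X : 'M[C]_m => X i j) (QT z z0).
  rewrite tr_diag_mx mul_mx_diag mul_diag_mx !mxE => e.
  by apply: (mulIf Qij); rewrite mul1r [RHS]e mulrAC.
exists h, L, mu, k; split; [exact: hu|exact: lmu|exact: hD|exact: weyl_orbit_refl|].
apply: (@GL_weyl_orbit Q) => //.
  by move=> i j; rewrite !mxE => /oppr_inj; have := @Linj i j; rewrite !mxE.
rewrite mul_mx_diag mul_diag_mx; apply/matrixP => i j; rewrite !mxE.
have [->|/Qmu ->] := eqVneq (Q i j) 0; first by rewrite mul0r mulr0.
by rewrite mulrC !mxE.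
Qed.

(** Both sides use the same representation of $\mathrm{GL}_m(\mathbb{C})$, and $\theta$ is
    conjugation by $I_{p,q}$, hence inner. The first component of the pair of exponents is the
    infinitesimal character for $\mathrm{U}(p,q)$; the second is supplied by
    [U_infinitesimal_character]. *)
Lemma U_cohomological (psi : parameter UG) : A_parameter psi ->
  (cohomological psi <-> cohomological_GLC (restr_WC psi)).
Proof.
move=> pA; split=> [[_ [d [rho [l [[ra irr _] _ [_ hw] ic]]]]]|[_ [d [rho [l [ra irr hw ic]]]]]].
  split; first exact: A_parameter_restr.
  have [v v0 vB] := proj1 (has_hw_GL rho l) hw.
  have ld : dominant l by apply: (GL_hw_dominant ra v0) => b [Gb bt]; exact: vB.
  exists d, rho, l; split=> //; first by exists v.
  exact: U_infinitesimal_character.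
split=> //; exists d, rho, l; split.
- by split=> // z ->; exact: alg_rep1 (GLN1 R m) ra.
- have II := Ipq_sq R p q; have [Iu _] := mulmx1_unit II.
  have Ii : invmx (Ipq R p q) = Ipq R p q by apply: (can_inj (mulKmx Iu)); rewrite mulmxV.
  have := conj_rep_iso ra (@GLN_M R m) Iu Iu; rewrite Ii; exact.
- by split; [exact: cochar_GL | apply/has_hw_GL].
have [h [l0 [mu0 [k [hu lmu hD lw _]]]]] := ic.
exists h, l0, mu0, k; split=> //.
  by split=> //; [exact: cocharC_GL | exact: cocharC_GL | exact: cochar_GL].
by move=> z z0; rewrite (conjL_Lparam _ (over_WR_A pA) z0) -hD.
Qed.

End UnitaryGroup.

Theorem theorem2 (R : realType) :
           
  [/\ forall n : nat,
        (dual (r := Sp2n R n) `<=` dual (r := PGL R n.*2.+1))%classic /\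
        forall psi : parameter (Sp2n R n), A_parameter psi ->
          (cohomological psi <-> cohomological (G := PGL R n.*2.+1) psi),
      forall p q : nat, odd (p + q) ->
        (dual (r := SO R p q) `<=` dual (r := PGL R (p + q).-1))%classic /\
        forall psi : parameter (SO R p q), A_parameter psi ->
          (cohomological psi <-> cohomological (G := PGL R (p + q).-1) psi),
      forall (n : nat) (psi : parameter (PGL R n.*2.+1)), cohomological psi ->
        exists2 h, SL R n.*2.+1 h &
          cohomological (G := Sp2n R n)
            (conj_param (G := PGL R n.*2.+1) h psi) &
      forall (p q : nat) (psi : parameter (PGL R (p + q).-1)), odd (p + q) ->
        cohomological psi ->
        exists2 h, SL R (p + q).-1 h &
          cohomological (G := SO R p q)
            (conj_param (G := PGL R (p + q).-1) h psi)]
            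
  /\ forall (p q : nat) (psi : parameter (U R p q)), A_parameter psi ->
       (cohomological psi <-> cohomological_GLC (restr_WC psi)).
Proof.
split; last by move=> p q psi; exact: U_cohomological.
split.
- move=> n; split; first by move=> g; exact: classical_sub_SL.
  move=> psi pA; split.
    by apply: (@cohomological_PGL R (Sp2n R n)) => //; exact: Sp_dominant.
  by apply: (@cohomological_of_PGL R (Sp2n R n)) => //; exact: Sp_rep.
- move=> p q oN; split; first by move=> g; exact: classical_sub_SL.
  move=> psi pA; split.
    by apply: (@cohomological_PGL R (SO R p q)) => // l d rho; exact: SO_dominant.
  by apply: (@cohomological_of_PGL R (SO R p q)) => // l; exact: SO_rep.
- move=> n psi; apply: (@PGL_to_classical R (Sp2n R n)) => //; exact: Sp_rep.
by move=> p q psi oN; apply: (@PGL_to_classical R (SO R p q)) => // l; exact: SO_rep.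
Qed.
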